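(* Let $\mathbb{K}$ be a field of characteristic $0$, let $w,x,y,z$ be non-negative integers, and let $Y\subset\mathbb{P}^3=\mathbb{P}^3(\mathbb{K})$ be a general union of $w$ 5-points, $x$ 4-points, $y$ 3-points and $z$ 2-points. Then $Y$ has good postulation in degree $10$, except exactly when $(w,x,y,z)$ is one of the following nine 4-tuples (for which $Y$ does not have good postulation in degree $10$): $$(9,0,0,0),\ (8,1,0,0),\ (8,0,1,1),\ (8,0,1,0),\ (8,0,0,2),\ (8,0,0,1),\ (7,2,0,1),\ (7,1,2,0),\ (7,2,0,0).$$
   Context: The field $\mathbb{K}$ is not assumed algebraically closed. An $m$-point (fat point of multiplicity $m$) $mP$ of $\mathbb{P}^3$ is the zero-dimensional closed subscheme with ideal sheaf $(\mathcal{I}_{P,\mathbb{P}^3})^m$, where $P\in\mathbb{P}^3$; its length is $\binom{m+2}{3}$. A general union of $k$ fat points with prescribed multiplicities is $Y=m_1P_1+\dots+m_kP_k$ with $P_1,\dots,P_k$ general points of $\mathbb{P}^3$ (i.e. $(P_1,\dots,P_k)$ ranges in some non-empty Zariski open subset of $(\mathbb{P}^3)^k$); $\deg(Y)$ is the sum of the lengths of its components. A zero-dimensional scheme $Y\subset\mathbb{P}^3$ has good postulation in degree $d$ if: (a) when $\deg(Y)\le\binom{d+3}{3}$, $h^1(\mathbb{P}^3,\mathcal{I}_Y(d))=0$; and (b) when $\deg(Y)\ge\binom{d+3}{3}$, $h^0(\mathbb{P}^3,\mathcal{I}_Y(d))=0$. *)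

(* Defs.v *)
From HB Require Import structures.
From mathcomp Require Import all_boot all_order all_algebra.
From mathcomp Require Import fraction.
From mathcomp Require Import mpoly.

Set Implicit Arguments.
Unset Strict Implicit.
Unset Printing Implicit Defensive.

Import GRing.Theory.
Local Open Scope ring_scope.

Definition ideal_span (R : comNzRingType) (G : R -> Prop) (f : R) : Prop :=
  exists (n : nat) (c g : 'I_n -> R),
    (forall i, G (g i)) /\ f = \sum_(i < n) c i * g i.

Definition ideal_pow (R : comNzRingType) (I : R -> Prop) (m : nat) : R -> Prop :=
  ideal_span (fun f => exists2 g : 'I_m -> R,
                         (forall j, I (g j)) & f = \prod_(j < m) g j).

Section FatPoints.

Variable K : fieldType.

(* A point of P^3 is given by homogeneous coordinates, that is, by a nonzero  *)
(* row vector; all the notions below are invariant under rescaling it.        *)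
Definition point_ideal (v : 'rV[K]_4) : {mpoly K[4]} -> Prop :=
  ideal_span (fun f => (exists e : nat, f \is e.-homog)
                       /\ f.@[fun i => v 0 i] = 0).

(* The multiplicities are listed in ms; the a-th row of P holds homogeneous   *)
(* coordinates of the point of multiplicity ms`_a. The scheme-theoretic union *)
(* corresponds to the intersection of the ideals.                             *)
Definition fat_ideal (ms : seq nat) (P : 'M[K]_(size ms, 4))
    (f : {mpoly K[4]}) : Prop :=
  forall a : 'I_(size ms),
    ideal_pow (point_ideal (row a P)) (nth 0%N ms a) f.

Definition fat_degree (ms : seq nat) : nat := (\sum_(m <- ms) 'C(m + 2, 3))%N.

(* For a homogeneous ideal I with associated ideal sheaf I~ on P^3, and h a   *)
(* nonzero form of positive degree: the sections of I~(d) over D_+(h), i.e.   *)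
(* the elements of degree d of the localization I_h. Since I~ is a subsheaf   *)
(* of the structure sheaf, all of them live in the fraction field, where the  *)
(* restriction maps become inclusions.                                        *)
Definition twisted_section (I : {mpoly K[4]} -> Prop) (d : nat)
    (h : {mpoly K[4]}) (u : {fraction {mpoly K[4]}}) : Prop :=
  exists (n e : nat) (f : {mpoly K[4]}),
    [/\ h ^+ n \is e.-homog, f \is (d + e)%N.-homog, I f
      & u = tofrac f / tofrac (h ^+ n)].

(* Vanishing of H^0(P^3, I~(d)) and H^1(P^3, I~(d)), computed as the Cech     *)
(* cohomology of the affine cover of P^3 by the four D_+('X_i).               *)
Definition H0_vanishes (I : {mpoly K[4]} -> Prop) (d : nat) : Prop :=
  forall s : {fraction {mpoly K[4]}},
    (forall i, twisted_section I d 'X_i s) -> s = 0.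

Definition H1_vanishes (I : {mpoly K[4]} -> Prop) (d : nat) : Prop :=
  forall t : 'I_4 -> 'I_4 -> {fraction {mpoly K[4]}},
    (forall i j, twisted_section I d ('X_i * 'X_j) (t i j)) ->
    (forall i j k, t i k = t i j + t j k) ->
    exists s : 'I_4 -> {fraction {mpoly K[4]}},
      (forall i, twisted_section I d 'X_i (s i))
      /\ (forall i j, t i j = s j - s i).

Definition good_postulation (d : nat) (ms : seq nat)
    (P : 'M[K]_(size ms, 4)) : Prop :=
  ((fat_degree ms <= 'C(d + 3, 3))%N -> H1_vanishes (fat_ideal P) d)
  /\ (('C(d + 3, 3) <= fat_degree ms)%N -> H0_vanishes (fat_ideal P) d).

Definition multicoords (k : nat) (P : 'M[K]_(k, 4)) : Prop :=
  forall a : 'I_k, row a P != 0.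

(* The variable of index mxvec_index a j is the j-th homogeneous coordinate   *)
(* on the a-th factor of (P^3)^k.                                             *)
Definition multihomog (k : nat) (F : {mpoly K[k * 4]}) : Prop :=
  exists e : 'I_k -> nat, forall mu, mu \in msupp F ->
    forall a : 'I_k, (\sum_(j < 4) mu (mxvec_index a j))%N = e a.

Definition zariski_open (k : nat) (U : 'M[K]_(k, 4) -> Prop) : Prop :=
  exists E : {mpoly K[k * 4]} -> Prop,
    (forall F, E F -> multihomog F) /\
    (forall P, multicoords P ->
       (U P <-> exists2 F, E F & F.@[fun l => mxvec P 0 l] != 0)).

(* The open set may always be shrunk so that the k points are distinct.       *)
Definition for_general (k : nat) (Q : 'M[K]_(k, 4) -> Prop) : Prop :=
  exists U : 'M[K]_(k, 4) -> Prop,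
    [/\ zariski_open U,
        exists2 P, multicoords P & U P
      & forall P, multicoords P -> U P -> Q P].

End FatPoints.

Definition multiplicities (w x y z : nat) : seq nat :=
  nseq w 5 ++ nseq x 4 ++ nseq y 3 ++ nseq z 2.

(* Main.v *)
From Stdlib Require Import BinNat Nnat.
Require Import Defs.
From mathcomp Require Import all_boot all_order all_algebra.
From mathcomp Require Import fraction mpoly.
From mathcomp Require Import zify ring.

(* For homogeneous forms, membership in the m-th power of the ideal of a point *)
(* means that all derivatives of order less than m vanish there (Euler, in    *)
(* characteristic 0). So h^0 = 0, resp. h^1 = 0, says that the linear         *)
(* conditions imposed on forms of degree 10 have full column, resp. row, rank, *)
(* an open property: one good choice of points suffices for each (w,x,y,z).   *)
(*                                                                            *)
(* Good points are found in the torus by a degeneration. At p the conditions  *)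
(* read sum_s c_s Q(s) p^s = 0 for all polynomials Q of degree less than m in *)
(* the exponent s. If the set of exponents is cut by an affine hyperplane and *)
(* the points are split accordingly, then moving the first points by a        *)
(* one-parameter subgroup t^a makes the matrix block triangular at t = 0. It  *)
(* is therefore enough to cut the simplex of 286 exponents successively into  *)
(* pieces so that no nonzero polynomial of degree less than m vanishes on the *)
(* piece of an m-fold point (or so that values on the piece are arbitrary):   *)
(* finitely many small ranks, checked modulo 101.                             *)
(*                                                                            *)
(* For the nine exceptions, products of quadrics through nine of the points   *)
(* with forms of lower degree give more forms than expected.                  *)

Set Implicit Arguments.
Unset Strict Implicit.
Unset Printing Implicit Defensive.

Import GRing.Theory.
Local Open Scope ring_scope.


(** On forms of degree 10, vanishing at the fat points is a system of linear equations, one for each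
    derivative of order m - 1 at each m-point. Good postulation says that this system has maximal
    rank: h^0 = 0 is injectivity on forms ([nonsingular]), h^1 = 0 is independence of the equations
    ([independent]). The sheaf side is reached through [vanish_ideal_pow], [H0_of_nonsingular],
    [H1_of_independent] and, for the converse needed by the exceptions, [independent_of_H1]. Maximal
    rank is the nonvanishing of a multihomogeneous minor, so a single configuration in the torus
    gives it for general points ([for_general_realizable]).

    The configuration comes from toric degenerations. [realizable_cut] distributes the points over
    the two sides of a hyperplane cutting the set of exponents, and [point_checkP] settles a single
    point by a rank modulo 101. Monotonicity in the multiplicities, together with the exchange of a
    4-point for five 2-points of the same total length 20, reduces the infinitely many tuples to
    finitely many certificates; [realizable10_nonexceptional] collects the result.

    In the exceptional cases quadrics through nine of the points are responsible. Either a product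
    of powers of such quadrics, possibly with one further form, is an unexpected form
    ([not_good_H0]), or the multiples of such a product fill a space larger than independence allows
    ([independent_multiples], [not_good_H1]). *)

(** * Matrices of full rank: minors, specialization and reduction modulo a prime *)

Section Independence.

Variable K : fieldType.

(** This is full column rank. Exchanging the arguments of [e] turns it into full row rank, so one
    notion serves both for h^0 = 0 and for h^1 = 0. *)
Definition indep (X Y : eqType) (e : X -> Y -> K) (xs : seq X) (ys : seq Y) :=
  forall c : Y -> K, (forall x, x \in xs -> \sum_(y <- ys) c y * e x y = 0) ->
    forall y, y \in ys -> c y = 0.

Variables X Y : eqType.
Implicit Types (e : X -> Y -> K) (xs : seq X) (ys : seq Y).

Lemma indep_sub e xs xs' ys :
  {subset xs <= xs'} -> indep e xs ys -> indep e xs' ys.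
Proof. by move=> sub ind c c0; apply: ind => x /sub /c0. Qed.

Lemma indep_subr e xs ys ys' :
  uniq ys -> uniq ys' -> {subset ys' <= ys} -> indep e xs ys -> indep e xs ys'.
Proof.
move=> uys uys' sub ind c c0 y ysy.
have := ind (fun y => if y \in ys' then c y else 0) _ y (sub _ ysy).
rewrite ysy; apply=> x /c0 c0x; rewrite -[RHS]c0x.
rewrite (bigID (mem ys')) /= [X in _ + X]big1 ?addr0; last first.
  by move=> i /negbTE ->; rewrite mul0r.
rewrite -big_filter (perm_big ys').
  by apply: eq_big_seq => i ->.
apply: uniq_perm; rewrite ?filter_uniq // => i.
by rewrite mem_filter andb_idr //; apply: sub.
Qed.

Lemma indep_perm e xs ys ys' : perm_eq ys ys' -> indep e xs ys -> indep e xs ys'.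
Proof.
move=> pys ind c c0 y; rewrite -(perm_mem pys) => ysy.
by apply: ind ysy => x /c0; rewrite (perm_big _ pys).
Qed.

Lemma indep_scale (r : X -> K) (s : Y -> K) e e' xs ys :
    (forall x, x \in xs -> r x != 0) -> (forall y, y \in ys -> s y != 0) ->
    (forall x y, x \in xs -> y \in ys -> e x y * r x = e' x y * s y) ->
  indep e' xs ys -> indep e xs ys.
Proof.
move=> r0 s0 ee ind c c0 y ysy; apply: (mulIf (s0 _ ysy)); rewrite mul0r.
apply: (ind (fun y => c y * s y)) ysy => x xsx.
transitivity ((\sum_(z <- ys) c z * e x z) * r x); last by rewrite c0 ?mul0r.
rewrite mulr_suml; apply: eq_big_seq => z zys.
by rewrite -!mulrA ee // (mulrC (s z)).
Qed.

Lemma eq_indep e e' xs ys :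
  (forall x y, x \in xs -> y \in ys -> e x y = e' x y) ->
  indep e xs ys -> indep e' xs ys.
Proof.
move=> ee; apply: (@indep_scale (fun=> 1) (fun=> 1)); rewrite ?oner_eq0 //.
by move=> x y xx yy; rewrite !mulr1 ee.
Qed.

(** Full column rank provides an invertible maximal minor. Through it independence becomes the
    nonvanishing of one determinant, which can be specialized, reduced modulo a prime, or regarded
    as a polynomial in the coordinates of the points. *)
Lemma indep_minor e xs ys : uniq ys -> indep e xs ys ->
  exists2 f : 'I_(size ys) -> X, (forall i, f i \in xs) &
    \det (\matrix_(i, j) e (f i) (tnth (in_tuple ys) j)) != 0.
Proof.
move=> uys ind.
pose A : 'M_(size xs, size ys) :=
  \matrix_(i, j) e (tnth (in_tuple xs) i) (tnth (in_tuple ys) j).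
have : row_free A^T.
  apply: inj_row_free => v vA.
  pose c y := if insub (index y ys) is Some j then v 0 j else 0.
  have cE (j : 'I_(size ys)) : c (tnth (in_tuple ys) j) = v 0 j.
    rewrite /c (tnth_nth (tnth (in_tuple ys) j)) /= index_uniq //.
    by rewrite valK.
  apply/rowP => j; rewrite mxE -cE; apply: (ind c); last exact: mem_tnth.
  move=> x xsx; have /matrixP/(_ 0) := vA.
  have xlt : (index x xs < size xs)%N by rewrite index_mem.
  move=> /(_ (Ordinal xlt)); rewrite !mxE => vx; rewrite -[RHS]vx [LHS]big_tnth.
  apply: eq_bigr => i _; rewrite !mxE cE; congr (_ * e _ _).
  by rewrite (tnth_nth x) /= nth_index.
rewrite /row_free mxrank_tr => fA.
have fA' : row_full A by [].
exists (fun i => tnth (in_tuple xs) (fullrankfun fA' i)).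
  by move=> i; apply: mem_tnth.
have := fullrowsub_unit fA'; rewrite unitmxE unitfE.
by congr (\det _ != 0); apply/matrixP => i j; rewrite !mxE.
Qed.

Lemma minor_indep e xs ys (f : 'I_(size ys) -> X) : (forall i, f i \in xs) ->
  \det (\matrix_(i, j) e (f i) (tnth (in_tuple ys) j)) != 0 -> indep e xs ys.
Proof.
move=> fxs dn0 c c0 y ysy; set B := \matrix_(i, j) _ in dn0.
have uB : B \in unitmx by rewrite unitmxE unitfE.
pose v := \col_j c (tnth (in_tuple ys) j).
have Bv : B *m v = 0.
  apply/colP => i; rewrite !mxE -[RHS](c0 _ (fxs i)) [RHS]big_tnth.
  by apply: eq_bigr => j _; rewrite !mxE mulrC.
have : v = 0 by rewrite -(mulKmx uB v) Bv mulmx0.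
move=> /colP v0; have ylt : (index y ys < size ys)%N by rewrite index_mem.
have := v0 (Ordinal ylt); rewrite !mxE (tnth_nth y) /= nth_index //.
Qed.

End Independence.

Section SameKernel.

Variable K : fieldType.
Variables X X' Y : eqType.

(** The primed equations imply the unprimed ones, so their solution space is no larger and their
    rank no smaller. As both systems have the same number of equations, full rank passes from the
    unprimed system to the primed one. *)
Lemma indep_same_kernel (e : X -> Y -> K) (e' : X' -> Y -> K) xs xs' ys :
    uniq xs -> uniq xs' -> uniq ys -> size xs = size xs' ->
    (forall c : Y -> K,
       (forall x, x \in xs' -> \sum_(y <- ys) c y * e' x y = 0) ->
       (forall x, x \in xs -> \sum_(y <- ys) c y * e x y = 0)) ->
  indep (fun y x => e x y) ys xs -> indep (fun y x => e' x y) ys xs'.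
Proof.
move=> uxs uxs' uys sxs ker ind.
pose A := \matrix_(j < size ys, i < size xs)
  e (tnth (in_tuple xs) i) (tnth (in_tuple ys) j).
pose A' := \matrix_(j < size ys, i < size xs')
  e' (tnth (in_tuple xs') i) (tnth (in_tuple ys) j).
have rA : \rank A = size xs.
  have [f fys dn0] := indep_minor uxs ind.
  apply/eqP; rewrite eqn_leq rank_leq_col /=.
  have g i : {j : 'I_(size ys) | tnth (in_tuple ys) j = f i}.
    have jlt : (index (f i) ys < size ys)%N by rewrite index_mem.
    by exists (Ordinal jlt); rewrite (tnth_nth (f i)) /= nth_index.
  have rB : \rank (rowsub (fun i => sval (g i)) A) = size xs.
    apply/eqP; rewrite [_ == _]row_free_unit unitmxE unitfE.
    congr (\det _ != 0): dn0; apply/matrixP => i j; rewrite !mxE.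
    by case: (g i) => k /= ->.
  by rewrite -[leqLHS]rB; apply/mxrankS/rowsub_sub.
have kerS : (kermx A' <= kermx A)%MS.
  apply/rV_subP => v /sub_kermxP vA'; apply/sub_kermxP/rowP => i.
  pose c y := if insub (index y ys) is Some j then v 0 j else 0.
  have cE (j : 'I_(size ys)) : c (tnth (in_tuple ys) j) = v 0 j.
    rewrite /c (tnth_nth (tnth (in_tuple ys) j)) /= index_uniq //.
    by rewrite valK.
  rewrite !mxE -[RHS](ker c _ (tnth (in_tuple xs) i)) ?mem_tnth //.
    by rewrite [RHS]big_tnth; apply: eq_bigr => j _; rewrite !mxE cE.
  move=> x xsx; have xlt : (index x xs' < size xs')%N by rewrite index_mem.
  have /rowP/(_ (Ordinal xlt)) := vA'; rewrite !mxE => vx.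
  rewrite -[RHS]vx [LHS]big_tnth.
  apply: eq_bigr => j _; rewrite !mxE cE; congr (_ * e' _ _).
  by rewrite (tnth_nth x) /= nth_index.
have := mxrankS kerS; rewrite !mxrank_ker rA => le.
have rA' : \rank A' = size xs'.
  apply/eqP; rewrite eqn_leq rank_leq_col /= -[leqLHS]sxs.
  have := rank_leq_row A; have := rank_leq_row A'; rewrite rA; move: le.
  by move: (\rank A') => r; lia.
move=> c c0 x xsx.
pose v := \col_i c (tnth (in_tuple xs') i).
have : A' *m v = 0.
  apply/colP => j; rewrite !mxE -[RHS](c0 (tnth (in_tuple ys) j)) ?mem_tnth //.
  by rewrite [RHS]big_tnth; apply: eq_bigr => i _; rewrite !mxE mulrC.
have fA' : row_full A' by rewrite /row_full rA'.
move=> /(congr1 (mulmx (pinvmx A'))); rewrite mulmx0 mulmxA mulVpmx // mul1mx.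
move/colP; have xlt : (index x xs' < size xs')%N by rewrite index_mem.
by move/(_ (Ordinal xlt)); rewrite !mxE (tnth_nth x) /= nth_index.
Qed.

End SameKernel.

Lemma natr_inj_pchar0 (K : fieldType) : [pchar K] =i pred0 ->
  injective (fun n : nat => n%:R : K).
Proof.
move=> /pcharf0P nat0 m n; wlog le_mn : m n / (m <= n)%N => [H|].
  by case/orP: (leq_total m n) => le E; [apply: H | apply/esym/H].
move=> E; apply/eqP; rewrite eqn_leq le_mn /= -subn_eq0 -nat0 natrB //.
by rewrite /= in E; rewrite E subrr.
Qed.

(** Characteristic 0 makes the values [n%:R] distinct, and there are more of them than roots. *)
Lemma poly_nonroot (K : fieldType) (q : {poly K}) :
  [pchar K] =i pred0 -> q != 0 -> exists n : nat, q.[n%:R] != 0.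
Proof.
move=> charK q0; have inj := natr_inj_pchar0 charK.
pose s := [seq n%:R : K | n <- iota 0 (size q)].
case: (boolP (all (root q) s)) => [rs|].
  have us : uniq s by rewrite map_inj_uniq ?iota_uniq.
  by have := max_poly_roots q0 rs us; rewrite size_map size_iota ltnn.
by case/allPn => _ /mapP[n _ ->] rn; exists n.
Qed.

Lemma indep_specialize (K : fieldType) (X Y : eqType) (e : X -> Y -> {poly K})
    xs ys : [pchar K] =i pred0 -> uniq ys ->
    indep (fun x y => (e x y).[0]) xs ys ->
  exists2 t : K, t != 0 & indep (fun x y => (e x y).[t]) xs ys.
Proof.
move=> charK uys /(indep_minor uys)[f fxs dn0].
pose M := \matrix_(i, j) e (f i) (tnth (in_tuple ys) j).
have detM t : \det (\matrix_(i, j) (e (f i) (tnth (in_tuple ys) j)).[t])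
    = (\det M).[t].
  rewrite -horner_evalE -det_map_mx; congr (\det _).
  by apply/matrixP => i j; rewrite !mxE.
(* The factor ['X] forces the nonroot found below to be nonzero. *)
have q0 : 'X * \det M != 0.
  rewrite mulf_neq0 ?polyX_eq0 //; apply: contra dn0 => /eqP M0.
  by rewrite (detM 0) M0 horner0.
have [n] := poly_nonroot charK q0.
rewrite hornerM hornerX mulf_eq0 negb_or => /andP[n0 dn].
by exists n%:R => //; apply: (minor_indep fxs); rewrite detM.
Qed.

(** The minor over each field is the image of one integer determinant; an integer that is nonzero
    modulo [p] stays nonzero in characteristic 0. *)
Lemma indep_mod (K : fieldType) (p : nat) (X Y : eqType) (e : X -> Y -> nat)
    xs ys : [pchar K] =i pred0 -> prime p -> uniq ys ->
    indep (fun x y => (e x y)%:R : 'F_p) xs ys ->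
  indep (fun x y => (e x y)%:R : K) xs ys.
Proof.
move=> charK pr uys /(indep_minor uys)[f fxs dn0].
apply: (minor_indep fxs).
pose M : 'M[int]_(size ys) := \matrix_(i, j) (e (f i) (tnth (in_tuple ys) j))%:R.
have detM (F : fieldType) :
    \det (\matrix_(i, j) (e (f i) (tnth (in_tuple ys) j))%:R : 'M[F]_(size ys))
    = (\det M)%:~R.
  rewrite -det_map_mx; congr (\det _); apply/matrixP => i j; rewrite !mxE.
  by rewrite rmorph_nat.
rewrite detM in dn0; rewrite detM; apply: contra dn0; set d := \det M.
have nat0 n : (n.+1%:R : K) != 0 by have /pcharf0P -> := charK.
case: (intP d) => [|n|n] dK; first by rewrite mulr0z.
  by have := nat0 n; rewrite pmulrn dK.
by have := nat0 n; rewrite pmulrn -oppr_eq0 -mulrNz dK.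
Qed.

Lemma minor_inj (K : fieldType) (X Y : eqType) (e : X -> Y -> K) n (f : 'I_n -> X)
    (g : 'I_n -> Y) : \det (\matrix_(i, j) e (f i) (g j)) != 0 -> injective f.
Proof.
move=> dn0 i j fij; apply/eqP/negP => /negP nij; case/eqP: dn0.
by apply: (determinant_alternate nij) => k; rewrite !mxE fij.
Qed.

Lemma indep_square (K : fieldType) (X Y : eqType) (e : X -> Y -> K) xs ys :
    uniq xs -> uniq ys -> size xs = size ys ->
  indep e xs ys -> indep (fun y x => e x y) ys xs.
Proof.
move=> uxs uys sxy /(indep_minor uys)[f fxs dn0].
have injf := minor_inj dn0.
have uf : uniq (codom f) by rewrite (map_inj_uniq injf) enum_uniq.
have szf : size (codom f) = size ys by rewrite size_codom card_ord.
have pf : perm_eq (codom f) xs.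
  have sub : {subset codom f <= xs} by move=> _ /codomP[i ->].
  have [_ mem] := uniq_min_size uf sub (eq_leq (etrans sxy (esym szf))).
  exact: uniq_perm.
move=> c c0 x; rewrite -(perm_mem pf) => /codomP[i ->].
set B := \matrix_(i, j) _ in dn0.
have uB : B \in unitmx by rewrite unitmxE unitfE.
pose u := \row_i c (f i).
have uB0 : u *m B = 0.
  apply/rowP => j; rewrite !mxE -[RHS](c0 (tnth (in_tuple ys) j)) ?mem_tnth //.
  rewrite -(perm_big _ pf) [RHS]big_map big_enum /=.
  by apply: eq_bigr => k _; rewrite !mxE.
have /rowP/(_ i) : u = 0 by rewrite -(mulmxK uB u) uB0 mul0mx.
by rewrite !mxE.
Qed.

(** * Monomials and exponent vectors *)

Definition mono (R : pzSemiRingType) (x : nat -> R) (s : seq nat) : R :=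
  \prod_(i < size s) x i ^+ nth 0%N s i.

Lemma mono_cons (R : pzSemiRingType) (x : nat -> R) n s :
  mono x (n :: s) = x 0%N ^+ n * mono (fun i => x i.+1) s.
Proof. by rewrite /mono big_ord_recl. Qed.

Fixpoint dot (a s : seq nat) : nat :=
  if a is x :: a' then if s is y :: s' then (x * y + dot a' s')%N else 0%N
  else 0%N.

Lemma mono_weight (R : comPzSemiRingType) (t : R) (a : seq nat) (x : nat -> R) s :
  mono (fun i => t ^+ nth 0%N a i * x i) s = t ^+ dot a s * mono x s.
Proof.
elim: s a x => [|n s IHs] a x; first by case: a => [|? ?]; rewrite /mono !big_ord0 mulr1.
rewrite !mono_cons; case: a => [|k a] /=.
  rewrite !mul1r; congr (_ * _); rewrite -[RHS]mul1r -(expr0 t).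
  by rewrite -(IHs [::]); apply: eq_bigr => i _; rewrite nth_nil.
rewrite (IHs a) exprMn -exprM exprD.
by rewrite -!mulrA; congr (_ * _); rewrite mulrCA.
Qed.

(** The first entry stays 0: on forms of fixed degree, Euler's relation expresses one of the four
    logarithmic derivatives through the others. The remaining three entries leave exactly as many
    vectors as the length of an [m]-point. *)
Definition low_exponents (m : nat) : seq (seq nat) :=
  [seq [:: 0; ij.1; ij.2; k]%N |
    ij <- [seq (i, j) | i <- iota 0 m, j <- iota 0 (m - i)],
    k <- iota 0 (m - ij.1 - ij.2)].

Lemma low_exponentsP m s :
  reflect (exists i j k, s = [:: 0; i; j; k]%N /\ (i + j + k < m)%N) (s \in low_exponents m).
Proof.
apply: (iffP allpairsPdep) => [[[i j] [k [/allpairsPdep[i' [j' []]]]]]|[i [j [k [-> lt]]]]].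
  rewrite !mem_iota => ilt jlt [-> ->]; rewrite /= => klt ->.
  by exists i', j', k; split=> //; lia.
exists (i, j), k; split=> //; last by rewrite /= mem_iota; lia.
by apply/allpairsPdep; exists i, j; rewrite !mem_iota; split=> //; lia.
Qed.

Lemma low_exponents_uniq m : uniq (low_exponents m).
Proof.
apply: allpairs_uniq_dep => [|? _|]; rewrite ?iota_uniq //.
  apply: allpairs_uniq_dep => [|? _|]; rewrite ?iota_uniq //.
  by move=> [i j] [i' j'] _ _ /= [-> ->].
by move=> [[i j] k] [[i' j'] k'] _ _ /= [-> -> ->].
Qed.

Lemma low_exponentsS m m' : (m <= m')%N -> {subset low_exponents m <= low_exponents m'}.
Proof.
move=> le s /low_exponentsP[i [j [k [-> lt]]]]; apply/low_exponentsP; exists i, j, k; split=> //.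
exact: leq_trans le.
Qed.

(** * Degeneration along one-parameter subgroups of the torus *)

Section Torus.

Variable K : fieldType.
Hypothesis charK : [pchar K] =i pred0.

Definition powprod (s k : seq nat) : nat :=
  (\prod_(i < size k) nth 0 s i ^ nth 0 k i)%N.

(** The monomial of exponent s is an eigenvector of the operator prod (X_i d/dX_i)^(k_i), with
    eigenvalue prod s_i^(k_i). This is the value of that operator, k = [x.2], on the monomial at the
    point labelled [x.1]. *)
Definition torus_condition (p : nat -> nat -> K) (x : nat * seq nat) (s : seq nat) : K :=
  (powprod s x.2)%:R * mono (p x.1) s.

Definition torus_conditions (L : seq (nat * nat)) : seq (nat * seq nat) :=
  [seq (l.1, k) | l <- L, k <- low_exponents l.2].

Lemma torus_conditionsP L x :
  reflect (exists2 m, (x.1, m) \in L & x.2 \in low_exponents m) (x \in torus_conditions L).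
Proof.
apply: (iffP allpairsPdep) => [[[l m] [k [lL kk ->]]]|[m lL kk]]; first by exists m.
by exists (x.1, m), x.2; split=> //; case: x {lL kk}.
Qed.

Lemma torus_conditions_cat L1 L2 : torus_conditions (L1 ++ L2) = torus_conditions L1 ++
    torus_conditions L2.
Proof. by rewrite /torus_conditions map_cat flatten_cat. Qed.

Lemma torus_conditions_uniq L : uniq (unzip1 L) -> uniq (torus_conditions L).
Proof.
move=> uL; have inj l m m' : (l, m) \in L -> (l, m') \in L -> m = m'.
  elim: L uL => //= -[l1 m1] L IHL /= /andP[l1L /IHL {}IHL].
  rewrite !inE => /predU1P[E|lm] /predU1P[E'|lm'].
  - by have [_ ->] := E; have [_ ->] := E'.
  - by have [El _] := E; case/negP: l1L; apply/mapP; exists (l, m').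
  - by have [El _] := E'; case/negP: l1L; apply/mapP; exists (l, m).
  - exact: IHL.
apply: allpairs_uniq_dep => [|l _|]; rewrite ?low_exponents_uniq ?(map_uniq uL) //.
move=> _ _ /allpairsPdep[[l m] [k [lL _ ->]]] /allpairsPdep[[l' m'] [k' [lL' _ ->]]].
by move=> /= [El Ek]; rewrite Ek; rewrite El in lL *; rewrite (inj _ _ _ lL lL').
Qed.

(** The Boolean selects the cohomology group: [true] is the side of h^0 = 0, [false] that of h^1 =
    0. *)
Definition maximal_rank (b : bool) (D : seq (seq nat)) (L : seq (nat * nat)) : Prop :=
  exists2 p : nat -> nat -> K, (forall l i, p l i != 0) &
    if b then indep (torus_condition p) (torus_conditions L) D
    else indep (fun s x => torus_condition p x s) D (torus_conditions L).

Lemma maximal_rank_perm b D D' L : perm_eq D D' -> maximal_rank b D L -> maximal_rank b D' L.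
Proof.
move=> pD [p p0 gD]; exists p => //; case: b gD => gD; first exact: (indep_perm pD).
by apply: indep_sub gD => s; rewrite (perm_mem pD).
Qed.

(* The points of [L1] are moved by the one-parameter subgroup [t^a] of the   *)
(* torus: after rescaling each line by a power of [t], the matrix of the      *)
(* conditions becomes block triangular at [t = 0].                           *)
Lemma maximal_rank_cat b D1 D2 L1 L2 (a : seq nat) c :
    uniq (D1 ++ D2) -> uniq (unzip1 (L1 ++ L2)) ->
    (forall s, s \in D1 -> dot a s <= c)%N -> (forall s, s \in D2 -> c < dot a s)%N ->
  maximal_rank b D1 L1 -> maximal_rank b D2 L2 -> maximal_rank b (D1 ++ D2) (L1 ++ L2).
Proof.
move=> uD uL le1 gt2 [p1 p1n0 g1] [p2 p2n0 g2].
pose in1 l := l \in unzip1 L1.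
have in1T x : x \in torus_conditions L1 -> in1 x.1.
  by case/torus_conditionsP=> m xL _; apply/mapP; exists (x.1, m).
have in1F x : x \in torus_conditions L2 -> in1 x.1 = false.
  case/torus_conditionsP=> m xL _; apply/negP => x1; move: uL; rewrite /unzip1 map_cat cat_uniq.
  case/and3P=> _ /hasP[]; exists x.1 => //; apply/mapP; by exists (x.1, m).
pose p' l := if in1 l then p1 l else p2 l.
(* The subtraction is truncated. These are the powers of t left once the column of s is divided by
   t^min(a.s, c) and the rows of [L2] are multiplied by t^c. *)
pose ex l s := (if in1 l then dot a s - c else c - dot a s)%N.
pose E x s : {poly K} := (torus_condition p' x s)%:P * 'X^(ex x.1 s).
pose pt t l i := if in1 l then t ^+ nth 0%N a i * p1 l i else p2 l i.
pose r (t : K) (x : nat * seq nat) := if in1 x.1 then 1 else t ^+ c.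
have Et t x s : (E x s).[t] = torus_condition p' x s * t ^+ ex x.1 s.
  by rewrite hornerM hornerC hornerXn.
have ptE t x s : torus_condition (pt t) x s * r t x = (E x s).[t] * t ^+ minn (dot a s) c.
  rewrite Et /r /ex /torus_condition /pt /p'; case: ifP => _.
    rewrite mulr1 mono_weight -!mulrA -exprD; congr (_ * _).
    by rewrite [RHS]mulrC; congr (t ^+ _ * _); lia.
  by rewrite -!mulrA -exprD; congr (_ * (_ * t ^+ _)); lia.
have E1 x s : x \in torus_conditions L1 -> s \in D1 -> (E x s).[0] = torus_condition p1 x s.
  move=> /in1T x1 /le1 ls; rewrite Et /ex /torus_condition /p' x1.
  by have -> : (dot a s - c = 0)%N; [lia | rewrite mulr1].
have E2 x s : x \in torus_conditions L2 -> s \in D2 -> (E x s).[0] = torus_condition p2 x s.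
  move=> /in1F x1 /gt2 ls; rewrite Et /ex /torus_condition /p' x1.
  by have -> : (c - dot a s = 0)%N; [lia | rewrite mulr1].
(* This is the zero block at t = 0. The opposite block, [L2] against [D1], may survive on the
   hyperplane a.s = c. *)
have E12 x s : x \in torus_conditions L1 -> s \in D2 -> (E x s).[0] = 0.
  move=> /in1T x1 /gt2 ls; rewrite Et /ex x1 expr0n.
  by have -> : (dot a s - c == 0)%N = false; [lia | rewrite mulr0].
have ptn0 t : t != 0 -> forall l i, pt t l i != 0.
  by move=> t0 l i; rewrite /pt; case: ifP => // _; rewrite mulf_neq0 ?expf_neq0.
have rn0 t x : t != 0 -> r t x != 0.
  by move=> t0; rewrite /r; case: ifP => _; rewrite ?oner_neq0 ?expf_neq0.
case: b g1 g2 => g1 g2; last first.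
  have [] := @indep_specialize K _ _ (fun s x => E x s) (D1 ++ D2) (torus_conditions (L1 ++ L2))
    charK.
  - exact: torus_conditions_uniq.
  - rewrite torus_conditions_cat => d d0.
    (* On the columns of [D2] only the rows of [L2] survive, so their coefficients vanish first. For
       column independence the order is reversed: [D1], then [D2]. *)
    have d2 x : x \in torus_conditions L2 -> d x = 0.
      apply: g2 => s sD; have := d0 s; rewrite mem_cat sD orbT => /(_ isT).
      rewrite big_cat /= big_seq big1 => [|y yL]; last by rewrite E12 ?mulr0.
      by rewrite add0r => ds; rewrite -[RHS]ds; apply: eq_big_seq => y yL; rewrite E2.
    have d1 x : x \in torus_conditions L1 -> d x = 0.
      apply: g1 => s sD; have := d0 s; rewrite mem_cat sD => /(_ isT).
      rewrite big_cat /= [X in _ + X]big_seq [X in _ + X]big1 => [|y yL]; last by rewrite d2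
        ?mul0r.
      by rewrite addr0 => ds; rewrite -[RHS]ds; apply: eq_big_seq => y yL; rewrite E1.
    by move=> x; rewrite mem_cat => /orP[/d1|/d2].
  move=> t t0 ind; exists (pt t) => //; first exact: ptn0.
  apply: (indep_scale (r := fun s => (t ^+ minn (dot a s) c)^-1)
           (s := fun x => (r t x)^-1) (e' := fun s x => (E x s).[t])) => //.
  - by move=> s _; rewrite invr_neq0 ?expf_neq0.
  - by move=> x _; rewrite invr_neq0 ?rn0.
  move=> s x _ _; apply: (mulIf (rn0 t x t0)); rewrite mulfVK ?rn0 //.
  by rewrite mulrAC ptE mulfK ?expf_neq0.
have [] := @indep_specialize K _ _ E (torus_conditions (L1 ++ L2)) (D1 ++ D2) charK uD.
  rewrite torus_conditions_cat => d d0.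
  have d1 s : s \in D1 -> d s = 0.
    apply: g1 => x xL; have := d0 x; rewrite mem_cat xL => /(_ isT).
    rewrite big_cat /= [X in _ + X]big_seq [X in _ + X]big1 => [|y yL]; last by rewrite E12
      ?mulr0.
    by rewrite addr0 => ds; rewrite -[RHS]ds; apply: eq_big_seq => y yL; rewrite E1.
  have d2 s : s \in D2 -> d s = 0.
    apply: g2 => x xL; have := d0 x; rewrite mem_cat xL orbT => /(_ isT).
    rewrite big_cat /= big_seq big1 => [|y yL]; last by rewrite d1 ?mul0r.
    by rewrite add0r => ds; rewrite -[RHS]ds; apply: eq_big_seq => y yL; rewrite E2.
  by move=> x; rewrite mem_cat => /orP[/d1|/d2].
move=> t t0 ind; exists (pt t) => //; first exact: ptn0.
apply: (indep_scale (r := r t) (s := fun s => t ^+ minn (dot a s) c)) ind => //.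
- by move=> x _; apply: rn0.
- by move=> s _; rewrite expf_neq0.
Qed.

End Torus.

(** * Gaussian elimination modulo 101 *)

Definition modulus : N := 101%num.

(** The test against [modulus] certifies that the head is a nonzero residue, so no invariant saying
    that all entries are reduced has to be carried. *)
Fixpoint pivot (rs : seq (seq N)) : option (N * seq N * seq (seq N)) :=
  if rs is r :: rs' then
    let h := head N0 r in
    if (if h is N0 then false else N.ltb h modulus)
    then Some (h, behead r, rs')
    else if pivot rs' is Some (a, t, o) then Some (a, t, r :: o) else None
  else None.

Fixpoint combine (a b : N) (r t : seq N) : seq N :=
  match r, t with
  | x :: r', y :: t' => N.modulo (a * x + b * y)%num modulus :: combine a b r' t'
  | _, _ => [::]
  end.

(** Since 100 is -1 modulo 101, the row becomes [a] times itself minus [h] times the pivot row, and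
    no inverse is ever computed. *)
Definition clear_head (a : N) (t r : seq N) : seq N :=
  if r is h :: r' then
    if h is N0 then r' else combine a (N.modulo (100 * h)%num modulus) r' t
  else [::].

Fixpoint elimination (n : nat) (rs : seq (seq N)) : bool :=
  if n is n'.+1 then
    if pivot rs is Some (a, t, o) then elimination n' (map (clear_head a t) o)
    else false
  else true.

Fixpoint powN (s k : seq nat) : N :=
  if k is j :: k' then
    iter j (N.mul (N.of_nat (head 0 s))) (powN (behead s) k')
  else 1%num.

Definition power_matrix (ks D : seq (seq nat)) : seq (seq N) :=
  [seq [seq N.modulo (powN s k) modulus | s <- D] | k <- ks].

Definition power_matrix_tr (ks D : seq (seq nat)) : seq (seq N) :=
  [seq [seq N.modulo (powN s k) modulus | k <- ks] | s <- D].

Section Soundness.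

Local Notation F := 'F_101.
Let phi (x : N) : F := (N.to_nat x)%:R.

Fixpoint dotp (r : seq N) (c : seq F) : F :=
  match r, c with x :: r', y :: c' => phi x * y + dotp r' c' | _, _ => 0 end.

Lemma phiD x y : phi (x + y)%num = phi x + phi y.
Proof. by rewrite /phi Nnat.N2Nat.inj_add natrD. Qed.

Lemma phiM x y : phi (x * y)%num = phi x * phi y.
Proof. by rewrite /phi Nnat.N2Nat.inj_mul natrM. Qed.

Lemma phi_modulus : phi modulus = 0.
Proof. exact: val_inj. Qed.

Lemma phi_mod x : phi (N.modulo x modulus) = phi x.
Proof.
rewrite {2}[x](N.div_mod x modulus) // phiD phiM phi_modulus mul0r add0r //.
Qed.

Lemma phi_neq0 x : (if x is N0 then false else N.ltb x modulus) -> phi x != 0.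
Proof.
case: x => // q /N.ltb_lt lt.
have qlt : (N.to_nat (N.pos q) < 101)%N by move: lt; rewrite /modulus; lia.
have qgt : (0 < N.to_nat (N.pos q))%N by lia.
rewrite /phi -(dvdn_pcharf (p := 101)); last exact: pchar_Fp.
by rewrite gtnNdvd.
Qed.

Lemma pivotP rs a t o : pivot rs = Some (a, t, o) ->
  [/\ phi a != 0, exists2 r, r \in rs & head N0 r = a /\ behead r = t & {subset o <= rs}].
Proof.
elim: rs o => //= r rs IHrs o; case: ifP => [/phi_neq0 h0 [<- <- <-]|_].
  split=> //; first by exists r; rewrite ?mem_head.
  by move=> x xrs; rewrite inE xrs orbT.
case: (pivot rs) IHrs => // -[[a' t'] o'] IH [Ea Et <-]; rewrite Ea Et in IH.
have [a0 [q qrs qE] sub] := IH _ erefl.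
split=> //; first by exists q; rewrite // inE qrs orbT.
by move=> x; rewrite !inE => /orP[->//|/sub ->]; rewrite orbT.
Qed.

Lemma dotp_combine a b r t c : size r = size t ->
  dotp (combine a b r t) c = phi a * dotp r c + phi b * dotp t c.
Proof.
elim: r t c => [|x r IHr] [|y t] c //=; first by rewrite !mulr0 addr0.
case=> srt; case: c => [|z c]; first by rewrite !mulr0 addr0.
rewrite IHr // phi_mod phiD !phiM; ring.
Qed.

Lemma size_combine a b r t : size r = size t -> size (combine a b r t) = size t.
Proof. by elim: r t => [|x r IHr] [|y t] //= [/IHr ->]. Qed.

(** The cleared rows are orthogonal to the tail of [c], which vanishes by induction; the pivot row
    then reduces to a nonzero multiple of the head of [c]. *)
Lemma eliminationP n rs (c : seq F) : elimination n rs ->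
    {in rs, forall r, size r = n} -> size c = n ->
  {in rs, forall r, dotp r c = 0} -> all (pred1 0) c.
Proof.
elim: n rs c => [|n IHn] rs [|z c] //=.
case E: (pivot rs) => [[[a t] o]|] //; have [a0 [r0 r0rs [r0a r0t]] sub] := pivotP E.
move=> el srs [sc] drs.
have st : size t = n by rewrite -r0t size_behead srs.
have dt : phi a * z + dotp t c = 0.
  by have := drs _ r0rs; have := srs _ r0rs; case: (r0) r0a r0t => //= ? ? -> ->.
suff c0 : all (pred1 0) c.
  rewrite c0 andbT -(mulrI_eq0 _ (mulfI a0)); apply/eqP; rewrite -[RHS]dt.
  suff -> : dotp t c = 0 by rewrite addr0.
  elim: (c) t {st dt r0t E el} c0 => [|x c' IHc] [|y t] //= /andP[/eqP -> /IHc ->].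
  by rewrite mulr0 addr0.
apply: (IHn _ _ el _ sc) => _ /mapP[r ro ->].
  have := srs _ (sub _ ro); case: r {ro} => // h r [sr] /=.
  by case: h => // q; rewrite size_combine st.
have := srs _ (sub _ ro); have := drs _ (sub _ ro).
case: r {ro} => // h r; rewrite [dotp _ _ in X in X -> _]/= => hr [sr].
case: h hr => [|q] hr; first by rewrite -[RHS]hr /phi mul0r add0r.
rewrite /clear_head dotp_combine ?st // phi_mod phiM.
have -> : phi 100 = -1 by apply: val_inj.
move: dt hr; set A := phi a; set H := phi (N.pos q) => dt hr.
have -> : dotp r c = - (H * z) by apply/eqP; rewrite -addr_eq0 addrC hr.
have -> : dotp t c = - (A * z) by apply/eqP; rewrite -addr_eq0 addrC dt.
ring.
Qed.

Lemma dotp_map (Y : eqType) (f : Y -> N) (c : Y -> F) ys :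
  dotp (map f ys) (map c ys) = \sum_(y <- ys) c y * phi (f y).
Proof. by elim: ys => [|y ys IH]; rewrite ?big_nil ?big_cons //= IH mulrC. Qed.

Lemma elimination_indep (X Y : eqType) (f : X -> Y -> N) xs ys :
    elimination (size ys) [seq [seq f x y | y <- ys] | x <- xs] ->
  indep (fun x y => phi (f x y)) xs ys.
Proof.
move=> el c c0 y ysy.
have /allP/(_ (c y)) : all (pred1 0) (map c ys).
  apply: (eliminationP el); rewrite ?size_map // => _ /mapP[x xsx ->].
    by rewrite size_map.
  by rewrite dotp_map c0.
by rewrite map_f // => /(_ isT)/eqP.
Qed.

Lemma nat_of_powN s k : N.to_nat (powN s k) = powprod s k.
Proof.
elim: k s => [|j k IHk] s; first by rewrite /powprod big_ord0.
rewrite /powprod big_ord_recl /=.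
have -> : (\prod_(i < size k) nth 0 s (bump 0 i) ^ nth 0 (j :: k) (bump 0 i))%N
    = powprod (behead s) k.
  by apply: eq_bigr => i _; rewrite nth_behead.
rewrite -IHk nth0; set x := head 0%N s; elim: j => [|j IHj] /=; first by rewrite mul1n.
by rewrite Nnat.N2Nat.inj_mul Nnat.Nat2N.id IHj expnS -mulnA.
Qed.

Lemma phi_powN s k : phi (N.modulo (powN s k) modulus) = (powprod s k)%:R.
Proof. by rewrite phi_mod /phi nat_of_powN. Qed.

End Soundness.

(* The two components answer whether the conditions of one [m]-fold point    *)
(* are linearly independent columnwise and rowwise on the exponents in [D].  *)
Definition point_check (m : nat) (D : seq (seq nat)) : bool * bool :=
  let ks := low_exponents m in let n := size D in let k := size ks in
  if (n <= k)%N
  then let r := elimination n (power_matrix ks D) in (r, (n == k) && r)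
  else (false, elimination k (power_matrix_tr ks D)).

(** * Certificates for maximal rank *)

Section Check.

Variable K : fieldType.
Hypothesis charK : [pchar K] =i pred0.

(** A single point can be placed at (1,1,1,1), where every monomial takes the value 1. The matrix
    then consists of the natural numbers prod s_i^(k_i), and a rank modulo 101 is enough. *)
Lemma point_checkP (b : bool) m D l : uniq D ->
  (if b then (point_check m D).1 else (point_check m D).2) -> maximal_rank K b D [:: (l, m)].
Proof.
move=> uD chk; exists (fun _ _ => 1); first by move=> *; apply: oner_neq0.
have one s : mono (fun=> 1 : K) s = 1 by apply: big1 => i _; rewrite expr1n.
pose e (x : nat * seq nat) s := powprod s x.2.
have rE : torus_conditions [:: (l, m)] = [seq (l, k) | k <- low_exponents m] by rewrite
  /torus_conditions /= cats0.
have urs : uniq (torus_conditions [:: (l, m)]) by apply: torus_conditions_uniq.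
have [el|el] :
  (indep (fun x s => (e x s)%:R : 'F_101) (torus_conditions [:: (l, m)]) D
     /\ (b = false -> size D = size (low_exponents m))) \/
  (indep (fun s x => (e x s)%:R : 'F_101) D (torus_conditions [:: (l, m)]) /\ b = false).
- move: chk; rewrite /point_check; case: leqP => _ /= chk; [left|right].
    have [el bF] : elimination (size D) (power_matrix (low_exponents m) D) /\
        (b = false -> size D = size (low_exponents m)).
      by case: b chk => /= [->|/andP[/eqP -> ->]].
    split=> // c c0; apply: (elimination_indep el) => k kk.
    have := c0 (l, k); rewrite rE map_f // => /(_ isT) ck; rewrite -[RHS]ck.
    by apply: eq_bigr => s _; rewrite phi_powN.
  case: b chk => //= el; split=> // c c0 x; rewrite rE => /mapP[k kk ->].
  apply: (elimination_indep el (c := fun k => c (l, k))) kk => s sD.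
  rewrite -[RHS](c0 s sD) rE big_map; apply: eq_bigr => i _.
  by rewrite phi_powN.
- have K_ind : indep (fun x s => (e x s)%:R : K) (torus_conditions [:: (l, m)]) D.
    exact: (indep_mod charK _ uD el.1).
  have ind : indep (torus_condition (fun _ _ => 1 : K)) (torus_conditions [:: (l, m)]) D.
    by apply: eq_indep K_ind => x s _ _; rewrite /torus_condition one mulr1.
  case: b el {chk} => // -[_ /(_ erefl) sD]; apply: indep_square => //.
  by rewrite rE size_map.
case: el => el ->.
have K_ind : indep (fun s x => (e x s)%:R : K) D (torus_conditions [:: (l, m)]).
  exact: (indep_mod charK _ urs el).
by apply: eq_indep K_ind => x s _ _; rewrite /torus_condition one mulr1.
Qed.

End Check.

(** * Trees of hyperplane cuts *)

(** A node cuts the exponents along the hyperplane a.s = c, the left subtree receiving the side a.s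
    <= c; a leaf assigns what is left to one point or to none. *)
Inductive cut_tree :=
  | Nothing
  | Point of nat
  | Cut of seq nat & nat & cut_tree & cut_tree.

Fixpoint tree_mults (T : cut_tree) : seq nat :=
  match T with
  | Nothing => [::]
  | Point m => [:: m]
  | Cut _ _ T1 T2 => tree_mults T1 ++ tree_mults T2
  end.

Definition below (a : seq nat) c (D : seq (seq nat)) := [seq s <- D | dot a s <= c]%N.
Definition above (a : seq nat) c (D : seq (seq nat)) := [seq s <- D | ~~ (dot a s <= c)]%N.

Lemma below_uniq a c D : uniq D -> uniq (below a c D).
Proof. exact: filter_uniq. Qed.

Lemma above_uniq a c D : uniq D -> uniq (above a c D).
Proof. exact: filter_uniq. Qed.

Fixpoint tree_check (T : cut_tree) (D : seq (seq nat)) : bool * bool :=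
  match T with
  | Nothing => (nilp D, true)
  | Point m => point_check m D
  | Cut a c T1 T2 =>
      let u := tree_check T1 (below a c D) in
      let v := tree_check T2 (above a c D) in
      (u.1 && v.1, u.2 && v.2)
  end.

Definition both (u : bool * bool) := u.1 && u.2.
Definition part (b : bool) (u : bool * bool) := if b then u.1 else u.2.

Section Realizable.

Variable K : fieldType.
Hypothesis charK : [pchar K] =i pred0.

(** Quantifying over all labellings makes the property invariant under permuting [ms] and lets
    configurations with disjoint labels be glued. *)
Definition realizable (b : bool) (D : seq (seq nat)) (ms : seq nat) : Prop :=
  forall L : seq (nat * nat), uniq (unzip1 L) -> perm_eq (unzip2 L) ms ->
  maximal_rank K b D L.

Lemma maximal_rank_permL b D L L' : uniq (unzip1 L) -> perm_eq L L' -> maximal_rank K b D L ->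
    maximal_rank K b D L'.
Proof.
move=> uL pL [p p0 gD]; exists p => //.
have pr : perm_eq (torus_conditions L) (torus_conditions L').
  apply: uniq_perm; rewrite ?torus_conditions_uniq //; first by rewrite -(perm_uniq (perm_map _
    pL)).
  by move=> x; apply/torus_conditionsP/torus_conditionsP => -[m xL xk]; exists m; rewrite //
    ?(perm_mem pL) // -(perm_mem pL).
case: b gD => gD; last exact: (indep_perm pr).
by apply: indep_sub gD => s; rewrite (perm_mem pr).
Qed.

(** Every labelling is a permutation of one that lists the multiplicities in the order of [ms]. *)
Lemma realizable_exact b D ms :
  (forall L, uniq (unzip1 L) -> unzip2 L = ms -> maximal_rank K b D L) -> realizable b D ms.
Proof.
move=> gD L uL; rewrite perm_sym => /(perm_iotaP 0%N)[Is pIs msE].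
have pL : perm_eq (map (nth (0, 0)%N L) Is) L.
  apply: perm_trans (perm_map _ pIs) _.
  by rewrite size_map map_nth_iota0 // take_size.
have uL' : uniq (unzip1 (map (nth (0, 0)%N L) Is)) by rewrite (perm_uniq (perm_map _ pL)).
apply: (maximal_rank_permL uL' pL); apply: gD => //.
rewrite msE /unzip2 -map_comp; apply/eq_in_map => i iIs /=.
have : i \in iota 0 (size (unzip2 L)) by rewrite -(perm_mem pIs).
by rewrite mem_iota size_map /= => ilt; rewrite (nth_map (0, 0)%N).
Qed.

Lemma realizable_perm b D ms ms' : perm_eq ms ms' -> realizable b D ms -> realizable b D ms'.
Proof. by move=> pm gD L uL pL; apply: gD => //; apply: perm_trans pL _; rewrite perm_sym. Qed.

(** This is the degeneration of [maximal_rank_cat] stripped of the points: the labels are split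
    after the first [size ms1] entries and each half is placed on its side of the hyperplane. *)
Lemma realizable_cut b D ms1 ms2 a c : uniq D ->
    realizable b (below a c D) ms1 -> realizable b (above a c D) ms2 ->
  realizable b D (ms1 ++ ms2).
Proof.
move=> uD g1 g2; apply: realizable_exact => L uL LE.
pose n := size ms1; rewrite -(cat_take_drop n L) in uL LE *.
have sn : size (unzip2 (take n L)) = size ms1.
  have : (n <= size L)%N.
    by rewrite -(size_map snd) -{1}(cat_take_drop n L) [map _ _]LE size_cat leq_addr.
  by move=> nl; rewrite size_map size_take_min; apply/minn_idPl.
move: LE; rewrite /unzip2 map_cat => /eqP; rewrite eqseq_cat // => /andP[/eqP E1 /eqP E2].
have pD : perm_eq (below a c D ++ above a c D) D by rewrite perm_filterC.
apply: (maximal_rank_perm pD); move: (uL); rewrite /unzip1 map_cat cat_uniq => /and3P[u1 _ u2].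
apply: (@maximal_rank_cat _ charK b _ _ _ _ a c) => //.
- by rewrite (perm_uniq pD).
- by move=> s; rewrite mem_filter => /andP[].
- by move=> s; rewrite mem_filter ltnNge => /andP[].
- by apply: g1; rewrite // -E1.
- by apply: g2; rewrite // -E2.
Qed.

Lemma realizable_nil b D : (if b then nilp D else true) -> realizable b D [::].
Proof.
move=> bD; apply: realizable_exact => -[] // _ _.
exists (fun _ _ => 1); first by move=> *; apply: oner_neq0.
by case: b bD => [/nilP ->|_].
Qed.

Lemma realizable_point b m D : uniq D -> part b (point_check m D) -> realizable b D [:: m].
Proof.
move=> uD chk; apply: realizable_exact => -[] // [l m'] [] // _ [->].
exact: point_checkP.
Qed.

Lemma tree_checkP b T D : uniq D -> part b (tree_check T D) -> realizable b D (tree_mults T).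
Proof.
elim: T D => [|m|a c T1 IH1 T2 IH2] D uD.
- by case: b => /= bD; apply: realizable_nil.
- exact: realizable_point.
case: b IH1 IH2 => IH1 IH2 /= /andP[c1 c2]; apply: (realizable_cut (a := a) (c := c)) => //.
all: by [apply: IH1 => //; apply: below_uniq | apply: IH2 => //; apply: above_uniq].
Qed.

End Realizable.
Arguments realizable K : clear implicits.

(* Each cell of [fs] holds either one 4-point or five 2-points; after [k] of  *)
(* them the [k]-th tail cuts off cells for 3-points, and the remaining region *)
(* is filled in one of the alternative ways listed ([false]: independent      *)
(* conditions, [true]: independent columns).                                  *)
Definition cut_data := (seq nat * nat)%type.
Definition tail_data := (seq cut_data * seq (bool * cut_tree))%type.

Fixpoint tail_check (cuts : seq cut_data) (alts : seq (bool * cut_tree)) D :=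
  if cuts is (a, c) :: cuts' then
    both (point_check 3 (below a c D)) && tail_check cuts' alts (above a c D)
  else all (fun bT => part bT.1 (tree_check bT.2 D)) alts.

Fixpoint family_check (tails : seq tail_data) (fs : seq (cut_data * cut_tree)) D :=
  if tails is (cuts, alts) :: tails' then
    tail_check cuts alts D &&
    (if fs is ((a, c), T) :: fs' then
       let D1 := below a c D in
       [&& both (point_check 4 D1), tree_mults T == nseq 5 2,
           both (tree_check T D1) & family_check tails' fs' (above a c D)]
     else nilp tails')
  else true.

Fixpoint fives_check (cuts : seq cut_data) (k : seq (seq nat) -> bool) D :=
  if cuts is (a, c) :: cuts' then
    both (point_check 5 (below a c D)) && fives_check cuts' k (above a c D)
  else k D.

Section Family.

Variable K : fieldType.
Hypothesis charK : [pchar K] =i pred0.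

Lemma part_both b u : both u -> part b u.
Proof. by case: b => /andP[]. Qed.

Definition alt_mults (alts : seq (bool * cut_tree)) := [seq (bT.1, tree_mults bT.2) | bT <- alts].

Lemma tail_checkP cuts alts D b ms : uniq D -> tail_check cuts alts D ->
  (b, ms) \in alt_mults alts -> realizable K b D (nseq (size cuts) 3%N ++ ms).
Proof.
elim: cuts D => [|[a c] cuts IH] D uD /=.
  elim: alts => //= -[b' T] alts IH /andP[chk /IH {}IH].
  rewrite inE => /predU1P[[-> ->]|/IH //]; exact: (tree_checkP charK).
move=> /andP[c1 c2] bms.
apply: (realizable_cut charK (a := a) (c := c) (ms1 := [:: 3%N]) uD).
  by apply: (realizable_point charK); [apply: below_uniq | apply: part_both].
by apply: IH => //; apply: above_uniq.
Qed.

(** A 4-point and five 2-points both have length 20 and every cell is certified for either filling.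
    One chain of cells therefore serves all [x <= k]: the first [x] cells hold 4-points, the next
    [k - x] hold 2-points. *)
Lemma family_checkP tails fs D k x b ms : uniq D -> family_check tails fs D ->
    (k < size tails)%N -> (x <= k)%N ->
    (b, ms) \in alt_mults (nth ([::], [::]) tails k).2 ->
  realizable K b D (nseq x 4%N ++ nseq (5 * (k - x)) 2%N ++
    nseq (size (nth ([::], [::]) tails k).1) 3%N ++ ms).
Proof.
elim: tails fs D k x => // -[cuts alts] tails IH fs D [|k] x uD /=.
  case/andP=> chk _ _; rewrite leqn0 => /eqP -> /=; exact: tail_checkP.
case: fs => [|[[a c] T] fs] /andP[_]; first by move/nilP ->.
case/and4P=> c4 /eqP Tm cT rec klt xk bms.
have uA : uniq (above a c D) by [apply: above_uniq | apply: below_uniq].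
have uB : uniq (below a c D) by [apply: above_uniq | apply: below_uniq].
case: x xk => [|x] xk.
  rewrite subn0 mulnS nseqD -[nseq 0 4]/[::] cat0s -catA.
  apply: (realizable_cut charK (a := a) (c := c) (ms1 := nseq 5 2%N) uD).
    by rewrite [nseq _ _]/= -Tm; apply: (tree_checkP charK); last apply: part_both.
  by have := IH _ _ k 0%N uA rec klt isT bms; rewrite subn0.
rewrite subSS -[nseq x.+1 4]/([:: 4%N] ++ nseq x 4) -catA.
apply: (realizable_cut charK (a := a) (c := c) (ms1 := [:: 4%N]) uD).
  by apply: (realizable_point charK); last apply: part_both.
exact: (IH _ _ k x uA rec).
Qed.

Lemma fives_checkP cuts (k : seq (seq nat) -> bool) D b ms : uniq D ->
    (forall D', uniq D' -> k D' -> realizable K b D' ms) -> fives_check cuts k D ->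
  realizable K b D (nseq (size cuts) 5%N ++ ms).
Proof.
move=> uD Hk; elim: cuts D uD => [|[a c] cuts IH] D uD /=; first exact: Hk.
case/andP=> c5 rec; apply: (realizable_cut charK (a := a) (c := c) (ms1 := [:: 5%N]) uD).
  by apply: (realizable_point charK); [apply: below_uniq | apply: part_both].
by apply: IH => //; apply: above_uniq.
Qed.

End Family.

(** * Explicit certificates in degrees 10 and 13 *)

(** The exponents of all monomials of degree [d] in four variables: affine exponents homogenized by
    the first variable. *)
Definition simplex (d : nat) : seq (seq nat) :=
  [seq (d - sumn s)%N :: behead s | s <- low_exponents d.+1].

(* The cuts were found by a random search. *)
Local Notation o := (Point 2) (only parsing).

Definition fives : seq cut_data := [::([::0;1;1;1],4);([::1;0;1;1],4);([::0;2;1;2],9);([::2;0;2;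
 1],9);([::1;0;5;4],24);([::0;2;1;3],14);([::5;0;7;2],34);([::1;1;0;0],4)].

Definition tails0 : seq tail_data :=[::([::([::1;1;0;1],2);([::0;5;4;5],10);([::1;1;1;0],2);
 ([::5;0;4;5],10);([::14;15;8;0],40);([::10;15;8;0],44);([::2;1;0;2],5);([::1;0;2;2],5);([::0;
 22;23;9],55);([::5;0;3;8],19);([::5;4;0;8],22);([::5;5;0;2],15);([::21;29;16;0],103);([::9;13;
 0;5],42);([::12;0;8;13],51);([::6;0;13;11],44);([::0;5;15;18],48);([::13;1;0;9],33);([::16;0;
 14;5],48);([::7;0;19;13],67);([::9;5;0;11],47);([::25;11;0;6],81);([::9;0;5;6],45);([::3;0;2;
 6],25);([::2;0;8;17],59);([::0;4;11;17],74);([::5;3;0;3],28)],[::(false,Cut [::3;1;1;0] 13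
 (Point 3) (Cut [::1;3;0;3] 17 o Nothing));(true,Cut [::3;1;1;0] 13 (Point 3) (Cut [::1;3;0;3]
 17 o o));(false,Cut [::0;8;3;9] 60 (Cut [::0;7;6;2] 21 o (Cut [::2;1;6;0] 14 o o)) o);
 (true,Cut [::0;8;3;9] 60 (Cut [::0;7;6;2] 21 o (Cut [::2;1;6;0] 14 o o)) o);(true,Cut [::3;1;1;
 0] 13 (Point 3) (Point 3))]);([::([::4;3;0;4],8);([::19;0;19;16],38);([::0;2;1;2],6);([::2;1;0;
 2],5);([::8;0;17;16],42);([::1;1;1;0],2);([::6;4;0;3],16);([::17;20;0;24],92);([::1;2;2;0],5);
 ([::25;11;0;21],85);([::22;0;7;21],64);([::5;5;0;3],21);([::16;0;13;7],47);([::28;0;7;18],86);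
 ([::5;0;9;12],39);([::19;6;21;0],54);([::10;0;21;13],76);([::0;1;12;7],28);([::2;0;3;1],11);
 ([::2;3;7;0],18);([::4;2;9;0],30);([::4;0;3;1],18);([::0;5;24;11],82);([::1;0;3;3],17);([::2;1;
 1;0],9)],[::(false,Cut [::7;9;8;0] 62 (Point 3) (Cut [::0;5;8;7] 52 o Nothing));(true,Cut [::7;
 9;8;0] 62 (Point 3) (Cut [::0;5;8;7] 52 o o));(false,Cut [::8;0;7;6] 64 (Cut [::5;2;0;3] 23 o
 o) (Cut [::0;2;7;6] 38 o o));(true,Cut [::8;0;7;6] 64 (Cut [::5;2;0;3] 23 o o) (Cut [::0;2;7;
 6] 38 o o));(true,Cut [::7;9;8;0] 62 (Point 3) (Point 3))]);([::([::9;0;4;8],26);([::1;1;1;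
 0],2);([::0;8;4;7],24);([::25;18;0;20],50);([::0;23;21;12],78);([::0;5;3;2],15);([::2;1;2;
 0],5);([::27;29;0;16],80);([::1;5;0;5],12);([::26;22;9;0],66);([::0;2;3;3],12);([::1;0;2;3],8);
 ([::0;6;5;9],37);([::5;1;0;6],14);([::2;4;0;7],23);([::2;3;5;0],14);([::0;6;11;12],59);([::8;
 12;3;0],33);([::0;5;8;3],34);([::12;16;0;5],62);([::5;3;2;0],17);([::0;2;0;3],12);([::0;14;20;
 5],102)],[::(false,Cut [::0;4;5;1] 32 (Point 3) (Cut [::4;2;0;3] 17 o Nothing));(true,Cut [::0;
 4;5;1] 32 (Point 3) (Cut [::4;2;0;3] 17 o o));(false,Cut [::7;1;0;3] 20 (Cut [::4;7;0;8] 56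
 (Cut [::5;4;3;0] 28 o o) o) o);(true,Cut [::7;1;0;3] 20 (Cut [::4;7;0;8] 56 (Cut [::5;4;3;0]
 28 o o) o) o);(true,Cut [::0;4;5;1] 32 (Point 3) (Point 3))]);([::([::0;2;2;1],6);([::2;0;1;
 2],6);([::5;2;5;0],14);([::3;0;1;3],9);([::2;0;3;4],12);([::23;13;0;16],46);([::1;2;0;2],5);
 ([::10;0;7;4],32);([::4;3;2;0],12);([::4;3;0;2],12);([::27;16;9;0],84);([::23;11;0;17],85);
 ([::5;0;12;16],50);([::13;23;15;0],85);([::0;8;17;18],68);([::11;9;0;4],46);([::17;6;0;3],55);
 ([::1;8;4;0],20);([::5;14;0;13],56);([::18;0;2;19],80);([::16;21;9;0],113)],[::(false,Cut [::4;
 5;0;4] 39 (Point 3) (Cut [::4;2;0;7] 43 o Nothing));(true,Cut [::4;5;0;4] 39 (Point 3) (Cut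
 [::4;2;0;7] 43 o o));(false,Cut [::1;6;2;0] 19 o (Cut [::1;2;0;4] 16 o (Cut [::1;3;3;0] 15 o
 o)));(true,Cut [::1;6;2;0] 19 o (Cut [::1;2;0;4] 16 o (Cut [::1;3;3;0] 15 o o)));(true,Cut
 [::4;5;0;4] 39 (Point 3) (Point 3))]);([::([::15;18;0;13],36);([::5;0;5;2],14);([::2;1;0;2],5);
 ([::0;13;12;7],42);([::4;0;5;1],13);([::4;5;1;0],14);([::6;11;10;0],45);([::4;5;0;2],16);([::5;
 0;3;2],15);([::4;9;3;0],29);([::2;0;4;3],13);([::4;0;6;1],19);([::2;3;4;0],19);([::0;2;4;
 1],12);([::7;12;0;9],45);([::0;6;5;4],30);([::17;7;11;0],81);([::0;3;1;2],13);([::0;3;3;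
 1],20)],[::(false,Cut [::0;5;1;5] 28 (Point 3) (Cut [::1;0;0;1] 2 o Nothing));(true,Cut [::0;5;
 1;5] 28 (Point 3) (Cut [::1;0;0;1] 2 o o));(false,Cut [::2;0;2;3] 12 (Cut [::0;0;3;2] 9 o o)
 (Cut [::1;0;4;6] 24 o o));(true,Cut [::2;0;2;3] 12 (Cut [::0;0;3;2] 9 o o) (Cut [::1;0;4;6] 24
 o o));(true,Cut [::0;5;1;5] 28 (Point 3) (Point 3))]);([::([::11;8;0;8],22);([::0;7;7;3],20);
 ([::26;0;21;11],80);([::5;9;0;9],25);([::5;13;11;0],44);([::7;3;11;0],33);([::0;15;22;6],64);
 ([::1;0;2;2],7);([::0;2;23;26],74);([::7;0;4;11],37);([::2;0;1;4],12);([::16;0;9;7],62);([::8;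
 5;0;6],31);([::5;0;2;1],17);([::5;8;4;0],34);([::4;2;0;3],20);([::5;0;4;8],43)],[::(false,Cut
 [::3;0;1;1] 18 (Point 3) (Cut [::0;9;7;1] 28 o Nothing));(true,Cut [::3;0;1;1] 18 (Point 3)
 (Cut [::0;9;7;1] 28 o o));(false,Cut [::3;0;5;2] 30 (Cut [::8;0;3;4] 45 o o) (Cut [::2;0;1;4]
 18 o o));(true,Cut [::3;0;5;2] 30 (Cut [::8;0;3;4] 45 o o) (Cut [::2;0;1;4] 18 o o));(true,Cut
 [::3;0;1;1] 18 (Point 3) (Point 3))]);([::([::13;9;4;0],44);([::0;24;13;27],80);([::1;2;0;
 1],4);([::5;2;0;3],14);([::0;4;7;8],26);([::23;0;3;17],69);([::22;0;12;9],73);([::10;0;19;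
 24],87);([::0;5;1;4],13);([::7;6;0;5],36);([::0;2;2;3],12);([::17;0;21;8],91);([::7;18;0;
 30],117);([::1;0;4;6],26);([::6;0;15;14],96)],[::(false,Cut [::4;8;0;7] 51 (Point 3) (Cut [::4;
 5;0;5] 45 o Nothing));(true,Cut [::4;8;0;7] 51 (Point 3) (Cut [::4;5;0;5] 45 o o));(false,Cut
 [::2;9;0;9] 42 o (Cut [::3;2;0;5] 36 (Cut [::0;7;5;9] 56 o o) o));(true,Cut [::2;9;0;9] 42 o
 (Cut [::3;2;0;5] 36 (Cut [::0;7;5;9] 56 o o) o));(true,Cut [::4;8;0;7] 51 (Point 3) (Point
 3))]);([::([::5;0;9;12],36);([::7;0;9;10],46);([::5;0;5;1],19);([::7;9;8;0],44);([::7;0;3;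
 2],24);([::6;0;3;1],24);([::25;13;0;14],75);([::1;2;0;2],6);([::0;6;4;1],14);([::0;9;17;6],49);
 ([::5;2;0;6],25);([::0;1;11;6],34);([::0;6;0;13],31)],[::(false,Cut [::0;2;6;1] 22 (Point 3)
 (Cut [::1;0;4;2] 23 o Nothing));(true,Cut [::0;2;6;1] 22 (Point 3) (Cut [::1;0;4;2] 23 o o));
 (false,Cut [::5;0;4;4] 40 (Cut [::4;0;1;7] 35 (Cut [::5;2;0;4] 27 o o) o) o);(true,Cut [::5;0;
 4;4] 40 (Cut [::4;0;1;7] 35 (Cut [::5;2;0;4] 27 o o) o) o);(true,Cut [::0;2;6;1] 22 (Point 3)
 (Point 3))]);([::([::1;3;0;2],6);([::17;13;0;10],66);([::3;4;0;2],17);([::17;0;9;4],46);([::6;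
 1;0;4],21);([::10;0;9;4],43);([::9;16;0;20],95);([::0;4;4;9],26);([::4;0;6;13],48);([::12;7;9;
 0],60);([::5;0;2;2],27)],[::(false,Cut [::1;0;2;1] 10 (Point 3) (Cut [::3;5;0;4] 28 o
 Nothing));(true,Cut [::1;0;2;1] 10 (Point 3) (Cut [::3;5;0;4] 28 o o));(false,Cut [::2;0;6;5]
 28 o (Cut [::5;0;1;2] 32 (Cut [::1;3;2;0] 10 o o) o));(true,Cut [::2;0;6;5] 28 o (Cut [::5;0;1;
 2] 32 (Cut [::1;3;2;0] 10 o o) o));(true,Cut [::1;0;2;1] 10 (Point 3) (Point 3))]);([::([::5;0;
 3;2],16);([::13;0;19;23],85);([::6;0;9;2],31);([::0;10;8;3],38);([::0;18;2;17],44);([::10;5;7;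
 0],54);([::0;5;22;21],85);([::0;3;7;5],38);([::5;6;3;0],34)],[::(false,Cut [::0;8;6;7] 58
 (Point 3) (Cut [::0;6;1;3] 26 o Nothing));(true,Cut [::0;8;6;7] 58 (Point 3) (Cut [::0;6;1;3]
 26 o o));(false,Cut [::5;0;7;0] 38 o (Cut [::5;2;0;4] 16 (Cut [::0;1;6;8] 41 o o) o));
 (true,Cut [::5;0;7;0] 38 o (Cut [::5;2;0;4] 16 (Cut [::0;1;6;8] 41 o o) o));(true,Cut [::0;8;6;
 7] 58 (Point 3) (Point 3))]);([::([::2;0;4;3],14);([::3;0;1;0],8);([::0;4;1;4],12);([::21;13;0;
 0],63);([::0;2;21;19],63);([::0;5;3;6],27);([::0;19;5;22],96)],[::(false,Cut [::0;5;1;1] 19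
 (Point 3) (Cut [::0;4;3;6] 31 o Nothing));(true,Cut [::0;5;1;1] 19 (Point 3) (Cut [::0;4;3;6]
 31 o o));(false,Cut [::3;0;6;4] 34 (Cut [::5;6;0;5] 42 o (Cut [::2;0;9;5] 27 o o)) o);
 (true,Cut [::3;0;6;4] 34 (Cut [::5;6;0;5] 42 o (Cut [::2;0;9;5] 27 o o)) o);(true,Cut [::0;5;1;
 1] 19 (Point 3) (Point 3))]);([::([::21;19;27;0],168);([::1;9;6;0],42);([::8;25;0;1],50);
 ([::11;0;18;9],78);([::0;0;2;1],8)],[::(false,Cut [::3;0;4;0] 26 (Point 3) (Cut [::0;0;2;1] 13
 o Nothing));(true,Cut [::3;0;4;0] 26 (Point 3) (Cut [::0;0;2;1] 13 o o));(false,Cut [::3;1;0;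
 6] 8 o (Cut [::2;7;0;4] 26 (Cut [::3;0;6;4] 39 o o) o));(true,Cut [::3;1;0;6] 8 o (Cut [::2;7;
 0;4] 26 (Cut [::3;0;6;4] 39 o o) o));(true,Cut [::3;0;4;0] 26 (Point 3) (Point 3))]);([::([::3;
 8;5;0],41);([::1;0;2;2],11);([::2;1;0;0],4)],[::(false,Cut [::0;7;4;1] 35 (Point 3) (Cut [::1;
 6;0;7] 26 o Nothing));(true,Cut [::0;7;4;1] 35 (Point 3) (Cut [::1;6;0;7] 26 o o));(false,Cut
 [::0;2;5;5] 32 (Cut [::1;0;3;4] 18 o o) (Cut [::0;5;8;0] 53 o o));(true,Cut [::0;2;5;5] 32
 (Cut [::1;0;3;4] 18 o o) (Cut [::0;5;8;0] 53 o o));(true,Cut [::0;7;4;1] 35 (Point 3) (Point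
 3))]);([::([::25;0;20;8],160)],[::(false,Cut [::0;2;4;1] 29 (Point 3) (Cut [::5;0;4;1] 38 o
 Nothing));(true,Cut [::0;2;4;1] 29 (Point 3) (Cut [::5;0;4;1] 38 o o));(false,Cut [::8;5;0;2]
 16 o (Cut [::0;3;7;3] 48 (Cut [::1;0;3;7] 27 o o) o));(true,Cut [::8;5;0;2] 16 o (Cut [::0;3;7;
 3] 48 (Cut [::1;0;3;7] 27 o o) o));(true,Cut [::0;2;4;1] 29 (Point 3) (Point 3))]);
 ([::],[::(false,Cut [::8;2;3;0] 35 o Nothing);(true,Cut [::8;2;3;0] 35 o o);(true,Point 3);
 (true,Point 4)])].

Definition fours0 : seq (cut_data * cut_tree) :=[::(([::0;11;11;9],33),Cut [::0;3;0;1] 5 (Cut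
 [::3;0;2;0] 25 (Cut [::4;0;5;2] 35 o o) (Cut [::4;1;0;3] 35 o o)) o);(([::1;0;1;1],3),Cut [::1;
 1;0;1] 8 o (Cut [::0;5;4;5] 40 o (Cut [::0;1;0;0] 8 (Cut [::3;0;0;4] 7 o o) o)));(([::1;1;1;
 0],3),Cut [::2;0;5;5] 42 (Cut [::0;5;1;4] 37 o o) (Cut [::1;2;0;3] 26 (Cut [::5;1;0;5] 40 o o)
 o));(([::2;2;1;0],7),Cut [::1;2;3;0] 15 (Cut [::0;6;6;1] 23 o (Cut [::6;6;0;5] 31 o (Cut [::2;
 0;3;3] 24 o o))) o);(([::2;0;1;2],7),Cut [::3;1;2;0] 11 o (Cut [::0;1;1;1] 8 o (Cut [::3;0;2;
 0] 8 o (Cut [::1;0;3;2] 15 o o))));(([::24;23;7;0],86),Cut [::4;6;0;1] 12 (Cut [::1;2;0;2] 3 o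
 (Cut [::2;2;3;0] 20 o o)) (Cut [::0;6;1;2] 18 o o));(([::11;7;4;0],41),Cut [::5;1;0;3] 20 (Cut
 [::0;1;4;1] 15 o (Cut [::4;3;6;0] 30 o o)) (Cut [::2;3;0;0] 10 o o));(([::0;2;1;2],7),Cut [::1;
 0;0;2] 8 (Cut [::4;0;5;5] 35 o (Cut [::5;0;3;1] 38 (Cut [::0;1;2;0] 9 o o) o)) o);(([::5;9;6;
 0],39),Cut [::6;0;1;6] 48 (Cut [::1;0;6;3] 21 o o) (Cut [::2;3;3;0] 11 o (Cut [::2;4;5;0] 15 o
 o)));(([::7;0;4;1],23),Cut [::1;0;1;5] 17 (Cut [::5;0;6;0] 16 (Cut [::1;5;0;6] 43 o o) o) (Cut
 [::5;2;0;4] 29 o o));(([::0;9;6;4],39),Cut [::3;4;5;0] 33 (Cut [::0;3;2;2] 12 (Cut [::4;2;0;5]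
 34 o o) (Cut [::0;1;3;2] 11 o o)) o);(([::0;2;3;1],14),Cut [::0;0;1;2] 6 (Cut [::0;3;0;1] 11 o
 (Cut [::0;5;0;2] 25 (Cut [::0;4;3;4] 22 o o) o)) o);(([::3;0;17;13],97),Cut [::0;5;2;4] 22 o
 (Cut [::3;2;6;0] 35 (Cut [::2;6;5;0] 37 o (Cut [::3;1;0;3] 13 o o)) o));(([::8;9;4;0],53),Cut
 [::0;1;4;6] 35 (Cut [::0;3;2;1] 14 o (Cut [::2;4;3;0] 28 (Cut [::0;3;4;1] 28 o o) o)) o)].

Definition tails1 : seq tail_data :=[::([::([::6;6;0;5],12);([::5;0;4;5],10);([::5;4;4;0],10);
 ([::26;12;23;0],64);([::1;0;2;2],5);([::0;2;1;2],7);([::4;0;5;2],13);([::2;2;0;1],5);([::1;0;3;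
 2],8);([::2;7;0;8],21);([::12;0;25;23],98);([::0;18;17;10],70);([::0;1;2;4],11);([::2;5;9;
 0],20);([::9;4;19;0],46);([::2;1;2;0],8);([::0;8;12;19],81);([::4;0;8;3],30);([::5;9;0;6],32);
 ([::6;0;8;5],42);([::3;5;0;1],13);([::9;16;0;2],47);([::8;9;0;8],50);([::5;0;1;
 0],13)],[::(false,Cut [::9;0;1;3] 47 (Point 3) Nothing);(true,Cut [::9;0;1;3] 47 (Point 3) o);
 (false,Cut [::0;3;5;2] 23 (Cut [::3;1;4;0] 18 o o) Nothing);(true,Cut [::0;3;5;2] 23 (Cut [::3;
 1;4;0] 18 o o) o);(true,Cut [::9;0;1;3] 47 (Point 3) (Point 3))]);([::([::0;2;1;2],7);([::7;8;
 0;10],20);([::11;0;13;16],32);([::7;7;0;3],17);([::14;25;0;11],66);([::1;4;0;4],13);([::2;1;2;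
 0],6);([::0;3;1;2],10);([::0;13;5;11],57);([::0;16;9;5],48);([::0;4;3;6],25);([::0;7;3;11],44);
 ([::2;0;8;7],18);([::12;7;6;0],37);([::2;2;0;1],8);([::3;5;2;0],19);([::1;2;2;0],10);([::0;2;4;
 3],19);([::1;19;11;0],88);([::0;3;10;6],43);([::1;0;8;5],29);([::1;0;1;3],9)],[::(false,Cut
 [::7;2;8;0] 44 (Point 3) Nothing);(true,Cut [::7;2;8;0] 44 (Point 3) o);(false,Cut [::1;1;2;0]
 9 o (Cut [::0;9;8;9] 78 o Nothing));(true,Cut [::1;1;2;0] 9 o (Cut [::0;9;8;9] 78 o o));
 (true,Cut [::7;2;8;0] 44 (Point 3) (Point 3))]);([::([::1;1;0;1],2);([::4;2;3;0],13);([::11;0;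
 12;13],26);([::6;1;5;0],15);([::1;3;3;0],9);([::7;4;12;0],39);([::5;3;2;0],17);([::0;2;1;2],7);
 ([::9;8;5;0],45);([::5;14;0;7],33);([::20;21;0;16],94);([::0;1;2;2],7);([::13;17;8;0],84);
 ([::0;6;3;10],32);([::6;20;0;3],67);([::3;6;0;5],32);([::12;0;23;13],62);([::6;0;2;5],16);
 ([::3;2;0;1],15);([::0;13;2;8],63)],[::(false,Cut [::6;3;2;0] 36 (Point 3) Nothing);(true,Cut
 [::6;3;2;0] 36 (Point 3) o);(false,Cut [::3;8;0;1] 47 (Cut [::1;4;0;4] 26 o o) Nothing);
 (true,Cut [::3;8;0;1] 47 (Cut [::1;4;0;4] 26 o o) o);(true,Cut [::6;3;2;0] 36 (Point 3) (Point
 3))]);([::([::1;1;0;1],2);([::2;0;2;1],6);([::9;3;11;0],32);([::7;24;26;0],76);([::0;2;1;2],7);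
 ([::0;3;2;4],15);([::0;25;15;22],118);([::0;4;8;11],36);([::1;4;2;0],12);([::1;3;5;0],17);
 ([::0;7;11;6],57);([::0;9;4;5],38);([::0;1;19;13],68);([::0;8;6;11],59);([::2;0;3;5],18);([::2;
 3;1;0],11);([::17;17;0;15],81);([::19;10;16;0],98)],[::(false,Cut [::2;0;5;0] 25 (Point 3)
 Nothing);(true,Cut [::2;0;5;0] 25 (Point 3) o);(false,Cut [::5;7;1;0] 33 (Cut [::1;0;6;4] 33 o
 o) Nothing);(true,Cut [::5;7;1;0] 33 (Cut [::1;0;6;4] 33 o o) o);(true,Cut [::2;0;5;0] 25
 (Point 3) (Point 3))]);([::([::2;0;2;1],6);([::6;14;9;0],42);([::0;22;21;6],82);([::0;9;7;
 6],45);([::28;0;15;22],90);([::2;0;5;6],18);([::0;3;16;10],52);([::0;5;11;15],67);([::3;3;1;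
 0],10);([::14;0;26;5],72);([::3;0;4;2],19);([::1;2;0;1],4);([::15;25;12;0],103);([::9;13;16;
 0],101);([::1;0;3;2],17);([::3;0;7;1],43)],[::(false,Cut [::2;0;2;1] 17 (Point 3) Nothing);
 (true,Cut [::2;0;2;1] 17 (Point 3) o);(false,Cut [::7;2;2;0] 28 (Cut [::0;1;2;8] 21 o o)
 Nothing);(true,Cut [::7;2;2;0] 28 (Cut [::0;1;2;8] 21 o o) o);(true,Cut [::2;0;2;1] 17 (Point
 3) (Point 3))]);([::([::7;8;0;10],22);([::3;10;8;0],27);([::3;5;4;0],21);([::5;0;4;2],15);
 ([::2;1;0;3],7);([::19;0;10;5],54);([::1;0;3;3],9);([::3;2;0;1],8);([::0;5;1;3],15);([::18;0;7;
 21],85);([::21;0;17;1],78);([::10;8;5;0],51);([::21;8;0;3],88);([::1;1;0;2],10)],[::(false,Cut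
 [::0;7;7;4] 40 (Point 3) Nothing);(true,Cut [::0;7;7;4] 40 (Point 3) o);(false,Cut [::0;1;3;8]
 29 (Cut [::0;7;6;2] 26 o o) Nothing);(true,Cut [::0;1;3;8] 29 (Cut [::0;7;6;2] 26 o o) o);
 (true,Cut [::0;7;7;4] 40 (Point 3) (Point 3))]);([::([::13;17;0;14],57);([::7;11;0;7],42);
 ([::8;0;5;4],25);([::1;0;2;2],7);([::8;3;7;0],29);([::18;0;14;9],78);([::4;9;8;0],33);([::11;9;
 0;5],49);([::3;0;19;10],50);([::13;4;0;11],58);([::10;0;17;1],60);([::11;17;19;
 0],113)],[::(false,Cut [::8;0;1;4] 42 (Point 3) Nothing);(true,Cut [::8;0;1;4] 42 (Point 3) o);
 (false,Cut [::5;8;1;0] 42 (Cut [::1;8;0;7] 33 o o) Nothing);(true,Cut [::5;8;1;0] 42 (Cut [::1;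
 8;0;7] 33 o o) o);(true,Cut [::8;0;1;4] 42 (Point 3) (Point 3))]);([::([::4;3;0;3],12);([::4;
 23;0;10],54);([::7;5;0;11],38);([::16;22;0;27],140);([::11;0;9;6],40);([::14;7;0;15],79);([::0;
 7;8;11],56);([::0;1;1;0],2);([::0;6;0;5],32);([::2;1;0;5],24)],[::(false,Cut [::3;2;2;0] 15
 (Point 3) Nothing);(true,Cut [::3;2;2;0] 15 (Point 3) o);(false,Cut [::0;8;7;4] 44 o (Cut [::1;
 2;0;2] 17 o Nothing));(true,Cut [::0;8;7;4] 44 o (Cut [::1;2;0;2] 17 o o));(true,Cut [::3;2;2;
 0] 15 (Point 3) (Point 3))]);([::([::15;8;0;8],38);([::12;0;11;7],46);([::14;23;14;0],106);
 ([::3;0;19;7],51);([::0;13;7;8],62);([::1;1;0;2],6);([::6;1;5;0],24);([::13;25;0;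
 8],109)],[::(false,Cut [::6;6;0;5] 46 (Point 3) Nothing);(true,Cut [::6;6;0;5] 46 (Point 3) o);
 (false,Cut [::3;0;2;2] 16 (Cut [::6;5;0;5] 37 o o) Nothing);(true,Cut [::3;0;2;2] 16 (Cut [::6;
 5;0;5] 37 o o) o);(true,Cut [::6;6;0;5] 46 (Point 3) (Point 3))]);([::([::8;10;0;5],40);([::14;
 23;0;12],107);([::1;10;0;6],43);([::28;23;26;0],144);([::5;0;4;0],13);([::12;17;8;
 0],100)],[::(false,Cut [::4;2;3;0] 25 (Point 3) Nothing);(true,Cut [::4;2;3;0] 25 (Point 3) o);
 (false,Cut [::0;3;4;0] 17 o (Cut [::3;0;8;2] 27 o Nothing));(true,Cut [::0;3;4;0] 17 o (Cut
 [::3;0;8;2] 27 o o));(true,Cut [::4;2;3;0] 25 (Point 3) (Point 3))]);([::([::1;24;0;20],110);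
 ([::16;0;15;22],99);([::6;9;0;11],73);([::0;2;2;5],28)],[::(false,Cut [::8;5;9;0] 38 (Point 3)
 Nothing);(true,Cut [::8;5;9;0] 38 (Point 3) o);(false,Cut [::3;9;0;2] 44 o (Cut [::1;2;0;6] 38
 o Nothing));(true,Cut [::3;9;0;2] 44 o (Cut [::1;2;0;6] 38 o o));(true,Cut [::8;5;9;0] 38
 (Point 3) (Point 3))]);([::([::3;2;3;0],15);([::5;3;0;2],27)],[::(false,Cut [::0;5;3;3] 32
 (Point 3) Nothing);(true,Cut [::0;5;3;3] 32 (Point 3) o);(false,Cut [::5;1;5;0] 22 o (Cut [::0;
 9;4;7] 49 o Nothing));(true,Cut [::5;1;5;0] 22 o (Cut [::0;9;4;7] 49 o o));(true,Cut [::0;5;3;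
 3] 32 (Point 3) (Point 3))]);([::],[::(false,Cut [::0;8;4;1] 40 (Point 3) Nothing);(true,Cut
 [::0;8;4;1] 40 (Point 3) o);(false,Cut [::8;3;1;0] 38 (Cut [::9;2;0;8] 43 o o) Nothing);
 (true,Cut [::8;3;1;0] 38 (Cut [::9;2;0;8] 43 o o) o);(true,Cut [::0;8;4;1] 40 (Point 3) (Point
 3));(true,Point 4)])].

Definition fours1 : seq (cut_data * cut_tree) :=[::(([::1;1;1;0],3),Cut [::5;5;0;1] 13 (Cut
 [::1;1;0;2] 16 o o) (Cut [::1;0;1;1] 8 o (Cut [::4;0;3;1] 14 o o)));(([::2;2;1;0],7),Cut [::3;
 0;2;4] 30 (Cut [::1;5;0;3] 23 (Cut [::3;2;5;0] 25 o o) o) (Cut [::5;4;2;0] 13 o o));(([::1;0;1;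
 1],3),Cut [::0;0;0;1] 1 (Cut [::0;2;1;2] 17 (Cut [::5;0;0;4] 9 o o) (Cut [::0;2;0;3] 18 o o))
 o);(([::0;2;1;2],8),Cut [::1;2;0;2] 6 (Cut [::0;6;5;4] 31 o o) (Cut [::2;0;1;3] 17 (Cut [::4;3;
 5;0] 39 o o) o));(([::2;0;1;2],7),Cut [::3;1;2;0] 11 o (Cut [::2;0;1;2] 5 o (Cut [::0;3;5;5]
 30 o (Cut [::1;2;0;1] 9 o o))));(([::19;20;6;0],73),Cut [::3;0;1;3] 12 o (Cut [::4;6;5;0] 37
 (Cut [::1;6;1;0] 12 (Cut [::1;2;0;0] 2 o o) o) o));(([::0;5;24;26],89),Cut [::0;1;4;1] 10 (Cut
 [::5;2;0;1] 28 o (Cut [::4;5;0;0] 40 (Cut [::0;0;2;1] 2 o o) o)) o);(([::0;14;11;4],54),Cut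
 [::0;0;2;3] 14 (Cut [::1;0;3;1] 10 o o) (Cut [::1;1;0;4] 20 o (Cut [::3;0;5;6] 44 o o)));
 (([::6;9;2;0],33),Cut [::2;1;2;0] 15 (Cut [::3;0;2;0] 9 o (Cut [::3;0;0;4] 15 o o)) (Cut [::2;
 3;5;0] 39 o o));(([::10;11;0;6],58),Cut [::0;2;1;4] 17 (Cut [::1;0;5;6] 31 o (Cut [::1;2;0;4]
 10 (Cut [::3;0;1;0] 10 o o) o)) o);(([::10;0;2;7],37),Cut [::0;3;2;4] 22 o (Cut [::0;4;1;4] 31
 (Cut [::1;0;1;4] 11 o o) (Cut [::0;2;3;0] 12 o o)));(([::6;2;5;0],31),Cut [::0;0;0;1] 4 (Cut
 [::6;2;0;3] 26 o (Cut [::0;1;3;4] 18 o (Cut [::0;5;1;5] 35 o o))) o)].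

Definition tails2 : seq tail_data :=[::([::([::9;11;0;9],22);([::18;0;8;17],60);([::1;1;1;0],2);
 ([::25;13;29;0],71);([::0;5;2;5],16);([::0;4;2;3],15);([::12;9;20;0],53);([::5;10;17;0],45);
 ([::25;26;30;0],135);([::2;2;0;1],5);([::0;25;7;22],90);([::17;8;0;28],75);([::6;3;0;5],24);
 ([::4;6;1;0],15);([::1;10;5;0],29);([::10;7;0;12],61);([::7;16;17;0],86);([::4;9;0;8],52);
 ([::0;2;3;5],18);([::1;0;2;3],12)],[::(false,Cut [::3;0;2;7] 31 (Point 3) (Cut [::3;3;8;0] 31
 o Nothing));(true,Cut [::3;0;2;7] 31 (Point 3) (Cut [::3;3;8;0] 31 o o));(false,Cut [::1;7;0;
 5] 48 (Cut [::5;1;4;0] 16 o (Cut [::1;2;1;0] 10 o o)) o);(true,Cut [::1;7;0;5] 48 (Cut [::5;1;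
 4;0] 16 o (Cut [::1;2;1;0] 10 o o)) o);(true,Cut [::3;0;2;7] 31 (Point 3) (Point 3))]);
 ([::([::9;11;13;0],26);([::2;0;2;1],7);([::1;2;2;0],5);([::0;20;13;5],55);([::11;12;24;0],68);
 ([::9;15;0;14],32);([::5;5;4;0],21);([::1;5;3;0],15);([::2;1;0;2],5);([::23;26;4;0],66);([::0;
 10;2;5],31);([::6;27;0;22],104);([::2;3;0;1],12);([::27;21;17;0],135);([::3;0;1;0],6);([::8;1;
 0;7],28);([::5;5;0;2],34);([::13;12;0;6],99)],[::(false,Cut [::4;3;0;7] 39 (Point 3) (Cut [::0;
 6;1;7] 39 o Nothing));(true,Cut [::4;3;0;7] 39 (Point 3) (Cut [::0;6;1;7] 39 o o));(false,Cut
 [::5;0;8;3] 28 (Cut [::9;9;5;0] 77 o o) (Cut [::3;0;1;2] 17 o o));(true,Cut [::5;0;8;3] 28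
 (Cut [::9;9;5;0] 77 o o) (Cut [::3;0;1;2] 17 o o));(true,Cut [::4;3;0;7] 39 (Point 3) (Point
 3))]);([::([::0;1;3;4],11);([::13;16;0;21],42);([::1;2;0;3],7);([::2;2;1;0],6);([::5;2;4;
 0],14);([::6;5;0;3],18);([::2;1;0;2],7);([::0;3;0;7],15);([::0;11;5;7],41);([::3;8;0;4],27);
 ([::0;15;13;3],45);([::0;2;3;1],11);([::17;4;12;0],50);([::11;11;0;5],54);([::0;5;2;2],22);
 ([::11;1;0;9],41)],[::(false,Cut [::5;0;5;2] 24 (Point 3) (Cut [::0;3;2;9] 33 o Nothing));
 (true,Cut [::5;0;5;2] 24 (Point 3) (Cut [::0;3;2;9] 33 o o));(false,Cut [::6;0;1;3] 20 o (Cut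
 [::2;3;2;0] 18 o (Cut [::3;0;3;2] 16 o o)));(true,Cut [::6;0;1;3] 20 o (Cut [::2;3;2;0] 18 o
 (Cut [::3;0;3;2] 16 o o)));(true,Cut [::5;0;5;2] 24 (Point 3) (Point 3))]);([::([::6;0;3;
 4],23);([::8;9;4;0],26);([::6;1;5;0],15);([::0;6;3;4],23);([::9;0;7;5],42);([::9;0;11;3],45);
 ([::0;1;18;20],59);([::13;4;7;0],44);([::0;9;9;5],43);([::7;0;19;10],89);([::0;7;9;1],43);
 ([::0;0;2;3],13);([::10;5;11;0],74);([::24;18;13;0],122)],[::(false,Cut [::1;8;9;0] 73 (Point
 3) (Cut [::4;0;1;1] 11 o Nothing));(true,Cut [::1;8;9;0] 73 (Point 3) (Cut [::4;0;1;1] 11 o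
 o));(false,Cut [::0;6;9;8] 80 (Cut [::1;0;3;7] 26 o (Cut [::5;9;6;0] 52 o o)) o);(true,Cut
 [::0;6;9;8] 80 (Cut [::1;0;3;7] 26 o (Cut [::5;9;6;0] 52 o o)) o);(true,Cut [::1;8;9;0] 73
 (Point 3) (Point 3))]);([::([::5;0;4;2],20);([::6;4;0;9],18);([::17;2;11;0],47);([::0;5;4;
 2],16);([::0;5;3;1],14);([::4;0;11;8],38);([::3;0;10;6],38);([::26;25;19;0],126);([::2;0;8;
 1],26);([::0;5;4;9],35);([::4;0;19;20],128);([::25;4;17;0],118)],[::(false,Cut [::1;0;5;3] 38
 (Point 3) (Cut [::0;2;5;6] 48 o Nothing));(true,Cut [::1;0;5;3] 38 (Point 3) (Cut [::0;2;5;6]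
 48 o o));(false,Cut [::8;2;0;7] 21 o (Cut [::5;3;1;0] 15 o (Cut [::5;0;4;1] 34 o o)));
 (true,Cut [::8;2;0;7] 21 o (Cut [::5;3;1;0] 15 o (Cut [::5;0;4;1] 34 o o)));(true,Cut [::1;0;5;
 3] 38 (Point 3) (Point 3))]);([::([::2;0;6;5],20);([::8;5;0;9],21);([::5;0;2;4],22);([::0;4;1;
 5],16);([::5;4;0;0],12);([::13;0;9;16],89);([::16;21;0;24],136);([::0;7;3;4],25);([::0;0;1;
 1],4);([::0;9;6;2],32)],[::(false,Cut [::0;7;3;6] 48 (Point 3) (Cut [::1;2;0;3] 23 o Nothing));
 (true,Cut [::0;7;3;6] 48 (Point 3) (Cut [::1;2;0;3] 23 o o));(false,Cut [::0;2;6;3] 24 o (Cut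
 [::1;0;4;0] 9 o (Cut [::0;1;4;4] 25 o o)));(true,Cut [::0;2;6;3] 24 o (Cut [::1;0;4;0] 9 o
 (Cut [::0;1;4;4] 25 o o)));(true,Cut [::0;7;3;6] 48 (Point 3) (Point 3))]);([::([::7;0;10;
 5],45);([::0;2;6;9],36);([::1;2;2;0],7);([::11;0;21;6],89);([::8;7;0;11],23);([::6;0;4;1],26);
 ([::6;1;0;3],15);([::8;9;0;14],59)],[::(false,Cut [::0;5;4;2] 24 (Point 3) (Cut [::4;3;0;5] 28
 o Nothing));(true,Cut [::0;5;4;2] 24 (Point 3) (Cut [::4;3;0;5] 28 o o));(false,Cut [::0;2;7;
 4] 35 (Cut [::0;2;5;4] 26 o o) (Cut [::4;3;2;0] 19 o o));(true,Cut [::0;2;7;4] 35 (Cut [::0;2;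
 5;4] 26 o o) (Cut [::4;3;2;0] 19 o o));(true,Cut [::0;5;4;2] 24 (Point 3) (Point 3))]);
 ([::([::0;4;5;11],39);([::2;0;3;9],30);([::9;2;3;0],26);([::2;9;12;0],30);([::0;4;21;8],83);
 ([::5;4;0;4],21)],[::(false,Cut [::0;8;3;7] 40 (Point 3) (Cut [::3;0;2;4] 24 o Nothing));
 (true,Cut [::0;8;3;7] 40 (Point 3) (Cut [::3;0;2;4] 24 o o));(false,Cut [::2;0;3;1] 20 (Cut
 [::0;6;5;3] 35 (Cut [::0;9;1;4] 21 o o) o) o);(true,Cut [::2;0;3;1] 20 (Cut [::0;6;5;3] 35
 (Cut [::0;9;1;4] 21 o o) o) o);(true,Cut [::0;8;3;7] 40 (Point 3) (Point 3))]);([::([::12;2;5;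
 0],40);([::6;23;24;0],111);([::0;14;2;13],39);([::4;4;1;0],18)],[::(false,Cut [::6;8;0;7] 47
 (Point 3) (Cut [::0;3;3;7] 32 o Nothing));(true,Cut [::6;8;0;7] 47 (Point 3) (Cut [::0;3;3;7]
 32 o o));(false,Cut [::8;0;5;8] 44 o (Cut [::3;5;7;0] 38 o (Cut [::1;0;3;0] 14 o o)));
 (true,Cut [::8;0;5;8] 44 o (Cut [::3;5;7;0] 38 o (Cut [::1;0;3;0] 14 o o)));(true,Cut [::6;8;0;
 7] 47 (Point 3) (Point 3))]);([::([::17;28;0;29],73);([::3;5;0;2],14)],[::(false,Cut [::4;3;2;
 0] 25 (Point 3) (Cut [::4;6;3;0] 39 o Nothing));(true,Cut [::4;3;2;0] 25 (Point 3) (Cut [::4;6;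
 3;0] 39 o o));(false,Cut [::8;0;9;6] 67 (Cut [::0;6;7;6] 51 o (Cut [::7;8;9;0] 67 o o)) o);
 (true,Cut [::8;0;9;6] 67 (Cut [::0;6;7;6] 51 o (Cut [::7;8;9;0] 67 o o)) o);(true,Cut [::4;3;2;
 0] 25 (Point 3) (Point 3))]);([::],[::(false,Cut [::3;3;0;4] 18 (Point 3) (Cut [::2;0;1;1] 9 o
 Nothing));(true,Cut [::3;3;0;4] 18 (Point 3) (Cut [::2;0;1;1] 9 o o));(false,Cut [::3;0;6;7]
 46 (Cut [::0;3;1;3] 15 o o) (Cut [::7;9;0;8] 34 o o));(true,Cut [::3;0;6;7] 46 (Cut [::0;3;1;
 3] 15 o o) (Cut [::7;9;0;8] 34 o o));(true,Cut [::3;3;0;4] 18 (Point 3) (Point 3));(true,Point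
 4)])].

Definition fours2 : seq (cut_data * cut_tree) :=[::(([::0;2;1;2],8),Cut [::0;5;5;1] 30 (Cut
 [::1;2;2;0] 12 o (Cut [::2;0;4;5] 24 o (Cut [::0;1;6;3] 28 o o))) o);(([::5;6;6;0],18),Cut
 [::0;1;2;2] 17 (Cut [::0;1;1;1] 8 o o) (Cut [::3;3;0;5] 40 o (Cut [::3;0;0;4] 35 o o)));(([::9;
 0;5;10],40),Cut [::1;0;1;1] 6 (Cut [::6;3;0;1] 23 (Cut [::0;1;3;5] 20 o (Cut [::1;1;0;3] 8 o
 o)) o) o);(([::6;0;3;4],25),Cut [::1;0;2;1] 10 (Cut [::3;4;3;0] 23 (Cut [::0;4;0;1] 21 o o)
 (Cut [::0;3;6;5] 35 o o)) o);(([::2;2;1;0],7),Cut [::0;1;0;3] 13 o (Cut [::1;1;0;1] 6 o (Cut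
 [::6;3;0;2] 18 o (Cut [::0;1;1;1] 8 o o))));(([::2;0;7;6],28),Cut [::4;3;1;0] 31 (Cut [::0;6;5;
 2] 33 (Cut [::5;0;3;2] 27 (Cut [::1;2;1;0] 11 o o) o) o) o);(([::16;0;14;1],64),Cut [::0;5;4;
 3] 31 (Cut [::0;6;1;2] 23 o o) (Cut [::1;2;1;0] 9 (Cut [::2;0;2;5] 28 o o) o));(([::0;24;13;
 18],111),Cut [::3;0;4;4] 28 o (Cut [::1;2;5;0] 9 o (Cut [::4;0;6;1] 37 (Cut [::2;2;0;3] 19 o
 o) o)));(([::3;7;8;0],48),Cut [::0;3;3;1] 11 o (Cut [::4;0;1;2] 19 (Cut [::2;6;0;3] 22 o o)
 (Cut [::6;5;3;0] 31 o o)));(([::0;12;3;10],48),Cut [::1;0;5;0] 32 (Cut [::2;3;1;0] 13 o o)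
 (Cut [::2;3;0;4] 4 o (Cut [::1;1;0;0] 1 o o)))].

Definition tails3 : seq tail_data :=[::([::([::0;3;11;12],38);([::7;0;6;3],23);([::0;16;25;
 29],144);([::11;9;8;0],22);([::2;0;1;2],7);([::0;4;7;16],55);([::2;0;6;3],20);([::1;0;4;9],32);
 ([::4;8;0;15],31);([::1;2;0;3],10);([::1;2;2;0],5);([::7;4;13;0],34);([::0;7;12;18],98);([::0;
 7;6;8],56);([::3;7;6;0],27);([::0;4;1;2],17);([::4;2;5;0],22)],[::(false,Cut [::2;7;8;0] 60
 (Point 3) Nothing);(true,Cut [::2;7;8;0] 60 (Point 3) o);(false,Cut [::7;0;6;5] 44 (Cut [::0;4;
 5;0] 31 o o) Nothing);(true,Cut [::7;0;6;5] 44 (Cut [::0;4;5;0] 31 o o) o);(true,Cut [::2;7;8;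
 0] 60 (Point 3) (Point 3))]);([::([::2;2;1;0],6);([::0;11;9;21],75);([::2;0;9;7],29);([::9;0;4;
 9],30);([::23;9;19;0],65);([::26;0;21;11],102);([::3;0;1;3],10);([::3;0;3;5],24);([::1;1;0;
 2],5);([::4;5;0;6],26);([::9;6;5;0],33);([::0;7;18;15],84);([::14;1;0;18],71);([::20;0;17;
 5],99);([::4;7;0;8],46)],[::(false,Cut [::0;9;7;1] 35 (Point 3) Nothing);(true,Cut [::0;9;7;1]
 35 (Point 3) o);(false,Cut [::3;3;0;5] 35 (Cut [::1;2;2;0] 9 o o) Nothing);(true,Cut [::3;3;0;
 5] 35 (Cut [::1;2;2;0] 9 o o) o);(true,Cut [::0;9;7;1] 35 (Point 3) (Point 3))]);([::([::0;0;1;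
 1],2);([::0;9;20;18],92);([::0;5;4;7],35);([::2;16;0;19],39);([::7;7;3;0],20);([::0;5;3;8],37);
 ([::0;3;4;1],12);([::7;0;2;8],32);([::0;7;15;9],72);([::4;4;0;5],24);([::3;0;3;4],23);([::2;1;
 0;4],19);([::3;0;3;1],14)],[::(false,Cut [::1;6;0;0] 13 (Point 3) Nothing);(true,Cut [::1;6;0;
 0] 13 (Point 3) o);(false,Cut [::8;0;5;8] 63 o (Cut [::1;6;3;0] 12 o Nothing));(true,Cut [::8;
 0;5;8] 63 o (Cut [::1;6;3;0] 12 o o));(true,Cut [::1;6;0;0] 13 (Point 3) (Point 3))]);
 ([::([::5;13;7;0],36);([::0;8;18;27],86);([::0;10;7;6],48);([::0;5;10;16],66);([::3;1;3;0],9);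
 ([::4;12;9;0],51);([::0;4;19;5],60);([::4;0;3;1],16);([::0;2;5;3],31);([::4;9;11;0],75);([::17;
 0;14;5],115)],[::(false,Cut [::1;0;6;8] 62 (Point 3) Nothing);(true,Cut [::1;0;6;8] 62 (Point
 3) o);(false,Cut [::7;5;4;0] 37 o (Cut [::2;9;0;3] 11 o Nothing));(true,Cut [::7;5;4;0] 37 o
 (Cut [::2;9;0;3] 11 o o));(true,Cut [::1;0;6;8] 62 (Point 3) (Point 3))]);([::([::2;11;9;
 0],26);([::12;22;23;0],101);([::1;8;15;0],42);([::0;6;14;27],106);([::2;17;0;25],50);([::8;2;9;
 0],33);([::7;3;11;0],52);([::5;7;0;8],32);([::0;4;3;1],20)],[::(false,Cut [::4;1;4;0] 27
 (Point 3) Nothing);(true,Cut [::4;1;4;0] 27 (Point 3) o);(false,Cut [::0;1;8;7] 56 (Cut [::2;1;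
 5;0] 25 o o) Nothing);(true,Cut [::0;1;8;7] 56 (Cut [::2;1;5;0] 25 o o) o);(true,Cut [::4;1;4;
 0] 27 (Point 3) (Point 3))]);([::([::0;2;2;3],16);([::1;2;1;0],6);([::5;0;5;1],14);([::1;0;5;
 8],39);([::0;2;9;4],42);([::3;0;2;6],26);([::23;9;0;11],71)],[::(false,Cut [::6;1;0;9] 48
 (Point 3) Nothing);(true,Cut [::6;1;0;9] 48 (Point 3) o);(false,Cut [::0;1;0;1] 4 o (Cut [::1;
 0;8;4] 41 o Nothing));(true,Cut [::0;1;0;1] 4 o (Cut [::1;0;8;4] 41 o o));(true,Cut [::6;1;0;
 9] 48 (Point 3) (Point 3))]);([::([::4;8;7;0],31);([::0;3;5;7],38);([::28;28;19;0],151);([::10;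
 0;11;10],74);([::8;0;24;25],187)],[::(false,Cut [::6;7;4;0] 39 (Point 3) Nothing);(true,Cut
 [::6;7;4;0] 39 (Point 3) o);(false,Cut [::0;3;2;0] 17 (Cut [::0;0;3;1] 22 o o) Nothing);
 (true,Cut [::0;3;2;0] 17 (Cut [::0;0;3;1] 22 o o) o);(true,Cut [::6;7;4;0] 39 (Point 3) (Point
 3))]);([::([::13;0;7;0],34);([::5;2;0;6],34);([::3;2;3;0],16)],[::(false,Cut [::4;0;3;1] 25
 (Point 3) Nothing);(true,Cut [::4;0;3;1] 25 (Point 3) o);(false,Cut [::4;0;1;6] 39 (Cut [::4;0;
 5;5] 37 o o) Nothing);(true,Cut [::4;0;1;6] 39 (Cut [::4;0;5;5] 37 o o) o);(true,Cut [::4;0;3;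
 1] 25 (Point 3) (Point 3))]);([::([::17;0;9;4],88)],[::(false,Cut [::0;5;5;7] 42 (Point 3)
 Nothing);(true,Cut [::0;5;5;7] 42 (Point 3) o);(false,Cut [::3;4;0;6] 34 o (Cut [::3;0;2;6] 40
 o Nothing));(true,Cut [::3;4;0;6] 34 o (Cut [::3;0;2;6] 40 o o));(true,Cut [::0;5;5;7] 42
 (Point 3) (Point 3))]);([::],[::(false,Nothing);(true,Point 2);(true,Point 3);(true,Point
 4)])].

Definition fours3 : seq (cut_data * cut_tree) :=[::(([::1;1;1;0],3),Cut [::0;1;1;1] 8 o (Cut
 [::0;1;0;0] 1 (Cut [::5;2;0;5] 40 o (Cut [::3;1;3;0] 3 o o)) o));(([::2;0;1;2],8),Cut [::0;1;4;
 5] 20 o (Cut [::0;0;0;1] 1 (Cut [::2;3;0;2] 15 (Cut [::1;4;0;2] 14 o o) o) o));(([::2;2;1;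
 0],7),Cut [::2;2;1;0] 5 o (Cut [::0;1;1;1] 8 o (Cut [::2;3;3;0] 15 (Cut [::0;3;1;2] 17 o o)
 o)));(([::0;0;1;1],3),Cut [::0;1;0;6] 15 (Cut [::4;3;3;0] 30 o (Cut [::4;2;0;3] 26 o o)) (Cut
 [::3;0;4;0] 10 o o));(([::7;0;8;22],82),Cut [::1;2;0;3] 10 (Cut [::6;4;1;0] 18 o (Cut [::5;0;1;
 2] 15 o o)) (Cut [::0;5;5;2] 34 o o));(([::6;4;3;0],23),Cut [::0;2;1;2] 17 (Cut [::0;2;1;1] 11
 (Cut [::3;0;1;3] 20 o o) o) (Cut [::4;1;3;0] 7 o o));(([::12;9;2;0],40),Cut [::0;3;1;0] 9 (Cut
 [::2;0;1;5] 18 o (Cut [::0;4;4;1] 23 o o)) (Cut [::0;6;2;3] 28 o o));(([::7;0;3;8],50),Cut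
 [::5;2;0;5] 23 o (Cut [::0;4;1;1] 13 o (Cut [::1;2;0;5] 23 o (Cut [::1;2;0;1] 12 o o))));
 (([::3;0;12;2],53),Cut [::0;3;2;3] 20 (Cut [::2;2;0;1] 12 o (Cut [::1;2;0;4] 24 (Cut [::3;4;1;
 0] 18 o o) o)) o)].

Definition tails4 : seq tail_data :=[::([::([::0;21;11;14],89);([::6;0;4;3],25);([::1;0;4;
 2],11);([::0;7;7;4],34);([::0;13;21;30],140);([::2;0;10;23],72);([::0;5;5;1],16);([::0;1;4;
 6],30);([::1;1;2;0],6);([::0;1;3;1],14);([::2;5;4;0],22);([::4;2;5;0],30);([::1;3;0;
 5],10)],[::(false,Cut [::0;2;3;6] 33 (Point 3) (Cut [::3;0;7;3] 54 o Nothing));(true,Cut [::0;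
 2;3;6] 33 (Point 3) (Cut [::3;0;7;3] 54 o o));(false,Cut [::7;0;3;8] 33 o (Cut [::0;8;3;1] 28
 (Cut [::0;3;2;3] 20 o o) o));(true,Cut [::7;0;3;8] 33 o (Cut [::0;8;3;1] 28 (Cut [::0;3;2;3]
 20 o o) o));(true,Cut [::0;2;3;6] 33 (Point 3) (Point 3))]);([::([::6;0;1;5],17);([::0;2;0;
 3],7);([::6;0;10;7],45);([::0;1;1;3],11);([::2;2;0;3],13);([::2;0;1;4],19);([::0;1;3;5],25);
 ([::0;5;10;6],46);([::3;0;23;19],147);([::9;4;0;7],44);([::12;10;0;7],60)],[::(false,Cut [::0;
 3;3;5] 42 (Point 3) (Cut [::3;3;7;0] 7 o Nothing));(true,Cut [::0;3;3;5] 42 (Point 3) (Cut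
 [::3;3;7;0] 7 o o));(false,Cut [::0;7;3;6] 49 (Cut [::4;2;5;0] 16 o o) (Cut [::3;2;1;0] 3 o
 o));(true,Cut [::0;7;3;6] 49 (Cut [::4;2;5;0] 16 o o) (Cut [::3;2;1;0] 3 o o));(true,Cut [::0;
 3;3;5] 42 (Point 3) (Point 3))]);([::([::0;0;1;3],8);([::1;4;0;8],17);([::5;2;0;5],20);([::13;
 0;6;23],110);([::6;3;0;10],50);([::0;4;6;15],76);([::0;3;3;2],16);([::0;12;2;11],73);([::0;6;9;
 22],156)],[::(false,Cut [::5;7;0;7] 61 (Point 3) (Cut [::0;6;1;8] 72 o Nothing));(true,Cut
 [::5;7;0;7] 61 (Point 3) (Cut [::0;6;1;8] 72 o o));(false,Cut [::4;3;6;0] 7 o (Cut [::6;7;0;2]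
 23 (Cut [::5;8;0;8] 61 o o) o));(true,Cut [::4;3;6;0] 7 o (Cut [::6;7;0;2] 23 (Cut [::5;8;0;8]
 61 o o) o));(true,Cut [::5;7;0;7] 61 (Point 3) (Point 3))]);([::([::7;3;0;4],22);([::0;1;5;
 10],41);([::3;1;0;5],23);([::0;4;2;5],28);([::4;6;0;13],75);([::0;8;6;5],41);([::5;3;0;
 5],38)],[::(false,Cut [::7;0;5;1] 20 (Point 3) (Cut [::0;8;6;9] 68 o Nothing));(true,Cut [::7;
 0;5;1] 20 (Point 3) (Cut [::0;8;6;9] 68 o o));(false,Cut [::1;1;2;0] 2 o (Cut [::0;1;2;3] 24
 (Cut [::0;1;6;7] 49 o o) o));(true,Cut [::1;1;2;0] 2 o (Cut [::0;1;2;3] 24 (Cut [::0;1;6;7] 49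
 o o) o));(true,Cut [::7;0;5;1] 20 (Point 3) (Point 3))]);([::([::0;6;11;7],61);([::5;2;0;
 3],16);([::22;1;0;16],82);([::0;9;23;24],183);([::2;1;0;3],19)],[::(false,Cut [::1;4;0;5] 40
 (Point 3) (Cut [::6;4;0;1] 14 o Nothing));(true,Cut [::1;4;0;5] 40 (Point 3) (Cut [::6;4;0;1]
 14 o o));(false,Cut [::1;1;2;0] 4 (Cut [::4;2;0;3] 27 o o) (Cut [::0;5;3;4] 35 o o));(true,Cut
 [::1;1;2;0] 4 (Cut [::4;2;0;3] 27 o o) (Cut [::0;5;3;4] 35 o o));(true,Cut [::1;4;0;5] 40
 (Point 3) (Point 3))]);([::([::0;4;3;5],35);([::0;0;2;3],20);([::1;5;0;9],56)],[::(false,Cut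
 [::3;1;0;4] 34 (Point 3) (Cut [::2;0;5;4] 39 o Nothing));(true,Cut [::3;1;0;4] 34 (Point 3)
 (Cut [::2;0;5;4] 39 o o));(false,Cut [::1;0;5;2] 24 (Cut [::5;2;3;0] 5 o (Cut [::0;8;2;5] 42 o
 o)) o);(true,Cut [::1;0;5;2] 24 (Cut [::5;2;3;0] 5 o (Cut [::0;8;2;5] 42 o o)) o);(true,Cut
 [::3;1;0;4] 34 (Point 3) (Point 3))]);([::([::0;2;3;4],29)],[::(false,Cut [::4;0;8;3] 49
 (Point 3) (Cut [::0;2;1;4] 24 o Nothing));(true,Cut [::4;0;8;3] 49 (Point 3) (Cut [::0;2;1;4]
 24 o o));(false,Cut [::2;3;8;0] 34 (Cut [::8;4;0;9] 54 o o) (Cut [::6;7;2;0] 16 o o));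
 (true,Cut [::2;3;8;0] 34 (Cut [::8;4;0;9] 54 o o) (Cut [::6;7;2;0] 16 o o));(true,Cut [::4;0;8;
 3] 49 (Point 3) (Point 3))]);([::],[::(false,Cut [::1;0;7;3] 46 o Nothing);(true,Cut [::1;0;7;
 3] 46 o o);(true,Point 3);(true,Point 4)])].

Definition fours4 : seq (cut_data * cut_tree) :=[::(([::4;0;2;3],17),Cut [::3;6;0;1] 27 (Cut
 [::0;2;1;0] 12 (Cut [::2;0;0;5] 5 o o) o) (Cut [::4;2;1;0] 18 o o));(([::2;0;4;3],20),Cut [::0;
 1;1;3] 12 (Cut [::4;0;3;4] 26 (Cut [::1;2;0;1] 13 (Cut [::1;1;0;2] 9 o o) o) o) o);(([::2;1;0;
 3],9),Cut [::1;1;0;3] 4 (Cut [::3;2;4;0] 35 o o) (Cut [::3;0;4;0] 26 o (Cut [::1;5;0;2] 8 o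
 o)));(([::0;0;2;1],7),Cut [::0;4;2;3] 17 o (Cut [::5;2;0;4] 32 o (Cut [::0;3;1;1] 8 o (Cut
 [::0;5;2;4] 29 o o))));(([::0;3;1;6],27),Cut [::5;0;6;1] 36 (Cut [::0;3;5;2] 27 o o) (Cut [::0;
 1;5;3] 34 (Cut [::1;0;0;2] 7 o o) o));(([::16;3;26;0],78),Cut [::0;1;1;3] 22 (Cut [::0;2;1;1]
 10 o o) (Cut [::1;3;0;3] 24 o (Cut [::0;2;6;3] 29 o o)));(([::2;0;5;7],56),Cut [::1;5;1;0] 10
 (Cut [::1;0;0;1] 5 o (Cut [::6;1;4;0] 24 o o)) (Cut [::0;0;2;5] 25 o o))].

Definition tails5 : seq tail_data :=[::([::([::4;0;7;4],36);([::9;0;8;1],26);([::5;0;10;1],32);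
 ([::9;0;11;5],63);([::5;0;9;2],43);([::1;3;10;0],41);([::5;4;7;0],42);([::3;5;9;0],57);([::16;
 0;9;14],77);([::1;1;0;2],4)],[::(false,Cut [::1;1;0;0] 3 (Point 3) Nothing);(true,Cut [::1;1;0;
 0] 3 (Point 3) o);(false,Cut [::0;4;5;1] 35 o (Cut [::1;6;0;3] 13 o Nothing));(true,Cut [::0;4;
 5;1] 35 o (Cut [::1;6;0;3] 13 o o));(true,Cut [::1;1;0;0] 3 (Point 3) (Point 3))]);([::([::3;1;
 2;0],9);([::13;0;16;10],97);([::2;0;1;2],9);([::1;2;0;3],7);([::0;1;4;2],17);([::1;15;20;
 0],81);([::6;2;11;0],58);([::4;5;0;2],14)],[::(false,Cut [::2;0;1;4] 19 (Point 3) Nothing);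
 (true,Cut [::2;0;1;4] 19 (Point 3) o);(false,Cut [::3;0;2;2] 17 o (Cut [::8;7;1;0] 34 o
 Nothing));(true,Cut [::3;0;2;2] 17 o (Cut [::8;7;1;0] 34 o o));(true,Cut [::2;0;1;4] 19 (Point
 3) (Point 3))]);([::([::0;0;9;2],28);([::0;2;2;1],12);([::1;0;2;3],14);([::0;21;28;10],184);
 ([::3;8;9;0],63);([::6;0;5;8],46)],[::(false,Cut [::0;0;5;7] 52 (Point 3) Nothing);(true,Cut
 [::0;0;5;7] 52 (Point 3) o);(false,Cut [::0;5;6;3] 54 (Cut [::6;0;5;5] 46 o o) Nothing);
 (true,Cut [::0;5;6;3] 54 (Cut [::6;0;5;5] 46 o o) o);(true,Cut [::0;0;5;7] 52 (Point 3) (Point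
 3))]);([::([::3;4;7;0],31);([::1;4;3;0],20);([::0;10;7;11],69);([::2;15;2;
 0],42)],[::(false,Cut [::0;1;3;6] 27 (Point 3) Nothing);(true,Cut [::0;1;3;6] 27 (Point 3) o);
 (false,Cut [::0;0;2;1] 13 (Cut [::0;1;4;6] 28 o o) Nothing);(true,Cut [::0;0;2;1] 13 (Cut [::0;
 1;4;6] 28 o o) o);(true,Cut [::0;1;3;6] 27 (Point 3) (Point 3))]);([::([::11;2;8;0],61);([::4;
 3;1;0],14)],[::(false,Cut [::5;5;1;0] 29 (Point 3) Nothing);(true,Cut [::5;5;1;0] 29 (Point 3)
 o);(false,Cut [::7;6;0;1] 26 (Cut [::0;7;2;4] 26 o o) Nothing);(true,Cut [::7;6;0;1] 26 (Cut
 [::0;7;2;4] 26 o o) o);(true,Cut [::5;5;1;0] 29 (Point 3) (Point 3))]);([::],[::(false,Cut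
 [::7;0;8;6] 63 (Point 3) Nothing);(true,Cut [::7;0;8;6] 63 (Point 3) o);(false,Cut [::6;2;0;1]
 13 (Cut [::1;0;8;4] 52 o o) Nothing);(true,Cut [::6;2;0;1] 13 (Cut [::1;0;8;4] 52 o o) o);
 (true,Cut [::7;0;8;6] 63 (Point 3) (Point 3));(true,Point 4)])].

Definition fours5 : seq (cut_data * cut_tree) :=[::(([::5;0;7;2],29),Cut [::0;0;1;3] 19 (Cut
 [::2;0;0;1] 8 o o) (Cut [::6;0;5;1] 14 o (Cut [::5;0;4;1] 16 o o)));(([::4;0;4;1],21),Cut [::5;
 0;0;3] 20 (Cut [::0;1;2;4] 20 o (Cut [::0;3;2;1] 16 o o)) (Cut [::0;5;2;6] 44 o o));(([::6;2;3;
 0],23),Cut [::1;3;0;0] 5 (Cut [::1;0;0;3] 10 o (Cut [::4;5;0;6] 30 o (Cut [::4;4;0;1] 12 o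
 o))) o);(([::1;7;8;0],48),Cut [::2;1;0;1] 9 (Cut [::1;1;0;3] 11 o o) (Cut [::1;2;2;0] 9 (Cut
 [::4;6;0;3] 30 o o) o));(([::0;11;5;3],56),Cut [::5;2;0;5] 12 (Cut [::0;2;1;0] 9 o o) (Cut
 [::6;0;4;3] 35 o (Cut [::4;3;1;0] 14 o o)))].

Definition tails6 : seq tail_data :=[::([::([::3;0;5;2],21);([::0;9;5;9],56);([::5;0;5;4],33);
 ([::0;3;11;9],73);([::0;6;2;5],33);([::4;2;5;0],16)],[::(false,Cut [::0;1;1;2] 14 (Point 3)
 (Cut [::2;5;7;0] 31 o Nothing));(true,Cut [::0;1;1;2] 14 (Point 3) (Cut [::2;5;7;0] 31 o o));
 (false,Cut [::6;5;6;0] 30 (Cut [::3;1;7;0] 24 o o) (Cut [::5;0;6;4] 41 o o));(true,Cut [::6;5;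
 6;0] 30 (Cut [::3;1;7;0] 24 o o) (Cut [::5;0;6;4] 41 o o));(true,Cut [::0;1;1;2] 14 (Point 3)
 (Point 3))]);([::([::6;5;0;9],50);([::0;3;6;5],36);([::7;18;0;20],130);([::0;1;6;
 11],78)],[::(false,Cut [::3;1;0;5] 41 (Point 3) (Cut [::1;6;0;7] 63 o Nothing));(true,Cut [::3;
 1;0;5] 41 (Point 3) (Cut [::1;6;0;7] 63 o o));(false,Cut [::5;7;4;0] 15 (Cut [::2;0;7;1] 18
 (Cut [::5;5;0;2] 21 o o) o) o);(true,Cut [::5;7;4;0] 15 (Cut [::2;0;7;1] 18 (Cut [::5;5;0;2]
 21 o o) o) o);(true,Cut [::3;1;0;5] 41 (Point 3) (Point 3))]);([::([::9;22;0;22],155);([::9;0;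
 26;13],118)],[::(false,Cut [::0;3;4;5] 44 (Point 3) (Cut [::2;0;5;2] 23 o Nothing));(true,Cut
 [::0;3;4;5] 44 (Point 3) (Cut [::2;0;5;2] 23 o o));(false,Cut [::0;4;7;5] 42 o (Cut [::0;1;2;
 7] 52 o (Cut [::1;0;4;0] 4 o o)));(true,Cut [::0;4;7;5] 42 o (Cut [::0;1;2;7] 52 o (Cut [::1;0;
 4;0] 4 o o)));(true,Cut [::0;3;4;5] 44 (Point 3) (Point 3))]);([::],[::(false,Cut [::7;0;8;1]
 22 (Point 3) (Cut [::1;0;0;1] 8 o Nothing));(true,Cut [::7;0;8;1] 22 (Point 3) (Cut [::1;0;0;
 1] 8 o o));(false,Cut [::3;5;0;4] 33 o (Cut [::8;7;7;0] 14 o (Cut [::1;0;7;5] 42 o o)));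
 (true,Cut [::3;5;0;4] 33 o (Cut [::8;7;7;0] 14 o (Cut [::1;0;7;5] 42 o o)));(true,Cut [::7;0;8;
 1] 22 (Point 3) (Point 3));(true,Point 4)])].

Definition fours6 : seq (cut_data * cut_tree) :=[::(([::0;2;0;7],25),Cut [::1;2;5;0] 28 (Cut
 [::2;1;0;1] 7 o o) (Cut [::1;0;0;4] 5 o (Cut [::1;5;0;1] 8 o o)));(([::17;13;0;18],124),Cut
 [::1;3;3;0] 12 o (Cut [::0;0;1;2] 13 (Cut [::3;2;0;3] 16 o (Cut [::0;3;5;4] 37 o o)) o));
 (([::0;2;1;4],28),Cut [::3;0;2;4] 30 (Cut [::3;0;3;2] 19 o o) (Cut [::3;2;4;0] 12 o (Cut [::5;
 1;0;4] 35 o o)))].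

Definition alts7 : seq (bool * cut_tree) :=[::(false,Cut [::9;2;11;0] 44 o (Cut [::4;0;3;10] 52
 (Point 4) (Cut [::4;4;0;1] 8 o (Cut [::0;2;1;2] 11 o (Cut [::1;4;0;5] 26 o o)))));(false,Cut
 [::1;0;2;0] 7 (Point 3) (Cut [::4;0;1;4] 12 o (Cut [::5;5;2;0] 13 o (Point 4))));(false,Cut
 [::3;0;4;0] 16 (Point 3) (Cut [::0;2;2;11] 38 (Point 3) (Cut [::0;3;3;5] 33 (Point 3) (Point
 3))));(false,Cut [::1;0;0;2] 6 (Point 3) (Cut [::4;0;5;0] 21 (Point 3) (Cut [::0;4;5;1] 20 o
 (Cut [::0;3;2;2] 17 o (Point 3)))));(false,Cut [::1;0;11;0] 34 (Point 3) (Cut [::5;8;0;7] 28 o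
 (Cut [::0;6;7;4] 44 o (Cut [::0;8;9;1] 55 (Point 3) (Cut [::7;0;7;8] 50 o (Cut [::1;9;1;0] 22
 o o))))));(false,Cut [::1;3;0;1] 5 o (Cut [::0;0;0;1] 1 o (Cut [::4;1;0;5] 16 o (Cut [::3;1;6;
 0] 23 (Point 3) (Cut [::3;2;0;3] 15 o (Cut [::6;0;5;6] 45 o (Cut [::6;0;5;2] 35 o o)))))));
 (false,Cut [::0;4;0;9] 25 o (Cut [::6;7;0;10] 37 o (Cut [::11;0;11;2] 54 o (Cut [::7;0;3;4] 30
 o (Cut [::1;3;7;0] 16 o (Cut [::2;5;6;0] 23 o (Cut [::5;5;0;8] 37 o (Cut [::0;2;9;7] 55 o (Cut
 [::0;4;3;3] 27 o o)))))))));(true,Cut [::0;1;2;0] 2 o (Cut [::7;0;1;10] 44 (Point 4) (Cut [::5;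
 5;0;3] 17 o (Point 4))));(true,Cut [::3;0;2;6] 33 (Point 4) (Cut [::0;3;3;1] 13 (Point 3)
 (Point 4)));(true,Cut [::2;1;4;0] 16 (Point 4) (Cut [::0;1;0;2] 7 (Point 4) (Point 4)));
 (true,Cut [::5;0;6;6] 30 o (Cut [::3;1;2;0] 13 (Point 4) (Cut [::0;4;2;3] 18 o (Cut [::0;5;4;
 6] 39 o (Cut [::2;5;3;0] 22 o (Cut [::4;0;3;4] 24 o o))))));(true,Cut [::7;2;5;0] 32 (Point 4)
 (Cut [::5;9;7;0] 36 o (Cut [::3;2;2;0] 16 (Point 3) (Cut [::1;3;1;0] 14 o o))));(true,Cut [::2;
 0;0;3] 5 o (Cut [::2;1;7;0] 24 (Point 3) (Cut [::0;5;4;1] 31 (Point 4) (Point 3))));(true,Cut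
 [::1;0;1;3] 16 (Point 4) (Cut [::5;0;6;3] 40 (Point 3) (Cut [::3;0;5;3] 36 (Point 3) (Point
 3))));(true,Cut [::1;0;0;3] 8 (Point 3) (Cut [::6;0;4;5] 40 (Point 3) (Cut [::5;0;0;3] 17
 (Point 3) (Cut [::5;0;12;1] 47 (Point 3) (Point 3)))));(true,Cut [::1;0;3;0] 10 (Point 3) (Cut
 [::1;2;3;0] 15 (Point 3) (Cut [::0;6;1;4] 21 o (Cut [::1;5;0;0] 11 (Point 3) (Point 3)))));
 (true,Cut [::3;0;7;0] 24 (Point 3) (Cut [::1;0;0;2] 3 o (Cut [::8;8;7;0] 36 o (Cut [::5;0;3;2]
 24 (Point 3) (Cut [::4;8;0;7] 28 o (Point 3))))));(true,Cut [::0;1;1;0] 1 o (Cut [::2;0;1;5]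
 17 (Point 3) (Cut [::5;0;3;6] 36 o (Cut [::0;5;3;3] 21 o (Cut [::9;0;2;7] 40 o (Cut [::1;3;4;
 0] 17 (Point 3) (Cut [::7;6;0;4] 26 o o)))))));(true,Cut [::0;8;5;9] 51 o (Cut [::4;0;1;2] 8 o
 (Cut [::5;0;3;4] 26 o (Cut [::1;5;10;0] 30 o (Cut [::4;9;0;6] 24 o (Cut [::3;5;0;2] 12 o (Cut
 [::6;0;1;8] 34 o (Cut [::7;2;0;10] 56 (Point 3) o))))))));(true,Cut [::6;5;0;3] 12 o (Cut [::5;
 1;4;0] 17 o (Cut [::0;0;1;5] 11 o (Cut [::1;3;5;0] 12 o (Cut [::6;0;4;3] 28 o (Cut [::0;6;2;3]
 20 o (Cut [::4;3;0;2] 10 o (Cut [::0;3;2;4] 23 o (Cut [::1;3;1;0] 7 o (Cut [::3;2;0;0] 5 o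
 o))))))))))].

(** The analogue for eight 5-points, which leave 6 exponents. *)
Definition alts8 : seq (bool * cut_tree) :=[::(false,Nothing);(true,Cut [::0;6;1;5] 27 o (Point
 4));(true,Cut [::0;3;2;6] 27 (Point 3) (Point 3));(true,Cut [::0;1;1;1] 6 o (Cut [::5;0;6;3]
 32 (Point 3) o));(true,Cut [::0;2;0;1] 6 o (Cut [::5;3;3;0] 28 o o))].

(** Eight 5-points, a 4-point and a 3-point impose independent conditions in degree 13. From there
    [independent_of_H1] recovers independence in degree 10 in the exceptional cases where h^1 must
    be shown nonzero. *)
Definition interpolation_tree : cut_tree :=Cut [::0;1;1;1] 4 (Point 5) (Cut [::0;2;2;1] 9
 (Point 5) (Cut [::0;4;6;3] 29 (Point 5) (Cut [::1;1;0;1] 4 (Point 5) (Cut [::1;0;1;1] 4 (Point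
 5) (Cut [::2;0;2;1] 9 (Point 5) (Cut [::2;2;0;1] 9 (Point 5) (Cut [::6;0;4;3] 29 (Point 5)
 (Cut [::1;1;1;0] 3 (Point 4) (Cut [::0;1;5;3] 15 (Point 3) Nothing))))))))).

Definition tails (w : nat) : seq tail_data :=
  nth [::] [:: tails0; tails1; tails2; tails3; tails4; tails5; tails6] w.
Definition fours (w : nat) : seq (cut_data * cut_tree) :=
  nth [::] [:: fours0; fours1; fours2; fours3; fours4; fours5; fours6] w.

(** There are 286 monomials of degree 10; a 5-point uses 35 of them, a cell for a 4-point 20. *)
Definition left_over (w k : nat) : nat := (286 - 35 * w - 20 * k)%N.

(** Of the [n] exponents, [Y] blocks of ten are meant for 3-points and [r] are left. The tail cuts
    off all blocks but the last; that block and the remainder are filled by a 3-point and 2-points,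
    by 2-points alone, by one 3-point more than fits, or by a 4-point. Numbers of 2-points are
    rounded down for independence and up for injectivity. *)
Definition required_alts (n : nat) : seq (bool * seq nat) :=
  let Y := (n %/ 10)%N in let r := (n %% 10)%N in
  let tr := (if Y is 0 then [::] else [:: 3])%N in
  let lo := (r %/ 4)%N in let hi := ((r + 3) %/ 4)%N in
  [:: (false, tr ++ nseq lo 2%N); (true, tr ++ nseq hi 2%N); (true, 3%N :: tr)] ++
  (if Y is 0 then [::] else
    [:: (false, nseq ((10 + r) %/ 4)%N 2%N); (true, nseq ((13 + r) %/ 4)%N 2%N)]) ++
  (if (Y <= 1)%N then [:: (true, [:: 4%N])] else [::]).

Definition stage_check (w k : nat) : bool :=
  let t := nth ([::], [::]) (tails w) k in let n := left_over w k in
  [&& size t.1 == (n %/ 10).-1, (k < size (tails w))%N &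
      all (fun bm => bm \in alt_mults t.2) (required_alts n)].

Definition certificate_check : bool :=
  all (fun w => all (stage_check w) (iota 0 (left_over w 0 %/ 20).+1) &&
    fives_check (take w fives) (family_check (tails w) (fours w)) (simplex 10)) (iota 0 7).

Lemma certificate_checkP : certificate_check.
Proof. by vm_compute. Qed.

Lemma certificate7 : fives_check (take 7 fives) (tail_check [::] alts7) (simplex 10).
Proof. by vm_compute. Qed.

Lemma certificate8 : fives_check (take 8 fives) (tail_check [::] alts8) (simplex 10).
Proof. by vm_compute. Qed.

Lemma interpolation_check : (tree_check interpolation_tree (simplex 13)).2.
Proof. by vm_compute. Qed.

Lemma simplexP d s :
  reflect (exists i j k l, s = [:: i; j; k; l] /\ (i + j + k + l = d)%N) (s \in simplex d).
Proof.
apply: (iffP mapP) => [[_ /low_exponentsP[i [j [k [-> lt]]]] ->]|[i [j [k [l [-> E]]]]]].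
  by exists (d - (i + (j + k)))%N, i, j, k; split=> /=; [congr (_ :: _) |]; lia.
exists [:: 0; j; k; l]%N; first by apply/low_exponentsP; exists j, k, l; split=> //; lia.
by congr (_ :: _); rewrite /=; lia.
Qed.

Lemma simplex_uniq d : uniq (simplex d).
Proof.
rewrite map_inj_in_uniq ?low_exponents_uniq // => _ _ /low_exponentsP[i [j [k [-> _]]]]
  /low_exponentsP[i' [j' [k' [-> _]]]].
by move=> /= [_ -> -> ->].
Qed.

(** * Reduction of all multiplicities to the certified ones *)

Section Generic.

Variable K : fieldType.
Hypothesis charK : [pchar K] =i pred0.

(** Adding conditions cannot create new solutions. *)
Lemma realizable_le_true D ms ms' : (size ms <= size ms')%N ->
    (forall i, nth 0 ms i <= nth 0 ms' i)%N ->
  realizable K true D ms -> realizable K true D ms'.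
Proof.
move=> le_s le_m g; apply: realizable_exact => L uL LE.
have sL : size L = size ms' by rewrite -LE size_map.
pose L1 := zip (take (size ms) (unzip1 L)) ms.
have s1 : size (take (size ms) (unzip1 L)) = size ms.
  by rewrite size_takel // size_map sL.
have [||p p0 gp] := g L1.
- by rewrite unzip1_zip ?s1 // take_uniq.
- by rewrite unzip2_zip ?s1.
exists p => //; apply: indep_sub gp => x /torus_conditionsP[m xL xm].
have /(nthP (0, 0)%N)[i ilt] := xL.
rewrite size_zip s1 minnn in ilt; rewrite nth_zip // => -[xi mi].
apply/torus_conditionsP; exists (nth 0%N ms' i).
  apply/(nthP (0, 0)%N); exists i; first by rewrite sL; apply: leq_trans ilt le_s.
  rewrite -xi nth_take // -LE -nth_zip ?zip_unzip //.
  by rewrite !size_map.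
by apply: low_exponentsS xm; rewrite -mi.
Qed.

(** A subset of independent conditions is independent. *)
Lemma realizable_le_false D ms ms' : (size ms <= size ms')%N ->
    (forall i, nth 0 ms i <= nth 0 ms' i)%N ->
  realizable K false D ms' -> realizable K false D ms.
Proof.
move=> le_s le_m g; apply: realizable_exact => L uL LE.
have sL : size L = size ms by rewrite -LE size_map.
(* Labels from [N] on do not occur in [L]; they serve the additional points of [ms']. *)
pose N := (\max_(l <- unzip1 L) l).+1.
pose ls := unzip1 L ++ iota N (size ms' - size ms).
have sls : size ls = size ms' by rewrite size_cat size_iota size_map sL; lia.
have uls : uniq ls.
  rewrite cat_uniq uL iota_uniq andbT; apply/hasP => -[l]; rewrite mem_iota => /andP[Nl _].
  move=> /= lL; have : (l <= \max_(l <- unzip1 L) l)%N by apply: (leq_bigmax_seq (F := fun l :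
    nat => l)).
  by rewrite leqNgt Nl.
have [||p p0 gp] := g (zip ls ms').
- by rewrite unzip1_zip ?sls.
- by rewrite unzip2_zip ?sls.
exists p => //; apply: indep_subr gp; rewrite ?torus_conditions_uniq ?unzip1_zip ?sls //.
move=> x /torus_conditionsP[m xL xm].
have /(nthP (0, 0)%N)[i ilt xi] := xL.
have ilt' : (i < size ms')%N by apply: leq_trans le_s; rewrite -sL.
apply/torus_conditionsP; exists (nth 0%N ms' i).
  apply/(nthP (0, 0)%N); exists i; first by rewrite size_zip sls minnn.
  rewrite nth_zip // nth_cat size_map ilt (nth_map (0, 0)%N) // xi //.
apply: low_exponentsS xm; have -> : m = nth 0%N ms i by rewrite -LE (nth_map (0, 0)%N) // xi.
exact: le_m.
Qed.

(** Comparison entry by entry of two nonincreasing lists of multiplicities, stated through the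
    numbers of points of multiplicity at least 5, 4, 3 and 2. *)
Definition dominates (w x y z w' x' y' z' : nat) :=
  [&& w <= w', w + x <= w' + x', w + x + y <= w' + x' + y' &
      w + x + y + z <= w' + x' + y' + z']%N.

Lemma nth_multiplicities w x y z i : nth 0%N (multiplicities w x y z) i =
  (2 * (i < w + x + y + z) + (i < w + x + y) + (i < w + x) + (i < w))%N.
Proof.
rewrite /multiplicities !nth_cat !size_nseq !nth_nseq.
case: (ltnP i w) => h1; first by lia.
case: (ltnP (i - w) x) => h2; first by lia.
case: (ltnP (i - w - x) y) => h3; first by lia.
by case: (ltnP (i - w - x - y) z) => h4; lia.
Qed.

Lemma dominatesP w x y z w' x' y' z' : dominates w x y z w' x' y' z' ->
  (size (multiplicities w x y z) <= size (multiplicities w' x' y' z'))%N /\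
  (forall i, nth 0 (multiplicities w x y z) i <= nth 0 (multiplicities w' x' y' z') i)%N.
Proof.
move=> /and4P[h1 h2 h3 h4]; split; last first.
  by move=> i; rewrite !nth_multiplicities; lia.
by rewrite /multiplicities !size_cat !size_nseq; lia.
Qed.

Definition realizable10 (b : bool) w x y z := realizable K b (simplex 10) (multiplicities w x y
  z).

Lemma realizable10_true w x y z w' x' y' z' : realizable10 true w x y z -> dominates w x y z w'
    x' y' z' ->
  realizable10 true w' x' y' z'.
Proof. by move=> g /dominatesP[h1 h2]; apply: realizable_le_true g. Qed.

Lemma realizable10_false w x y z w' x' y' z' : realizable10 false w' x' y' z' -> dominates w x y
    z w' x' y' z' ->
  realizable10 false w x y z.
Proof. by move=> g /dominatesP[h1 h2]; apply: realizable_le_false g. Qed.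

Lemma count_multiplicities a w x y z :
  count a (multiplicities w x y z) = (a 5 * w + a 4 * x + a 3 * y + a 2 * z)%N.
Proof. by rewrite /multiplicities !count_cat !count_nseq !addnA. Qed.

Lemma realizable10_exact b ms w x y z : realizable K b (simplex 10) ms ->
    (forall a : pred nat, count a ms = (a 5 * w + a 4 * x + a 3 * y + a 2 * z)%N) ->
  realizable10 b w x y z.
Proof.
move=> g cE; apply: realizable_perm g; apply/permP => a.
by rewrite cE count_multiplicities.
Qed.

Lemma stage_realizable w k x b ms : (w <= 6)%N -> (20 * k <= left_over w 0)%N ->
    (x <= k)%N -> (b, ms) \in required_alts (left_over w k) ->
  realizable K b (simplex 10) (nseq w 5 ++ nseq x 4 ++ nseq (5 * (k - x)) 2 ++
    nseq (left_over w k %/ 10).-1 3 ++ ms)%N.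
Proof.
move=> w6 kle xk bms.
have wI : w \in iota 0 7 by rewrite mem_iota.
have kI : k \in iota 0 (left_over w 0 %/ 20).+1.
  by rewrite mem_iota /= ltnS leq_divRL // mulnC.
have /andP[/allP/(_ k kI) st chk] :
  all (stage_check w) (iota 0 (left_over w 0 %/ 20).+1) &&
  fives_check (take w fives) (family_check (tails w) (fours w)) (simplex 10) :=
  allP certificate_checkP w wI.
move: st; rewrite /stage_check => /and3P[/eqP sz klt /allP/(_ _ bms) alt].
have sz5 : size (take w fives) = w by rewrite size_takel // (leq_trans w6).
rewrite -[w in nseq w 5]sz5.
apply: fives_checkP chk; rewrite ?simplex_uniq // => D' uD' fam.
by rewrite -sz; apply: family_checkP fam klt xk alt.
Qed.

End Generic.

Section Main.

Variable K : fieldType.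
Hypothesis charK : [pchar K] =i pred0.
Local Notation realizable10 := (realizable10 K).

(** The alternatives of [required_alts] read as numbers of points. They are the extremal
    configurations to which domination reduces all tuples with at most six 5-points. *)
Lemma stage_facts w k x (n := left_over w k) (Y := (n %/ 10)%N) (r := (n %% 10)%N) :
    (w <= 6)%N -> (20 * k <= left_over w 0)%N -> (x <= k)%N ->
  [/\ realizable10 false w x Y (5 * (k - x) + r %/ 4)%N,
      realizable10 true w x Y (5 * (k - x) + (r + 3) %/ 4)%N,
      realizable10 true w x Y.+1 (5 * (k - x))%N,
      (0 < Y)%N -> realizable10 false w x Y.-1 (5 * (k - x) + (10 + r) %/ 4)%N /\
                   realizable10 true w x Y.-1 (5 * (k - x) + (13 + r) %/ 4)%N &
      (Y <= 1)%N -> realizable10 true w x.+1 0 (5 * (k - x))%N].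
Proof.
move=> w6 kle xk; have st b ms := @stage_realizable K charK w k x b ms w6 kle xk.
(* Here [u], [v], [t] count the 4-, 3- and 2-points outside the cells of twenty; [v] includes the
   3-points cut off by the tail. *)
have {st} st b ms u v t : (b, ms) \in required_alts n ->
    (forall a : pred nat, count a ms + a 3 * Y.-1 = a 4 * u + a 3 * v + a 2 * t)%N ->
    realizable10 b w (x + u) v (5 * (k - x) + t).
  move=> bms cE; apply: (realizable10_exact (st _ _ bms)) => a.
  rewrite !count_cat !count_nseq !mulnDr; have := cE a.
  rewrite -/Y; lia.
have cY (a : pred nat) : (a 3 + a 3 * Y.-1 = a 3 * Y + a 3 * (Y == 0))%N.
  by case: (a 3) => //; case: (Y) => *; lia.
split.
- rewrite -{1}[x]addn0; apply: (st _ ((if Y is 0 then [::] else [:: 3])%N ++ nseq (r %/ 4) 2%N))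
  => [|a].
    by rewrite /required_alts -/n -/Y -/r !inE eqxx.
  by rewrite count_cat count_nseq; case: (Y) => [|y] /=; case: (a 3); lia.
- rewrite -{1}[x]addn0; apply: (st _ ((if Y is 0 then [::] else [:: 3])%N ++ nseq ((r + 3) %/ 4)
  2%N)) => [|a].
    by rewrite /required_alts -/n -/Y -/r !inE eqxx ?orbT.
  by rewrite count_cat count_nseq; case: (Y) => [|y] /=; case: (a 3); lia.
- rewrite -{1}[x]addn0 -[(5 * _)%N]addn0; apply: (st _ (3%N :: (if Y is 0 then [::] else [::
  3])%N)) => [|a].
    by rewrite /required_alts -/n -/Y -/r !inE eqxx ?orbT.
  by case: (Y) => [|y] /=; case: (a 3); lia.
- move=> Y0; split; rewrite -{1}[x]addn0.
    apply: (st _ (nseq ((10 + r) %/ 4) 2%N)) => [|a]; last by rewrite count_nseq; lia.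
    by rewrite /required_alts -/n -/Y -/r; case: (Y) Y0 => // y _; rewrite !inE eqxx ?orbT.
  apply: (st _ (nseq ((13 + r) %/ 4) 2%N)) => [|a]; last by rewrite count_nseq; lia.
  by rewrite /required_alts -/n -/Y -/r; case: (Y) Y0 => // y _; rewrite !inE eqxx ?orbT.
move=> Y1; rewrite -addn1 -[(5 * _)%N]addn0; apply: (st _ [:: 4%N]) => [|a].
  by rewrite /required_alts -/n -/Y -/r Y1 !mem_cat mem_head !orbT.
by case: (Y) Y1 => [|[]] //= _; case: (a 4); case: (a 3); lia.
Qed.

(** Write 286 - 35w = 10q + r; the remainder r is 6 or 1. If the 4- and 3-points fit into 10q, the
    free tens are paired into cells of twenty, each filled exactly by five 2-points, so rounding
    occurs only in a last piece of size r or 10 + r. If they do not fit, a 3-point or a 4-point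
    beyond a full chain already gives injectivity. *)
Lemma realizable10_le6 b w x y z : (w <= 6)%N ->
    (if b then 286 <= 35 * w + 20 * x + 10 * y + 4 * z
     else 35 * w + 20 * x + 10 * y + 4 * z <= 286)%N ->
  realizable10 b w x y z.
Proof.
move=> w6 deg; pose R := left_over w 0; pose r := (R %% 10)%N.
have RE : (R = 286 - 35 * w)%N by rewrite /R /left_over muln0 subn0.
have rE : (r = 6 \/ r = 1)%N.
  rewrite /r RE; clear -w6.
  by do 7 (case: w w6 => [|w] w6; first by [left | right]).
have lE k : left_over w k = (R - 20 * k)%N by rewrite /left_over -RE.
have dR : (R = 10 * (R %/ 10) + r)%N by rewrite mulnC; exact: divn_eq.
case: (leqP (20 * x + 10 * y) (R - r)) => hle; last first.
  (* Both sides of [hle] are multiples of ten and r < 10, so the length exceeds 286 and independence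
     is not asked for. *)
  case: b deg => deg; last by move: rE; lia.
  case: (leqP (20 * x) (R - r)) => hx.
    have kle : (20 * x <= left_over w 0)%N by rewrite -/R; lia.
    have [_ _ g _ _] := stage_facts w6 kle (leqnn x).
    by rewrite lE in g; apply: (realizable10_true g); rewrite /dominates; move: rE; lia.
  have kle : (20 * (R %/ 20) <= left_over w 0)%N by rewrite -/R; lia.
  have [_ _ _ _ g] := stage_facts w6 kle (leqnn _).
  rewrite lE in g.
  by apply: (realizable10_true (g _)); rewrite /dominates; move: rE; lia.
(* [s] blocks of ten are left for 2-points; when [s] is odd, the unpaired block joins the remainder
   [r]. *)
pose s := (R %/ 10 - 2 * x - y)%N.
pose k := (x + s %/ 2)%N.
have kle : (20 * k <= left_over w 0)%N by rewrite /k /s -/R; lia.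
have xk : (x <= k)%N by rewrite /k leq_addr.
have [g1 g2 _ g3 _] := stage_facts w6 kle xk.
rewrite lE in g1 g2 g3.
have nr : ((R - 20 * k) %% 10 = r)%N by rewrite /r /k /s; lia.
have nq : ((R - 20 * k) %/ 10 = y + s %% 2)%N by rewrite /k /s; lia.
rewrite nr nq in g1 g2 g3.
have ks : (k - x = s %/ 2)%N by rewrite /k addKn.
rewrite ks in g1 g2 g3.
have sE : (10 * s = R - r - 20 * x - 10 * y)%N by rewrite /s; lia.
have [s0|s1] : (s %% 2 = 0 \/ s %% 2 = 1)%N by lia.
  rewrite s0 addn0 in g1 g2.
  case: b deg => deg.
    by apply: (realizable10_true g2); rewrite /dominates; case: rE => rE; rewrite rE; lia.
  by apply: (realizable10_false g1); rewrite /dominates; case: rE => rE; rewrite rE; lia.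
rewrite s1 addn1 /= in g3; have [g31 g32] := g3 isT.
case: b deg => deg.
  by apply: (realizable10_true g32); rewrite /dominates; case: rE => rE; rewrite rE; lia.
by apply: (realizable10_false g31); rewrite /dominates; case: rE => rE; rewrite rE; lia.
Qed.

Lemma realizable10_seven b ms x y z : (b, ms) \in alt_mults alts7 ->
    (forall a : pred nat, count a ms = a 4 * x + a 3 * y + a 2 * z)%N -> realizable10 b 7 x y z.
Proof.
move=> bms cE; apply: (@realizable10_exact K b (nseq 7 5 ++ ms)%N); last first.
  by move=> a; rewrite count_cat count_nseq cE !addnA.
have := fives_checkP charK (simplex_uniq 10) _ certificate7; apply.
by move=> D' uD' chk; apply: (tail_checkP charK uD' chk bms).
Qed.

Lemma realizable10_eight b ms x y z : (b, ms) \in alt_mults alts8 ->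
    (forall a : pred nat, count a ms = a 4 * x + a 3 * y + a 2 * z)%N -> realizable10 b 8 x y z.
Proof.
move=> bms cE; apply: (@realizable10_exact K b (nseq 8 5 ++ ms)%N); last first.
  by move=> a; rewrite count_cat count_nseq cE !addnA.
have := fives_checkP charK (simplex_uniq 10) _ certificate8; apply.
by move=> D' uD' chk; apply: (tail_checkP charK uD' chk bms).
Qed.

Definition exceptions : seq (nat * nat * nat * nat) :=
  [:: (9, 0, 0, 0); (8, 1, 0, 0); (8, 0, 1, 1); (8, 0, 1, 0);
      (8, 0, 0, 2); (8, 0, 0, 1); (7, 2, 0, 1); (7, 1, 2, 0); (7, 2, 0, 0)]%N.

Lemma realizable10_false7 t : t \in [:: (1, 0, 5); (1, 1, 2); (0, 4, 0); (0, 3, 2); (0, 2, 5);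
    (0, 1, 7); (0, 0, 10)]%N ->
  realizable10 false 7 t.1.1 t.1.2 t.2.
Proof.
rewrite !inE; repeat case/predU1P => [-> /=|]; last move/eqP => -> /=.
- by apply: (@realizable10_seven _ (nth (true, [::]) (alt_mults alts7) 0).2) => // a /=; lia.
- by apply: (@realizable10_seven _ (nth (true, [::]) (alt_mults alts7) 1).2) => // a /=; lia.
- by apply: (@realizable10_seven _ (nth (true, [::]) (alt_mults alts7) 2).2) => // a /=; lia.
- by apply: (@realizable10_seven _ (nth (true, [::]) (alt_mults alts7) 3).2) => // a /=; lia.
- by apply: (@realizable10_seven _ (nth (true, [::]) (alt_mults alts7) 4).2) => // a /=; lia.
- by apply: (@realizable10_seven _ (nth (true, [::]) (alt_mults alts7) 5).2) => // a /=; lia.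
- by apply: (@realizable10_seven _ (nth (true, [::]) (alt_mults alts7) 6).2) => // a /=; lia.
Qed.

Lemma realizable10_true7 t : t \in [:: (2, 0, 2); (2, 1, 0); (3, 0, 0); (1, 0, 6); (1, 1, 3);
    (1, 2, 1); (1, 3, 0); (0, 5, 0); (0, 4, 1); (0, 3, 3); (0, 2, 6); (0, 1, 8); (0, 0, 11)]%N ->
  realizable10 true 7 t.1.1 t.1.2 t.2.
Proof.
rewrite !inE; repeat case/predU1P => [-> /=|]; last move/eqP => -> /=.
- by apply: (@realizable10_seven _ (nth (true, [::]) (alt_mults alts7) 7).2) => // a /=; lia.
- by apply: (@realizable10_seven _ (nth (true, [::]) (alt_mults alts7) 8).2) => // a /=; lia.
- by apply: (@realizable10_seven _ (nth (true, [::]) (alt_mults alts7) 9).2) => // a /=; lia.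
- by apply: (@realizable10_seven _ (nth (true, [::]) (alt_mults alts7) 10).2) => // a /=; lia.
- by apply: (@realizable10_seven _ (nth (true, [::]) (alt_mults alts7) 11).2) => // a /=; lia.
- by apply: (@realizable10_seven _ (nth (true, [::]) (alt_mults alts7) 12).2) => // a /=; lia.
- by apply: (@realizable10_seven _ (nth (true, [::]) (alt_mults alts7) 13).2) => // a /=; lia.
- by apply: (@realizable10_seven _ (nth (true, [::]) (alt_mults alts7) 14).2) => // a /=; lia.
- by apply: (@realizable10_seven _ (nth (true, [::]) (alt_mults alts7) 15).2) => // a /=; lia.
- by apply: (@realizable10_seven _ (nth (true, [::]) (alt_mults alts7) 16).2) => // a /=; lia.
- by apply: (@realizable10_seven _ (nth (true, [::]) (alt_mults alts7) 17).2) => // a /=; lia.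
- by apply: (@realizable10_seven _ (nth (true, [::]) (alt_mults alts7) 18).2) => // a /=; lia.
- by apply: (@realizable10_seven _ (nth (true, [::]) (alt_mults alts7) 19).2) => // a /=; lia.
Qed.

Lemma realizable10_true8 t : t \in [:: (1, 0, 1); (0, 2, 0); (0, 1, 2); (0, 0, 3)]%N ->
  realizable10 true 8 t.1.1 t.1.2 t.2.
Proof.
rewrite !inE; repeat case/predU1P => [-> /=|]; last move/eqP => -> /=.
- by apply: (@realizable10_eight _ (nth (true, [::]) (alt_mults alts8) 1).2) => // a /=; lia.
- by apply: (@realizable10_eight _ (nth (true, [::]) (alt_mults alts8) 2).2) => // a /=; lia.
- by apply: (@realizable10_eight _ (nth (true, [::]) (alt_mults alts8) 3).2) => // a /=; lia.
- by apply: (@realizable10_eight _ (nth (true, [::]) (alt_mults alts8) 4).2) => // a /=; lia.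
Qed.

Lemma realizable10_false8 : realizable10 false 8 0 0 0.
Proof. by apply: (@realizable10_eight _ (nth (true, [::]) (alt_mults alts8) 0).2) => // a;
  rewrite !muln0. Qed.

(** Up to six 5-points the argument is uniform. For seven and eight, comparison with the extremal
    certificates covers everything outside the exceptions, and nine or more reduce to a case with
    eight. *)
Lemma realizable10_nonexceptional b w x y z : (w, x, y, z) \notin exceptions ->
    (if b then 286 <= 35 * w + 20 * x + 10 * y + 4 * z
     else 35 * w + 20 * x + 10 * y + 4 * z <= 286)%N ->
  realizable10 b w x y z.
Proof.
case: (leqP w 6) => [w6 _|w6 nex deg]; first exact: realizable10_le6.
have nx w' x' y' z' : (w', x', y', z') \in exceptions ->
    ~ (w = w' /\ x = x' /\ y = y' /\ z = z').
  by move=> ee [? [? [? ?]]]; subst; rewrite ee in nex.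
case: (leqP w 8) => w8; last first.
  have e1 := nx 9 0 0 0 isT.
  case: b deg => deg; last by lia.
  (* Every tuple with at least nine 5-points other than (9,0,0,0) dominates (8,1,0,1). *)
  by apply: (realizable10_true (@realizable10_true8 (1, 0, 1)%N isT)); rewrite /dominates /=; lia.
have [E|E] : w = 7 \/ w = 8 by lia.
  have e7 : ~ (x = 2 /\ y = 0 /\ z = 1) by move=> h; case: (nx 7 2 0 1 isT).
  have e8 : ~ (x = 1 /\ y = 2 /\ z = 0) by move=> h; case: (nx 7 1 2 0 isT).
  have e9 : ~ (x = 2 /\ y = 0 /\ z = 0) by move=> h; case: (nx 7 2 0 0 isT).
  subst w; clear nx nex w6 w8.
  case: b deg => deg.
    have use t : t \in [:: (2, 0, 2); (2, 1, 0); (3, 0, 0); (1, 0, 6); (1, 1, 3); (1, 2, 1); (1,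
      3, 0); (0, 5, 0); (0, 4, 1); (0, 3, 3); (0, 2, 6); (0, 1, 8); (0, 0, 11)]%N ->
        [&& t.1.1 <= x, t.1.1 + t.1.2 <= x + y & t.1.1 + t.1.2 + t.2 <= x + y + z]%N ->
        realizable10 true 7 x y z.
      by move=> /realizable10_true7 g le; apply: (realizable10_true g); rewrite /dominates; lia.
    have [h|h] : (3 <= x \/ x <= 2)%N by lia.
      by apply: (use (3, 0, 0)%N) => //=; lia.
    case: x deg h e7 e8 e9 use => [|[|[|x]]] deg h e7 e8 e9 use; last by lia.
    - have [h2|h2] : (5 <= y \/ y <= 4)%N by lia.
        by apply: (use (0, 5, 0)%N) => //=; lia.
      case: y deg h2 e7 e8 e9 use => [|[|[|[|[|y]]]]] deg h2 e7 e8 e9 use; last by lia.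
      + by apply: (use (0, 0, 11)%N) => //=; lia.
      + by apply: (use (0, 1, 8)%N) => //=; lia.
      + by apply: (use (0, 2, 6)%N) => //=; lia.
      + by apply: (use (0, 3, 3)%N) => //=; lia.
      + by apply: (use (0, 4, 1)%N) => //=; lia.
    - case: y deg e7 e8 e9 use => [|[|[|y]]] deg e7 e8 e9 use.
      + by apply: (use (1, 0, 6)%N) => //=; lia.
      + by apply: (use (1, 1, 3)%N) => //=; lia.
      + by apply: (use (1, 2, 1)%N) => //=; lia.
      + by apply: (use (1, 3, 0)%N) => //=; lia.
    - case: y deg e7 e8 e9 use => [|y] deg e7 e8 e9 use.
      + by apply: (use (2, 0, 2)%N) => //=; lia.
      + by apply: (use (2, 1, 0)%N) => //=; lia.
  have use t : t \in [:: (1, 0, 5); (1, 1, 2); (0, 4, 0); (0, 3, 2); (0, 2, 5); (0, 1, 7); (0,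
    0, 10)]%N ->
      [&& x <= t.1.1, x + y <= t.1.1 + t.1.2 & x + y + z <= t.1.1 + t.1.2 + t.2]%N ->
      realizable10 false 7 x y z.
    by move=> /realizable10_false7 g le; apply: (realizable10_false g); rewrite /dominates; lia.
  case: x deg e7 e8 e9 use => [|[|x]] deg e7 e8 e9 use; last by lia.
  - case: y deg e7 e8 e9 use => [|[|[|[|y]]]] deg e7 e8 e9 use.
    + by apply: (use (0, 0, 10)%N) => //=; lia.
    + by apply: (use (0, 1, 7)%N) => //=; lia.
    + by apply: (use (0, 2, 5)%N) => //=; lia.
    + by apply: (use (0, 3, 2)%N) => //=; lia.
    + by apply: (use (0, 4, 0)%N) => //=; lia.
  - case: y deg e7 e8 e9 use => [|[|y]] deg e7 e8 e9 use; last by lia.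
    + by apply: (use (1, 0, 5)%N) => //=; lia.
    + by apply: (use (1, 1, 2)%N) => //=; lia.
have e2 : ~ (x = 1 /\ y = 0 /\ z = 0) by move=> h; case: (nx 8 1 0 0 isT).
have e3 : ~ (x = 0 /\ y = 1 /\ z = 1) by move=> h; case: (nx 8 0 1 1 isT).
have e4 : ~ (x = 0 /\ y = 1 /\ z = 0) by move=> h; case: (nx 8 0 1 0 isT).
have e5 : ~ (x = 0 /\ y = 0 /\ z = 2) by move=> h; case: (nx 8 0 0 2 isT).
have e6 : ~ (x = 0 /\ y = 0 /\ z = 1) by move=> h; case: (nx 8 0 0 1 isT).
subst w; clear nx nex w6 w8.
case: b deg => deg; last by apply: (realizable10_false realizable10_false8); rewrite /dominates;
  lia.
have use t : t \in [:: (1, 0, 1); (0, 2, 0); (0, 1, 2); (0, 0, 3)]%N ->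
    [&& t.1.1 <= x, t.1.1 + t.1.2 <= x + y & t.1.1 + t.1.2 + t.2 <= x + y + z]%N ->
    realizable10 true 8 x y z.
  by move=> /realizable10_true8 g le; apply: (realizable10_true g); rewrite /dominates; lia.
have [h|[h|[h|h]]] : (1 <= x \/ x = 0 /\ 2 <= y \/ x = 0 /\ y = 1 \/ x = 0 /\ y = 0)%N by lia.
- by apply: (use (1, 0, 1)%N) => //=; lia.
- by apply: (use (0, 2, 0)%N) => //=; lia.
- by apply: (use (0, 1, 2)%N) => //=; lia.
- by apply: (use (0, 0, 3)%N) => //=; lia.
Qed.

Lemma interpolation w x y z : dominates w x y z 8 1 1 0 ->
  realizable K false (simplex 13) (multiplicities w x y z).
Proof.
move=> /dominatesP[h1 h2]; apply: (realizable_le_false h1 h2).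
have := @tree_checkP K charK false _ _ (simplex_uniq 13) interpolation_check.
exact: realizable_perm.
Qed.

End Main.

(** * Forms vanishing at fat points *)

Section Vanishing.

Variables (n : nat) (K : fieldType).
Implicit Types (f g h : {mpoly K[n]}) (v : 'I_n -> K).

Fixpoint vanish (m : nat) v f : Prop :=
  if m is m'.+1 then f.@[v] = 0 /\ forall j, vanish m' v f^`M(j) else True.

Lemma vanish0 m v : vanish m v 0.
Proof. by elim: m => //= m IH; split=> [|j]; rewrite ?meval0 ?mderiv0. Qed.

Lemma vanishD m v f g : vanish m v f -> vanish m v g -> vanish m v (f + g).
Proof.
elim: m f g => //= m IH f g [f0 fd] [g0 gd]; split=> [|j].
  by rewrite mevalD f0 g0 addr0.
by rewrite mderivD; apply: IH.
Qed.

Lemma vanishZ m v c f : vanish m v f -> vanish m v (c *: f).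
Proof.
elim: m f => //= m IH f [f0 fd]; split=> [|j]; first by rewrite mevalZ f0 mulr0.
by rewrite mderivZ; apply: IH.
Qed.

Lemma vanishB m v f g : vanish m v f -> vanish m v g -> vanish m v (f - g).
Proof. by move=> vf vg; rewrite -scaleN1r; apply: vanishD => //; apply: vanishZ. Qed.

Lemma vanish_sum (I : Type) (r : seq I) (P : pred I) m v (F : I -> {mpoly K[n]}) :
  (forall i, P i -> vanish m v (F i)) -> vanish m v (\sum_(i <- r | P i) F i).
Proof.
move=> vF; elim/big_ind: _ => //; first exact: vanish0.
by move=> f g; apply: vanishD.
Qed.

Lemma vanishW m v f : vanish m.+1 v f -> vanish m v f.
Proof.
elim: m f => // m IH f [f0 fd]; split=> // j; exact/IH/fd.
Qed.

Lemma vanish_le m m' v f : (m <= m')%N -> vanish m' v f -> vanish m v f.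
Proof.
by move=> le; rewrite -(subnK le); elim: (m' - m)%N => // k IH /vanishW.
Qed.

Lemma vanishMl m v g f : vanish m v f -> vanish m v (g * f).
Proof.
elim: m g f => //= m IH g f [f0 fd]; split=> [|j]; first by rewrite mevalM f0 mulr0.
rewrite mderivM; apply: vanishD; apply: IH => //.
by apply: vanishW; split.
Qed.

Lemma vanishM a b v f g : vanish a v f -> vanish b v g -> vanish (a + b) v (f * g).
Proof.
elim: a b f g => [|a IHa] b f g; first by move=> _; apply: vanishMl.
elim: b f g => [|b IHb] f g vf vg.
  by rewrite addn0 mulrC; apply: vanishMl.
rewrite addSn; split=> [|j]; first by rewrite mevalM vf.1 mul0r.
rewrite mderivM; apply: vanishD; first by apply: IHa; [apply: vf.2 | ].
by rewrite addnS -addSn; apply: IHb => //; apply: vg.2.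
Qed.

Lemma vanishX a v f k : vanish a v f -> vanish (a * k) v (f ^+ k).
Proof.
move=> vf; elim: k => [|k IHk]; first by rewrite muln0.
by rewrite exprS mulnS; apply: vanishM.
Qed.

(** A factor with nonzero value at the point is a unit in its local ring. *)
Lemma vanish_cancel m v h f : h.@[v] != 0 -> vanish m v (h * f) -> vanish m v f.
Proof.
move=> h0; elim: m f => // m IH f vhf; have vf := IH _ (vanishW vhf).
case: vhf => hf0 hfd; split=> [|j].
  by move/eqP: hf0; rewrite mevalM mulf_eq0 (negbTE h0) => /eqP.
apply: IH; have := hfd j; rewrite mderivM => vd.
rewrite -[_ * _](addrK (h^`M(j) * f)) [_ + h^`M(j) * f]addrC.
by apply: vanishB => //; apply: vanishMl.
Qed.

Lemma mderiv_homog d j f : f \is d.-homog -> f^`M(j) \is d.-1.-homog.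
Proof.
move=> /dhomogP hf; apply/dhomogP => m; rewrite mcoeff_msupp mcoeff_mderiv => c0.
have : (m + U_(j))%MM \in msupp f.
  by rewrite mcoeff_msupp; apply: contra c0 => /eqP ->; rewrite mul0rn.
by move=> /hf /=; rewrite mdegD mdeg1 addn1 => <-.
Qed.

Lemma mcoeff_euler j f m : ('X_j * f^`M(j))@_m = f@_m *+ m j.
Proof.
case: (boolP (U_(j) <= m)%MM) => [le|nle].
  rewrite -{1}(submK le) mulrC addmC mcoeffMX mcoeff_mderiv submK // mnmBE mnm1E eqxx.
  by rewrite subn1 prednK // lt0n -lep1mP.
have mj : m j = 0%N by apply/eqP; move: nle; rewrite lep1mP negbK.
rewrite mj mulr0n; apply: memN_msupp_eq0; apply/negP => /msuppM_le.
case/allpairsP => -[m1 m2] /= []; rewrite msuppX inE => /eqP -> _ E.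
by move: mj; rewrite E mnmDE mnm1E eqxx.
Qed.

Lemma euler d f : f \is d.-homog -> \sum_j 'X_j * f^`M(j) = d%:R *: f.
Proof.
move=> hf; apply/mpolyP => m; rewrite mcoeffZ raddf_sum /=.
under eq_bigr => j _ do rewrite mcoeff_euler.
rewrite sumrMnr -mdegE mulr_natl; case: (eqVneq f@_m 0) => [->|fm].
  by rewrite !mul0rn.
by congr (_ *+ _); move/dhomogP: hf; apply; rewrite mcoeff_msupp.
Qed.

Lemma euler_eval d f v : f \is d.-homog ->
  \sum_j v j * f^`M(j).@[v] = d%:R * f.@[v].
Proof.
move=> /euler E; rewrite -mevalZ -E raddf_sum /=.
by apply: eq_bigr => j _; rewrite mevalM mevalXU.
Qed.

Hypothesis charK : [pchar K] =i pred0.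

Lemma natr_pchar0_neq0 k : (0 < k)%N -> k%:R != 0 :> K.
Proof. by have /pcharf0P -> := charK; case: k. Qed.

Lemma homog0_vanish m v f : f \is 0.-homog -> vanish m.+1 v f -> f = 0.
Proof.
move=> hf [f0 _]; have fE : f = (f@_0%MM)%:MP.
  apply: msize1_polyC; rewrite msizeE; apply/bigmax_leqP_seq => k kf _.
  by have /dhomogP/(_ _ kf) /= -> := hf.
by move: f0; rewrite fE mevalC => ->; rewrite mpolyC0.
Qed.

(** Euler's formula expresses d f(v) through the first derivatives of f at v, so in characteristic 0
    the vanishing of all derivatives of one order forces that of the lower orders. The bound
    [m <= d] keeps the degrees divided by positive. *)
Lemma vanish_top_derivatives d m v f : f \is d.-homog -> (m <= d)%N ->
  vanish m.+1 v f <-> (forall mu : 'X_{1..n}, mdeg mu = m -> f^`M[mu].@[v] = 0).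
Proof.
elim: m d f => [|m IH] d f hf md; split.
- move=> [f0 _] mu /eqP; rewrite mdeg_eq0 => /eqP ->; by rewrite mderivm0m.
- by move=> /(_ 0%MM mdeg0); rewrite mderivm0m.
- move=> [f0 fd] mu mum.
  have [j jmu] : exists j, mu j != 0%N.
    apply/existsP; rewrite -negb_forall; apply/negP => /forallP all0.
    have mu0 : mu = 0%MM by apply/mnmP => j; apply/eqP; rewrite mnm0E.
    by rewrite mu0 mdeg0 in mum.
  have le : (U_(j) <= mu)%MM by rewrite lep1mP.
  have := (IH _ _ (mderiv_homog j hf) _).1 (fd j) (mu - U_(j))%MM.
  rewrite -(mderivmU1m j) -mderivmDm addmC submK //; apply; first by lia.
  by have := congr1 (@mdeg n) (submK le); rewrite mdegD mdeg1; lia.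
move=> fmu; have fd j : vanish m.+1 v f^`M(j).
  apply/(IH _ _ (mderiv_homog j hf)); first by lia.
  by move=> mu mum; rewrite -(mderivmU1m j) -mderivmDm; apply: fmu; rewrite mdegD mdeg1 mum.
split=> //; apply/eqP; have d0 : d%:R != 0 :> K by apply: natr_pchar0_neq0; lia.
rewrite -(mulrI_eq0 _ (mulfI d0)) -(euler_eval v hf) big1 // => j _.
by rewrite (fd j).1 mulr0.
Qed.

End Vanishing.

(** * Forms, their coefficients and their moments *)

Section Monomials.

Definition mon (s : seq nat) : 'X_{1..4} := [multinom nth 0%N s i | i < 4].

Lemma monE s i : mon s i = nth 0%N s i.
Proof. exact: mnmE. Qed.

Lemma mdeg_mon i j k l : mdeg (mon [:: i; j; k; l]) = (i + j + k + l)%N.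
Proof. by rewrite mdegE !big_ord_recl big_ord0 !monE /= addn0 !addnA. Qed.

Lemma simplex_mon d s : s \in simplex d -> mdeg (mon s) = d /\ size s = 4.
Proof. by case/simplexP=> i [j [k [l [-> <-]]]]; rewrite mdeg_mon. Qed.

Lemma mon_inj d : {in simplex d &, injective mon}.
Proof.
move=> _ _ /simplexP[i [j [k [l [-> _]]]]] /simplexP[i' [j' [k' [l' [-> _]]]]].
move/mnmP => E; move: (E 0) (E 1) (E (inord 2)) (E (inord 3)).
by rewrite !monE !inordK //= => -> -> -> ->.
Qed.

Lemma mon_simplex d (m : 'X_{1..4}) : mdeg m = d ->
  exists2 s, s \in simplex d & mon s = m.
Proof.
move=> md; exists [:: m 0; m 1; m (inord 2); m (inord 3)].
  apply/simplexP; exists (m 0), (m 1), (m (inord 2)), (m (inord 3)); split=> //.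
  rewrite -md mdegE !big_ord_recl big_ord0 addn0 !addnA.
  by congr (_ + m _ + m _ + m _)%N; apply: val_inj; rewrite /= ?inordK.
apply/mnmP => i; rewrite monE.
by case: i => -[|[|[|[|//]]]] lt /=; congr (m _); apply: val_inj; rewrite /= ?inordK.
Qed.

Let o1 : 'I_4 := Ordinal (isT : 1 < 4)%N.
Let o2 : 'I_4 := Ordinal (isT : 2 < 4)%N.
Let o3 : 'I_4 := Ordinal (isT : 3 < 4)%N.

Section Forms.

Variable K : fieldType.
Implicit Types (f : {mpoly K[4]}) (v : 'I_4 -> K).

Definition form (d : nat) (c : seq nat -> K) : {mpoly K[4]} :=
  \sum_(s <- simplex d) c s *: 'X_[mon s].

Lemma form_homog d c : form d c \is d.-homog.
Proof.
rewrite /form big_seq; apply: rpred_sum => s /simplex_mon[sd _].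
by apply: rpredZ; rewrite dhomogX /= sd.
Qed.

Lemma mcoeff_form d c s : s \in simplex d -> (form d c)@_(mon s) = c s.
Proof.
move=> sd; rewrite raddf_sum /= (bigD1_seq s) ?simplex_uniq //= big1_seq ?addr0.
  by rewrite mcoeffZ mcoeffX eqxx mulr1.
move=> t /andP[ts td]; rewrite mcoeffZ mcoeffX.
by rewrite (inj_in_eq (@mon_inj d)) // (negbTE ts) mulr0.
Qed.

Lemma formE d f : f \is d.-homog -> f = form d (fun s => f@_(mon s)).
Proof.
move=> hf; apply/mpolyP => m; case: (eqVneq (mdeg m) d) => md.
  by have [s sd <-] := mon_simplex md; rewrite mcoeff_form.
rewrite (dhomog_nemf_coeff hf) // (dhomog_nemf_coeff (form_homog d _)) //.
Qed.

Lemma eq_form d c c' : {in simplex d, c =1 c'} -> form d c = form d c'.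
Proof. by move=> cc; apply: eq_big_seq => s sd; rewrite cc. Qed.

Lemma mevalX_mon v (p : nat -> K) s : (forall i : 'I_4, v i = p i) -> size s = 4 ->
  'X_[mon s].@[v] = mono p s.
Proof.
move=> vp s4; rewrite mevalX /mono s4; apply: eq_bigr => i _.
by rewrite vp monE.
Qed.

Lemma powprod_shift (s k : seq nat) i : (i < size k)%N ->
  powprod s (set_nth 0%N k i (nth 0%N k i).+1) = (nth 0%N s i * powprod s k)%N.
Proof.
move=> ik; have sk : size (set_nth 0%N k i (nth 0%N k i).+1) = size k.
  by rewrite size_set_nth; apply/maxn_idPr.
rewrite /powprod sk (bigD1 (Ordinal ik)) //= [RHS](_ : _ = (nth 0 s i * (nth 0 s i ^ nth 0 k i *
  \prod_(j < size k | j != Ordinal ik) nth 0 s j ^ nth 0 k j))%N); last first.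
  by rewrite (bigD1 (Ordinal ik)).
rewrite nth_set_nth /= eqxx expnS -mulnA; congr (_ * (_ * _))%N.
by apply: eq_bigr => j; rewrite nth_set_nth /= -val_eqE /= => /negbTE ->.
Qed.

(** The value at p of prod (X_j d/dX_j)^(k_j) applied to f, written on coefficients; see [moment0]
    and [moment_shift]. *)
Definition moment d (p : nat -> K) (k : seq nat) f : K :=
  \sum_(s <- simplex d) f@_(mon s) * ((powprod s k)%:R * mono p s).

Lemma moment0 d (p : nat -> K) v f : (forall i : 'I_4, v i = p i) -> f \is d.-homog ->
  moment d p [:: 0; 0; 0; 0]%N f = f.@[v].
Proof.
move=> vp hf; rewrite {2}(formE hf) raddf_sum /=; apply: eq_big_seq => s sd.
have [_ s4] := simplex_mon sd.
rewrite mevalZ (mevalX_mon vp s4); congr (_ * _).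
by rewrite /powprod !big_ord_recl big_ord0 /= !expn0 !muln1 mul1r.
Qed.

Lemma moment_shift d p k f (j : 'I_4) : size k = 4 ->
  moment d p (set_nth 0%N k j (nth 0%N k j).+1) f = moment d p k ('X_j * f^`M(j)).
Proof.
move=> k4; apply: eq_big_seq => s sd; rewrite powprod_shift ?k4 //.
by rewrite mcoeff_euler monE -(mulr_natr f@_(mon s)) natrM -!mulrA.
Qed.

Lemma euler_homog d j f : f \is d.-homog -> 'X_j * f^`M(j) \is d.-homog.
Proof.
move=> /dhomogP hf; apply/dhomogP => m; rewrite mcoeff_msupp mcoeff_euler => c0.
by apply: hf; rewrite mcoeff_msupp; apply: contra c0 => /eqP ->; rewrite mul0rn.
Qed.

(** An operator X_j d/dX_j lowers the order of vanishing by at most one, so after fewer than [m] of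
    them the value at the point is still 0. *)
Lemma vanish_moment d m (p : nat -> K) v f k : (forall i : 'I_4, v i = p i) -> f \is d.-homog ->
  vanish m v f -> k \in low_exponents m -> moment d p k f = 0.
Proof.
move=> vp hf vf /low_exponentsP[a [b [c [-> lt]]]].
elim: {lt}(a + b + c)%N {-2}a {-2}b {-2}c (erefl (a + b + c)%N) m lt f hf vf
  => [|N IH] a' b' c' E m lt f hf vf.
  have [-> -> ->] : [/\ a' = 0, b' = 0 & c' = 0]%N by split; lia.
  by rewrite (moment0 vp hf); case: m lt vf => // m _ [].
case: m lt vf => // m lt [f0 fd].
have step (j : 'I_4) : vanish m v ('X_j * f^`M(j)) by apply: vanishMl; apply: fd.
have [[a'' Ea]|[[b'' Eb]|[c'' Ec]]] : (exists a'', a' = a''.+1) \/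
    (exists b'', b' = b''.+1) \/ (exists c'', c' = c''.+1).
  case: a' E lt => [|a''] E lt; last by left; exists a''.
  case: b' E lt => [|b''] E lt; last by right; left; exists b''.
  by case: c' E lt => [|c''] E lt; [lia | right; right; exists c''].
- rewrite Ea -[[:: _; _; _; _]]/(set_nth 0 [:: 0; a''; b'; c'] o1 (nth 0 [:: 0; a''; b'; c']
  o1).+1)%N.
  by rewrite moment_shift //; apply: (IH _ _ _ _ m); rewrite ?euler_homog //; lia.
- rewrite Eb -[[:: _; _; _; _]]/(set_nth 0 [:: 0; a'; b''; c'] o2 (nth 0 [:: 0; a'; b''; c']
  o2).+1)%N.
  by rewrite moment_shift //; apply: (IH _ _ _ _ m); rewrite ?euler_homog //; lia.
rewrite Ec -[[:: _; _; _; _]]/(set_nth 0 [:: 0; a'; b'; c''] o3 (nth 0 [:: 0; a'; b'; c'']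
  o3).+1)%N.
by rewrite moment_shift //; apply: (IH _ _ _ _ m); rewrite ?euler_homog //; lia.
Qed.

End Forms.

End Monomials.

Lemma sum_iota_rev (F : nat -> nat) k :
  sumn [seq F (k - j)%N | j <- iota 0 k] = (\sum_(j < k) F j.+1)%N.
Proof.
rewrite sumnE big_map -/(index_iota 0 k) -[X in iota 0 X]subn0 -/(index_iota 0 k).
rewrite big_mkord (reindex_inj rev_ord_inj) /=; apply: eq_bigr => j _.
by rewrite subKn.
Qed.

Lemma size_low_exponents m : size (low_exponents m) = 'C(m + 2, 3).
Proof.
have tri k : (\sum_(j < k) j.+1 = 'C(k.+1, 2))%N.
  by elim: k => [|k IH]; rewrite ?big_ord0 // big_ord_recr IH /= [RHS]binS bin1.
have tet k : (\sum_(j < k) 'C(j.+2, 2) = 'C(k + 2, 3))%N.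
  elim: k => [|k IH]; first by rewrite big_ord0.
  by rewrite big_ord_recr IH /= addSn [RHS]binS !addn2.
rewrite size_allpairs_dep -tet; under eq_map => ij do rewrite size_iota.
rewrite map_allpairs /= -(sum_iota_rev (fun j => 'C(j.+1, 2))).
rewrite /allpairs_dep sumn_flatten -map_comp; congr (sumn _).
apply: eq_map => i /=; rewrite -tri -(sum_iota_rev id).
by congr (sumn _); apply: eq_map => j.
Qed.

(** * The linear conditions imposed by fat points *)

(** The exponents of degree m - 1 in all four variables. Deriving them from [low_exponents] makes
    the list empty for [m = 0] and gives it the length of an [m]-point in general. *)
Definition derivative_exponents (m : nat) : seq (seq nat) :=
  [seq (m.-1 - sumn s)%N :: behead s | s <- low_exponents m].

Lemma derivative_exponents_uniq m : uniq (derivative_exponents m).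
Proof. by case: m => // m; apply: (simplex_uniq m). Qed.

Section Conditions.

Variables (K : fieldType) (n : nat).
Implicit Types (mu : 'I_n -> nat) (P : 'M[K]_(n, 4)) (f g : {mpoly K[4]}).

Definition pt P (a : 'I_n) : 'I_4 -> K := fun i => P a i.

Definition conditions mu : seq ('I_n * seq nat) :=
  [seq (a, t) | a : 'I_n <- enum 'I_n, t : seq nat <- derivative_exponents (mu a)].

Definition condition P (x : 'I_n * seq nat) f : K := f^`M[mon x.2].@[pt P x.1].

Definition monomial_condition P x (s : seq nat) : K := condition P x 'X_[mon s].

Definition vanish_all mu P f := forall a : 'I_n, vanish (mu a) (pt P a) f.

Lemma vanish_allB mu P f g :
  vanish_all mu P f -> vanish_all mu P g -> vanish_all mu P (f - g).
Proof. by move=> vf vg a; apply: vanishB. Qed.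

Lemma vanish_allD mu P f g :
  vanish_all mu P f -> vanish_all mu P g -> vanish_all mu P (f + g).
Proof. by move=> vf vg a; apply: vanishD. Qed.

Lemma vanish_allMl mu P f g : vanish_all mu P f -> vanish_all mu P (g * f).
Proof. by move=> vf a; apply: vanishMl. Qed.

Lemma vanish_allM mu1 mu2 mu P f g : (forall a, mu a <= mu1 a + mu2 a)%N ->
  vanish_all mu1 P f -> vanish_all mu2 P g -> vanish_all mu P (f * g).
Proof. by move=> le vf vg a; apply: vanish_le (le a) _; apply: vanishM. Qed.

Lemma vanish_allX mu k P f :
  vanish_all mu P f -> vanish_all (fun a => mu a * k)%N P (f ^+ k).
Proof. by move=> vf a; apply: vanishX. Qed.

Lemma vanish_all_cancel mu P k f : (forall a, P a 0 != 0) ->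
  vanish_all mu P ('X_0 ^+ k * f) -> vanish_all mu P f.
Proof.
move=> P0 vf a; apply: vanish_cancel (vf a).
by rewrite rmorphXn /= mevalXU expf_neq0 // P0.
Qed.

Lemma conditions_uniq mu : uniq (conditions mu).
Proof.
apply: allpairs_uniq_dep => [|a _|]; rewrite ?enum_uniq ?derivative_exponents_uniq //.
by move=> [a s] [a' s'] _ _ /= [-> ->].
Qed.

Lemma size_conditions mu : size (conditions mu) = (\sum_a 'C(mu a + 2, 3))%N.
Proof.
rewrite size_allpairs_dep; under eq_map => a do rewrite size_map size_low_exponents.
by rewrite sumnE big_map big_enum.
Qed.

Lemma conditionsP mu a t : ((a, t) \in conditions mu) = (t \in derivative_exponents (mu a)).
Proof.
apply/allpairsPdep/idP => [[a' [mu' [_ mu's [-> ->]]]] //|mus].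
by exists a, t; rewrite mem_enum.
Qed.

Lemma condition_sum P x (I : Type) (r : seq I) (c : I -> K) (F : I -> {mpoly K[4]}) :
  condition P x (\sum_(i <- r) c i *: F i) = \sum_(i <- r) c i * condition P x (F i).
Proof.
rewrite /condition raddf_sum raddf_sum /=; apply: eq_bigr => s _.
by rewrite mderivmZ mevalZ.
Qed.

Lemma conditionB P x f g : condition P x (f - g) = condition P x f - condition P x g.
Proof. by rewrite /condition mderivmB mevalB. Qed.

Lemma condition_form P d c x :
  \sum_(s <- simplex d) c s * monomial_condition P x s = condition P x (form d c).
Proof. by rewrite condition_sum. Qed.

Hypothesis charK : [pchar K] =i pred0.

(** Only derivatives of order one less than the multiplicity are recorded; [vanish_top_derivatives]
    recovers the lower orders. *)
Lemma conditions_vanish mu P d f : (forall a, mu a <= d.+1)%N -> f \is d.-homog ->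
  (forall x, x \in conditions mu -> condition P x f = 0) <-> vanish_all mu P f.
Proof.
move=> mud hf; split=> [c0 a|v0 [a t]].
  case E: (mu a) (mud a) => [|m] //= md.
  apply/(vanish_top_derivatives charK _ hf) => // nu num.
  have [s sm <-] := mon_simplex num.
  by apply: (c0 (a, s)); rewrite conditionsP E.
rewrite conditionsP /condition /= => mus; have := v0 a.
case: (mu a) (mud a) mus => [|m] // md mus.
move/(vanish_top_derivatives charK _ hf); apply=> //.
by have [] := simplex_mon mus.
Qed.

(** This and the next definition are the linear-algebra forms of h^0 = 0 and of h^1 = 0 in degree
    [d]. *)
Definition nonsingular mu P d := indep (monomial_condition P) (conditions mu) (simplex d).
Definition independent mu P d :=
  indep (fun s x => monomial_condition P x s) (simplex d) (conditions mu).

Lemma nonsingular_eq0 mu P d f : (forall a, mu a <= d.+1)%N -> nonsingular mu P d ->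
  f \is d.-homog -> vanish_all mu P f -> f = 0.
Proof.
move=> mud ns hf vf; rewrite (formE hf).
rewrite (@eq_form _ d _ (fun=> 0)) => [|s sd].
  by rewrite /form big1 // => s _; rewrite scale0r.
apply: (ns (fun s => f@_(mon s))) sd => x xc; rewrite condition_form -formE //.
by apply: (conditions_vanish P mud hf).2.
Qed.

End Conditions.

Section Points.

Variables (K : fieldType) (ms : seq nat).
Hypothesis charK : [pchar K] =i pred0.
Local Notation n := (size ms).
Implicit Types (P : 'M[K]_(n, 4)) (f : {mpoly K[4]}).

Definition mult_at (a : 'I_n) : nat := nth 0%N ms a.

Lemma mult_at_le d : all (fun m => m <= d)%N ms -> forall a, (mult_at a <= d)%N.
Proof. by move=> /allP msd a; apply: msd; rewrite mem_nth. Qed.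

Lemma fat_degree_size : size (conditions mult_at) = fat_degree ms.
Proof.
rewrite size_conditions /fat_degree -(big_mkord xpredT (fun a => 'C(nth 0 ms a + 2, 3)))%N.
by rewrite [RHS](big_nth 0%N).
Qed.

Let L := zip (iota 0 n) ms.

Lemma mem_labels l m : (l, m) \in L -> (l < n)%N /\ m = nth 0%N ms l.
Proof.
move=> /(nthP (0, 0)%N)[i]; rewrite size_zip size_iota minnn => ilt.
by rewrite nth_zip ?size_iota // nth_iota // add0n => -[<- <-].
Qed.

Lemma labels_uniq : uniq (unzip1 L).
Proof. by rewrite unzip1_zip ?iota_uniq ?size_iota. Qed.

Lemma labels_mults : unzip2 L = ms.
Proof. by rewrite unzip2_zip ?size_iota. Qed.

Lemma torus_condition_vanish p P d c : (forall a i, P a i = p (val a) (val i)) ->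
    vanish_all mult_at P (form d c) ->
  forall x, x \in torus_conditions L -> \sum_(s <- simplex d) c s * torus_condition p x s = 0.
Proof.
move=> Pp v0 [l k] /torus_conditionsP[m /mem_labels[/= ln mE] /= km].
have vl : vanish m (pt P (Ordinal ln)) (form d c) by rewrite mE; apply: (v0 (Ordinal ln)).
have mom := vanish_moment (fun i => Pp (Ordinal ln) i) (form_homog d c) vl km.
rewrite -[RHS]mom.
by apply: eq_big_seq => s sd; rewrite mcoeff_form.
Qed.

(** Vanishing at the fat points implies the torus conditions, so injectivity transfers at once. For
    independence the two systems have the same number of equations, and [indep_same_kernel]
    applies. *)
Lemma realizable_point_matrix b d : all (fun m => m <= d.+1)%N ms ->
    realizable K b (simplex d) ms ->
  exists2 P : 'M[K]_(n, 4), (forall a i, P a i != 0) & if b then nonsingular mult_at P d else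
    independent mult_at P d.
Proof.
move=> /mult_at_le msd /(_ L labels_uniq); rewrite labels_mults => /(_ (perm_refl _))[p p0 g].
pose P : 'M_(n, 4) := \matrix_(a, i) p (val a) (val i).
have Pp a i : P a i = p (val a) (val i) by rewrite mxE.
exists P; first by move=> a i; rewrite Pp.
case: b g => g.
  move=> c c0; apply: g; apply: (torus_condition_vanish Pp).
  apply/(conditions_vanish charK P msd (form_homog d c)) => x /c0.
  by rewrite condition_form.
apply: indep_same_kernel g; rewrite ?torus_conditions_uniq ?labels_uniq ?conditions_uniq
  ?simplex_uniq //.
  rewrite fat_degree_size size_allpairs_dep /fat_degree.
  rewrite -[in RHS]labels_mults sumnE !big_map; apply: eq_bigr => l _.
  exact: size_low_exponents.
move=> c c0; apply: (torus_condition_vanish Pp).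
apply/(conditions_vanish charK P msd (form_homog d c)) => x /c0.
by rewrite condition_form.
Qed.

End Points.

(** * Multihomogeneous minors and general points *)

Section Multihomogeneous.

Variables (K : fieldType) (n : nat).
Implicit Types (F : {mpoly K[n * 4]}) (e : 'I_n -> nat).

Definition block_degree (mu : 'X_{1..n * 4}) (a : 'I_n) : nat :=
  (\sum_(j < 4) mu (mxvec_index a j))%N.

Definition has_multidegree e F :=
  forall mu, mu \in msupp F -> forall a, block_degree mu a = e a.

Lemma block_degreeD mu nu a :
  block_degree (mu + nu)%MM a = (block_degree mu a + block_degree nu a)%N.
Proof. by rewrite /block_degree -big_split; apply: eq_bigr => j _; rewrite mnmDE. Qed.

Lemma multidegree_sum e (I : Type) (r : seq I) (P : pred I) (F : I -> {mpoly K[n * 4]}) :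
  (forall i, P i -> has_multidegree e (F i)) -> has_multidegree e (\sum_(i <- r | P i) F i).
Proof.
move=> eF; elim/big_ind: _ => // [mu|F1 F2 h1 h2 mu]; first by rewrite msupp0.
by move=> /msuppD_le; rewrite mem_cat => /orP[/h1|/h2].
Qed.

Lemma multidegreeM e1 e2 F1 F2 : has_multidegree e1 F1 -> has_multidegree e2 F2 ->
  has_multidegree (fun a => e1 a + e2 a)%N (F1 * F2).
Proof.
move=> h1 h2 mu /msuppM_le/allpairsP[[m1 m2] /= [/h1 E1 /h2 E2 ->]] a.
by rewrite block_degreeD E1 E2.
Qed.

Lemma multidegreeZ e c F : has_multidegree e F -> has_multidegree e (c *: F).
Proof. by move=> h mu /msuppZ_le/h. Qed.

Lemma multidegree1 : has_multidegree (fun=> 0%N) 1.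
Proof.
move=> mu; rewrite msupp1 inE => /eqP -> a; rewrite /block_degree big1 // => j _.
by rewrite mnm0E.
Qed.

Lemma multidegreeX e F k : has_multidegree e F ->
  has_multidegree (fun a => k * e a)%N (F ^+ k).
Proof.
move=> eF; elim: k => [|k IH]; first exact: multidegree1.
by rewrite exprS => mu /(multidegreeM eF IH) h a; rewrite h mulSn.
Qed.

Lemma multidegree_prod (I : Type) (r : seq I) (P : pred I) (e : I -> 'I_n -> nat)
    (F : I -> {mpoly K[n * 4]}) : (forall i, P i -> has_multidegree (e i) (F i)) ->
  has_multidegree (fun a => \sum_(i <- r | P i) e i a)%N (\prod_(i <- r | P i) F i).
Proof.
move=> eF; elim: r => [|i r IH].
  by move=> mu; rewrite big_nil => /multidegree1 h a; rewrite h big_nil.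
move=> mu; rewrite big_cons; case: (boolP (P i)) => Pi muF a; rewrite big_cons.
  by rewrite Pi; apply: (multidegreeM (eF _ Pi) IH muF).
by rewrite (negbTE Pi); apply: IH.
Qed.

Lemma mxvec_index_inj (i i' : 'I_n) (j j' : 'I_4) :
  mxvec_index i j = mxvec_index i' j' -> (i, j) = (i', j').
Proof.
pose A := \matrix_(i < n, j < 4) (i, j).
by move=> E; have := mxvecE A i j; rewrite E mxvecE !mxE.
Qed.

Lemma multidegree_var (a : 'I_n) (i : 'I_4) :
  has_multidegree (fun b => (b == a : nat)) 'X_(mxvec_index a i).
Proof.
move=> mu; rewrite msuppX inE => /eqP -> b; rewrite /block_degree.
rewrite (bigD1 i) //= big1 ?addn0 => [|j ji]; rewrite mnm1E.
  by congr (nat_of_bool _); apply/eqP/eqP => [/mxvec_index_inj[]|->].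
by case: eqP => // /mxvec_index_inj[_ /esym/eqP]; rewrite (negbTE ji).
Qed.

Definition block_vars (a : 'I_n) : 4.-tuple {mpoly K[n * 4]} :=
  [tuple 'X_(mxvec_index a i) | i < 4].

Lemma multidegree_comp (a : 'I_n) d (p : {mpoly K[4]}) : p \is d.-homog ->
  has_multidegree (fun b => d * (b == a))%N (p \mPo block_vars a).
Proof.
move=> /dhomogP hp; rewrite comp_mpolyEX big_seq; apply: multidegree_sum => m mp.
apply: multidegreeZ; rewrite comp_mpolyX => mu muF b.
have h i : has_multidegree (fun b => m i * (b == a))%N (tnth (block_vars a) i ^+ m i).
  by rewrite tnth_mktuple; apply/multidegreeX/multidegree_var.
rewrite (multidegree_prod (fun i _ => h i) muF) -big_distrl /=; congr (_ * _)%N.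
by rewrite -mdegE; apply: hp.
Qed.

(** The multidegree of an entry depends on its row only, so all terms of the Leibniz expansion share
    one multidegree. *)
Lemma multidegree_det k (e : 'I_k -> 'I_n -> nat) (M : 'M[{mpoly K[n * 4]}]_k) :
  (forall i j, has_multidegree (e i) (M i j)) ->
  has_multidegree (fun a => \sum_i e i a)%N (\det M).
Proof.
move=> eM; apply: multidegree_sum => s _.
rewrite mulr_sign -scaleN1r; case: ifP => _; last exact: multidegree_prod.
by apply: multidegreeZ; apply: multidegree_prod.
Qed.

Lemma multidegree_multihomog e F : has_multidegree e F -> multihomog F.
Proof. by move=> h; exists e => mu /h. Qed.

Lemma block_vars_eval (P : 'M[K]_(n, 4)) a (p : {mpoly K[4]}) :
  (p \mPo block_vars a).@[fun l => mxvec P 0 l] = p.@[fun i => P a i].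
Proof.
rewrite comp_mpoly_meval; apply: meval_eq => i.
by rewrite tnth_mktuple mevalXU mxvecE.
Qed.

Lemma for_general_nonzero (F : {mpoly K[n * 4]}) (Q : 'M[K]_(n, 4) -> Prop) P0 :
    multihomog F -> multicoords P0 -> F.@[fun l => mxvec P0 0 l] != 0 ->
    (forall P, multicoords P -> F.@[fun l => mxvec P 0 l] != 0 -> Q P) ->
  for_general Q.
Proof.
move=> hF mP0 F0 FQ; exists (fun P => F.@[fun l => mxvec P 0 l] != 0); split=> //.
- exists (fun F' => F' = F); split=> [_ ->//|P _].
  by split=> [FP|[_ -> //]]; exists F.
- by exists P0.
Qed.

Lemma multicoords_torus (P : 'M[K]_(n, 4)) : (forall a i, P a i != 0) -> multicoords P.
Proof.
move=> P0 a; apply/negP => /eqP/rowP/(_ 0); rewrite !mxE => /eqP.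
by rewrite (negbTE (P0 _ _)).
Qed.

Lemma for_general_always (Q : 'M[K]_(n, 4) -> Prop) :
  (forall P, multicoords P -> Q P) -> for_general Q.
Proof.
move=> allQ; apply: (@for_general_nonzero 1 _ (const_mx 1)).
- exact: multidegree_multihomog multidegree1.
- by apply: multicoords_torus => a i; rewrite mxE oner_neq0.
- by rewrite meval1 oner_neq0.
by move=> P mP _; apply: allQ.
Qed.

Lemma mderivm_homog d (mu : 'X_{1..4}) (p : {mpoly K[4]}) :
  p \is d.-homog -> p^`M[mu] \is (d - mdeg mu).-homog.
Proof.
move=> /dhomogP hp; apply/dhomogP => m; rewrite mcoeff_msupp mcoeff_mderivm => c0.
have : (mu + m)%MM \in msupp p.
  by rewrite mcoeff_msupp; apply: contra c0 => /eqP ->; rewrite mul0rn.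
by move=> /hp /=; rewrite mdegD => <-; rewrite addKn.
Qed.

End Multihomogeneous.

Section General.

Variables (K : fieldType) (ms : seq nat).
Hypothesis charK : [pchar K] =i pred0.
Local Notation n := (size ms).
Local Notation mult := (@mult_at ms).

Definition generic_condition (x : 'I_n * seq nat) (s : seq nat) : {mpoly K[n * 4]} :=
  ('X_[mon s])^`M[mon x.2] \mPo block_vars K x.1.

Lemma generic_condition_eval (P : 'M[K]_(n, 4)) x s :
  (generic_condition x s).@[fun l => mxvec P 0 l] = monomial_condition P x s.
Proof. exact: block_vars_eval. Qed.

Lemma generic_condition_multidegree d x s : s \in simplex d ->
  has_multidegree (fun b => (d - mdeg (mon x.2)) * (b == x.1))%N (generic_condition x s).
Proof.
move=> sd; apply/multidegree_comp/mderivm_homog; rewrite dhomogX /=.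
by have [->] := simplex_mon sd.
Qed.

(** Its nonvanishing keeps the points off the plane X_0 = 0, so that powers of X_0 can be cancelled
    in conditions at these points. *)
Definition generic_coordinates : {mpoly K[n * 4]} := \prod_(a < n) 'X_(mxvec_index a 0).

Lemma generic_coordinates_eval (P : 'M[K]_(n, 4)) :
  generic_coordinates.@[fun l => mxvec P 0 l] = \prod_(a < n) P a 0.
Proof.
by rewrite rmorph_prod; apply: eq_bigr => a _; rewrite /= mevalXU mxvecE.
Qed.

Lemma for_general_minor (Q : 'M[K]_(n, 4) -> Prop) k e (M : 'M[{mpoly K[n * 4]}]_k)
    (P0 : 'M[K]_(n, 4)) :
    (forall i j, has_multidegree (e i) (M i j)) -> (forall a i, P0 a i != 0) ->
    \det (map_mx (meval (fun l => mxvec P0 0 l)) M) != 0 ->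
    (forall P : 'M[K]_(n, 4), multicoords P -> (forall a, P a 0 != 0) ->
       \det (map_mx (meval (fun l => mxvec P 0 l)) M) != 0 -> Q P) ->
  for_general Q.
Proof.
move=> eM P00 dM MQ; apply: (@for_general_nonzero _ _ (\det M * generic_coordinates) _ P0).
- apply: multidegree_multihomog; apply: multidegreeM; first exact: (multidegree_det eM).
  by apply: multidegree_prod => a _; apply: multidegree_var.
- exact: multicoords_torus.
- rewrite mevalM generic_coordinates_eval -det_map_mx mulf_neq0 //.
  by apply/prodf_neq0 => a _.
move=> P mP; rewrite mevalM generic_coordinates_eval -det_map_mx mulf_eq0 negb_or.
by case/andP=> dP /prodf_neq0 Pn0; apply: MQ => // a; apply: Pn0.
Qed.

(** One good configuration shows that a certain maximal minor is a nonzero polynomial in the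
    coordinates; its nonvanishing is the open condition. *)
Lemma for_general_realizable b d (Q : 'M[K]_(n, 4) -> Prop) :
    all (fun m => m <= d.+1)%N ms -> realizable K b (simplex d) ms ->
    (forall P : 'M[K]_(n, 4), multicoords P -> (forall a, P a 0 != 0) ->
       (if b then nonsingular mult P d else independent mult P d) -> Q P) ->
  for_general Q.
Proof.
move=> msd /(realizable_point_matrix charK msd)[P0 P00 g] indQ.
case: b g indQ => /indep_minor; rewrite ?simplex_uniq ?conditions_uniq.
  case=> // f fx; set B := \matrix_(i, j) _ => dn0 indQ.
  pose M := \matrix_(i, j) generic_condition (f i) (tnth (in_tuple (simplex d)) j).
  have ME (P : 'M[K]_(n, 4)) : map_mx (meval (fun l => mxvec P 0 l)) M =
      \matrix_(i, j) monomial_condition P (f i) (tnth (in_tuple (simplex d)) j).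
    by apply/matrixP => i j; rewrite !mxE generic_condition_eval.
  apply: (for_general_minor (M := M) _ P00).
  - move=> i j; rewrite mxE; apply: (@generic_condition_multidegree d); exact: mem_tnth.
  - by rewrite ME.
  move=> P mP Px; rewrite ME => dP; apply: indQ => //.
  exact: (minor_indep fx dP).
case=> // f fx; set B := \matrix_(i, j) _ => dn0 indQ.
(* The conditions index the rows, as [multidegree_det] wants a multidegree constant along rows;
   hence the transpose below. *)
pose M := \matrix_(j, i) generic_condition (tnth (in_tuple (conditions mult)) j) (f i).
have ME (P : 'M[K]_(n, 4)) : map_mx (meval (fun l => mxvec P 0 l)) M =
    (\matrix_(i, j) monomial_condition P (tnth (in_tuple (conditions mult)) j) (f i))^T.
  by apply/matrixP => i j; rewrite !mxE generic_condition_eval.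
apply: (for_general_minor (M := M) _ P00).
- by move=> i j; rewrite mxE; apply: (@generic_condition_multidegree d).
- by rewrite ME det_tr.
move=> P mP Px; rewrite ME det_tr => dP; apply: indQ => //.
exact: (minor_indep (e := fun s x => monomial_condition P x s) fx dP).
Qed.

End General.

(** * Cohomology of the ideal sheaf *)

Section Ideals.

Variable R : comNzRingType.
Implicit Types (I G : R -> Prop) (f g : R).

Lemma ideal_span_gen G f : G f -> ideal_span G f.
Proof.
by move=> Gf; exists 1%N, (fun=> 1), (fun=> f); split=> //; rewrite big_ord1 mul1r.
Qed.

Lemma ideal_span0 G : ideal_span G 0.
Proof.
exists 0%N, (fun=> 0), (fun=> 0); split; first by case.
by rewrite big_ord0.
Qed.

Lemma ideal_spanD G f g : ideal_span G f -> ideal_span G g -> ideal_span G (f + g).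
Proof.
move=> [n [c [h [hG ->]]]] [n' [c' [h' [hG' ->]]]].
exists (n + n')%N, (fun i => match split i with inl j => c j | inr j => c' j end),
  (fun i => match split i with inl j => h j | inr j => h' j end); split.
  by move=> i; case: (split i).
rewrite big_split_ord /=; congr (_ + _); apply: eq_bigr => i _.
  by rewrite (unsplitK (inl i)).
by rewrite (unsplitK (inr i)).
Qed.

Lemma ideal_spanMl G f g : ideal_span G f -> ideal_span G (g * f).
Proof.
move=> [n [c [h [hG ->]]]]; exists n, (fun i => g * c i), h; split=> //.
by rewrite mulr_sumr; apply: eq_bigr => i _; rewrite mulrA.
Qed.

Lemma ideal_span_sum G (J : Type) (r : seq J) (P : pred J) (F : J -> R) :
  (forall j, P j -> ideal_span G (F j)) -> ideal_span G (\sum_(j <- r | P j) F j).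
Proof.
by move=> GF; elim/big_ind: _ => //; [apply: ideal_span0 | apply: ideal_spanD].
Qed.

Lemma ideal_pow0 I f : ideal_pow I 0 f.
Proof.
rewrite -[f]mulr1; apply/ideal_spanMl/ideal_span_gen.
by exists (fun=> 0); [case | rewrite big_ord0].
Qed.

Lemma ideal_powS I m y f : I y -> ideal_pow I m f -> ideal_pow I m.+1 (y * f).
Proof.
move=> Iy [n [c [h [hI ->]]]]; rewrite mulr_sumr; apply: ideal_span_sum => i _.
rewrite mulrCA; apply/ideal_spanMl/ideal_span_gen; have [g gI ->] := hI i.
exists (fun j => if unlift ord0 j is Some k then g k else y).
  by move=> j; case: unliftP.
rewrite big_ord_recl unlift_none; congr (_ * _).
by apply: eq_bigr => j _; rewrite liftK.
Qed.

End Ideals.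

Section PointIdeal.

Variable K : fieldType.
Implicit Types (f g : {mpoly K[4]}) (v : 'I_4 -> K).

Lemma eq_vanish m v v' f : v =1 v' -> vanish m v f -> vanish m v' f.
Proof.
move=> vv; elim: m f => //= m IH f [f0 fd]; split=> [|j]; last exact/IH/fd.
by rewrite -(meval_eq _ vv).
Qed.

Lemma ideal_pow_vanish m (v : 'rV[K]_4) f :
  ideal_pow (point_ideal v) m f -> vanish m (fun i => v 0 i) f.
Proof.
move=> [n [c [g [gI ->]]]]; apply: vanish_sum => i _; apply: vanishMl.
have [h hI ->] := gI i; elim: m h hI {gI} => // m IH h hI.
rewrite big_ord_recl; apply: (vanishM (a := 1) (b := m)); last by apply: IH => j; apply: hI.
have [n' [c' [g' [g'I ->]]]] := hI ord0.
apply: vanish_sum => j _; apply: vanishMl; split=> //; exact: (g'I j).2.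
Qed.

Definition directional v f := \sum_j v j *: f^`M(j).

Hypothesis charK : [pchar K] =i pred0.

(** By Euler's formula the derivative in the direction of v is, at v itself, a multiple of the
    value. Differentiating towards v therefore does not lower the order of vanishing. *)
Lemma directional_vanish d m v f : f \is d.-homog ->
  vanish m v f -> vanish m v (directional v f).
Proof.
elim: m d f => // m IH d f hf [f0 fd]; split=> [|i].
  rewrite raddf_sum /=; under eq_bigr => j _ do rewrite mevalZ.
  by rewrite (euler_eval v hf) f0 mulr0.
have -> : (directional v f)^`M(i) = directional v f^`M(i).
  by rewrite raddf_sum /=; apply: eq_bigr => j _; rewrite mderivZ mderiv_comm.
exact: IH (mderiv_homog i hf) (fd i).
Qed.

Lemma directional_homog d v f : f \is d.-homog -> directional v f \is d.-1.-homog.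
Proof. by move=> hf; apply: rpred_sum => j _; apply: rpredZ; apply: mderiv_homog. Qed.

(** Induction on the degree. Euler's formula writes f through products y_j d_j f, with linear forms
    y_j vanishing at v and d_j f of vanishing order one less, plus a multiple of the derivative of f
    towards v, which keeps the order and has smaller degree. *)
Lemma vanish_ideal_pow d m (v : 'rV[K]_4) f : v != 0 -> f \is d.-homog ->
  vanish m (fun i => v 0 i) f -> ideal_pow (point_ideal v) m f.
Proof.
move=> v0; have [k vk] : exists k, v 0 k != 0.
  apply/existsP; rewrite -negb_forall; apply: contra v0 => /forallP v0.
  by apply/eqP/rowP => i; rewrite mxE; apply/eqP.
elim: d m f => [|d IH] [|m] f hf vf; first exact: ideal_pow0.
- by rewrite (homog0_vanish hf vf); apply: ideal_span0.
- exact: ideal_pow0.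
(* The linear forms y_j differ from X_j by the multiple of X_k that makes them vanish at v; these
   multiples add up to the directional term in [fE]. *)
pose y j : {mpoly K[4]} := 'X_j - (v 0 j / v 0 k) *: 'X_k.
have fE : f = (d.+1%:R^-1)%:MP * (\sum_j y j * f^`M(j) +
    ((v 0 k)^-1 *: 'X_k) * directional (fun i => v 0 i) f).
  have d0 : d.+1%:R != 0 :> K by apply: (natr_pchar0_neq0 charK).
  have -> : \sum_j y j * f^`M(j) + ((v 0 k)^-1 *: 'X_k) * directional (fun i => v 0 i) f
      = \sum_j 'X_j * f^`M(j).
    rewrite /directional mulr_sumr -big_split /=; apply: eq_bigr => j _.
    rewrite mulrBl -[RHS]addr0 -addrA; congr (_ + _).
    by rewrite -!scalerAl -!scalerAr scalerA [_ * v 0 j]mulrC addNr.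
  by rewrite (euler hf) mul_mpolyC scalerA mulVf // scale1r.
rewrite fE; apply: ideal_spanMl; apply: ideal_spanD.
  apply: ideal_span_sum => j _; apply: ideal_powS.
    apply: ideal_span_gen; split.
      exists 1%N; apply: rpredB; last apply: rpredZ; by rewrite dhomogX /= mdeg1.
    by rewrite mevalB mevalZ !mevalXU divfK // subrr.
  by apply: IH; [apply: (mderiv_homog j hf) | apply: vf.2].
apply: ideal_spanMl; apply: IH; first exact: (directional_homog _ hf).
exact: directional_vanish hf vf.
Qed.

Lemma fat_ideal_vanish (ms : seq nat) (P : 'M[K]_(size ms, 4)) f :
  fat_ideal P f -> vanish_all (@mult_at ms) P f.
Proof.
move=> fI a; apply: eq_vanish (ideal_pow_vanish (fI a)) => i.
by rewrite mxE.
Qed.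

Lemma vanish_fat_ideal d (ms : seq nat) (P : 'M[K]_(size ms, 4)) f : multicoords P ->
  f \is d.-homog -> vanish_all (@mult_at ms) P f -> fat_ideal P f.
Proof.
move=> mP hf vf a; apply: vanish_ideal_pow (mP a) hf _.
by apply: eq_vanish (vf a) => i; rewrite mxE.
Qed.

End PointIdeal.

(** * Division by powers of a variable *)

Section MonomialDivision.

Variables (K : fieldType) (n : nat).
Implicit Types (f g : {mpoly K[n]}) (k m : 'X_{1..n}).

Lemma mcoeffXM k g m : ('X_[k] * g)@_m = if (k <= m)%MM then g@_(m - k) else 0.
Proof.
case: ifP => [le|nle]; first by rewrite -{1}(submK le) addmC mulrC mcoeffMX.
apply: memN_msupp_eq0; apply/negP => /msuppM_le/allpairsP[[m1 m2] /= []].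
by rewrite msuppX inE => /eqP -> _ E; rewrite E lem_addr in nle.
Qed.

Lemma mdivX k f : (forall m, f@_m != 0 -> (k <= m)%MM) -> exists g, f = 'X_[k] * g.
Proof.
move=> kf; exists (\sum_(m <- msupp f) f@_m *: 'X_[m - k]).
rewrite {1}[f]mpolyE mulr_sumr; apply: eq_big_seq => m mf.
by rewrite -scalerAr -mpolyXD addmC submK // kf // -mcoeff_msupp.
Qed.

Lemma homog_divX k d g : 'X_[k] * g \is (d + mdeg k).-homog -> g \is d.-homog.
Proof.
move=> /dhomogP hg; apply/dhomogP => m; rewrite mcoeff_msupp => gm.
have : (k + m)%MM \in msupp ('X_[k] * g).
  by rewrite mcoeff_msupp mcoeffXM lem_addr addmC addmK.
by move=> /hg /=; rewrite mdegD addnC => /addIn.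
Qed.

Lemma varX (i : 'I_n) N : 'X_i ^+ N = 'X_[U_(i) *+ N] :> {mpoly K[n]}.
Proof. by rewrite mpolyXn. Qed.

Lemma lem_var (i : 'I_n) N m : (U_(i) *+ N <= m)%MM = (N <= m i)%N.
Proof.
apply/mnm_lepP/idP => [/(_ i)|le j]; first by rewrite mulmnE mnm1E eqxx mul1n.
by rewrite mulmnE mnm1E; case: eqP => [<-|_]; rewrite ?mul1n.
Qed.

Lemma varX_homog (i : 'I_n) N : 'X_i ^+ N \is [in K[n], N.-homog].
Proof. by rewrite varX dhomogX /= mdegMn mdeg1 mul1n. Qed.

Lemma varX_neq0 (i : 'I_n) N : 'X_i ^+ N != 0 :> {mpoly K[n]}.
Proof. by rewrite -msize_poly_eq0 varX msizeX. Qed.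

Lemma homog_varM (i : 'I_n) N d g : 'X_i ^+ N * g \is (d + N).-homog -> g \is d.-homog.
Proof. by rewrite varX -{2}[N]mul1n -(mdeg1 i) -mdegMn => /homog_divX. Qed.

Lemma varM_homog (i : 'I_n) N d g : g \is d.-homog -> 'X_i ^+ N * g \is (d + N).-homog.
Proof. by move=> hg; rewrite addnC; apply: dhomogM => //; apply: varX_homog. Qed.

Lemma var_divides (i j : 'I_n) N N' f g : i != j ->
  'X_j ^+ N * f = 'X_i ^+ N' * g -> exists h, f = 'X_i ^+ N' * h.
Proof.
move=> ij E; rewrite varX; apply: mdivX => m fm; rewrite lem_var leqNgt.
apply: contra fm => lt; have := congr1 (mcoeff (U_(j) *+ N + m)%MM) E.
rewrite !varX !mcoeffXM lem_addr addmC addmK lem_var mnmDE mulmnE mnm1E.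
by rewrite eq_sym (negbTE ij) addn0 leqNgt lt => ->.
Qed.

Definition low_part (i : 'I_n) N f := \sum_(m <- msupp f | (m i < N)%N) f@_m *: 'X_[m].

Lemma mcoeff_low_part i N f m : (low_part i N f)@_m = if (m i < N)%N then f@_m else 0.
Proof.
rewrite raddf_sum /=; under eq_bigr => k _ do rewrite mcoeffZ mcoeffX.
case: (boolP (m \in msupp f)) => mf; last first.
  rewrite (memN_msupp_eq0 mf) if_same big_seq_cond big1 // => k /andP[kf _].
  by case: eqP => [E|]; [rewrite -E kf in mf | rewrite mulr0].
case: ifP => mi.
  rewrite big_mkcond (bigD1_seq m) ?msupp_uniq //= mi eqxx mulr1 big1 ?addr0 // => k km.
  by rewrite (negbTE km) mulr0 if_same.
rewrite big1 // => k ki; case: eqP => [E|]; last by rewrite mulr0.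
by rewrite -E ki in mi.
Qed.

Lemma low_part_split i N f : exists g, f = low_part i N f + 'X_i ^+ N * g.
Proof.
have [|g fE] := @mdivX (U_(i) *+ N) (f - low_part i N f).
  move=> m; rewrite mcoeffB mcoeff_low_part lem_var.
  by case: ltnP => // _; rewrite subrr eqxx.
by exists g; rewrite varX -fE addrC subrK.
Qed.

Lemma low_part_homog i N d f : f \is d.-homog -> low_part i N f \is d.-homog.
Proof.
move=> /dhomogP hf; apply/dhomogP => m; rewrite mcoeff_msupp mcoeff_low_part.
by case: ifP => _; rewrite ?eqxx // -mcoeff_msupp => /hf.
Qed.

(** Modulo X_i^N the right-hand side is 0, and multiplying by powers of the other variables does not
    change the exponent of X_i. *)
Lemma low_part_cross (i j k : 'I_n) N f g h : j != i -> k != i ->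
    'X_j ^+ N * f - 'X_k ^+ N * g = 'X_i ^+ N * h ->
  'X_j ^+ N * low_part i N f = 'X_k ^+ N * low_part i N g.
Proof.
move=> ji ki E; apply/mpolyP => m; rewrite !varX !mcoeffXM !mcoeff_low_part.
rewrite !mnmBE !mulmnE !mnm1E (negbTE ji) (negbTE ki) !subn0.
case: ltnP => mi; last by rewrite !if_same.
have := congr1 (mcoeff m) E; rewrite mcoeffB !varX !mcoeffXM.
rewrite [in RHS]lem_var leqNgt mi => /eqP; rewrite subr_eq0 => /eqP //.
Qed.

End MonomialDivision.

Section Fractions.

Variable K : fieldType.
Local Notation R := {mpoly K[4]}.
Local Notation "f %:F" := (tofrac (f : R)).
Implicit Types (f g : R) (u : {fraction R}).

Lemma var_frac_neq0 (i : 'I_4) N : ('X_i ^+ N)%:F != 0.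
Proof. by rewrite tofrac_eq0 varX_neq0. Qed.

Lemma twisted_varP (I : R -> Prop) d (i : 'I_4) u : twisted_section I d 'X_i u ->
  exists N f, [/\ f \is (d + N).-homog, I f & u * ('X_i ^+ N)%:F = f%:F].
Proof.
move=> [N [e [f [he hf If ->]]]]; exists N, f; split=> //.
  by rewrite (dhomog_uniq (varX_neq0 _ i N) (varX_homog _ i N) he).
by rewrite divfK // var_frac_neq0.
Qed.

Lemma twisted_var2P (I : R -> Prop) d (i j : 'I_4) u : twisted_section I d ('X_i * 'X_j) u ->
  exists N f, [/\ f \is (d + (N + N)).-homog, I f & u * ('X_i ^+ N * 'X_j ^+ N)%:F = f%:F].
Proof.
move=> [N [e [f [he hf If ->]]]]; exists N, f; rewrite exprMn in he *.
have n0 : 'X_i ^+ N * 'X_j ^+ N != 0 :> R by rewrite mulf_neq0 ?varX_neq0.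
split=> //; last by rewrite divfK // tofrac_eq0.
have hN := dhomogM (varX_homog K i N) (varX_homog K j N).
by rewrite (dhomog_uniq n0 hN he).
Qed.

Lemma twisted_var (I : R -> Prop) d (i : 'I_4) N f u : f \is (d + N).-homog -> I f ->
  u * ('X_i ^+ N)%:F = f%:F -> twisted_section I d 'X_i u.
Proof.
move=> hf If E; exists N, N, f; split=> //; first exact: varX_homog.
by rewrite -E mulfK // var_frac_neq0.
Qed.

Lemma twisted_var2 (I : R -> Prop) d (i j : 'I_4) N f u :
  f \is (d + (N + N)).-homog -> I f ->
  u * ('X_i ^+ N * 'X_j ^+ N)%:F = f%:F -> twisted_section I d ('X_i * 'X_j) u.
Proof.
move=> hf If E; exists N, (N + N)%N, f; rewrite exprMn; split=> //.
  by apply: dhomogM; apply: varX_homog.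
by rewrite -E mulfK // tofrac_eq0 mulf_neq0 ?varX_neq0.
Qed.

(** A fraction with a power of X_0 and also a power of X_1 as denominator is a polynomial, the two
    variables being coprime. *)
Lemma global_form d N N' f f' u : f \is (d + N).-homog ->
    u * ('X_0 ^+ N)%:F = f%:F -> u * ('X_1 ^+ N')%:F = f'%:F ->
  exists2 g, g \is d.-homog & u = g%:F.
Proof.
move=> hf E E'; have [|g fE] := @var_divides K 4 0 1 N' N f f' isT.
  by apply/eqP; rewrite -tofrac_eq !tofracM -E -E' mulrCA; apply/eqP; ring.
exists g; first by apply: (@homog_varM _ _ 0 N); rewrite -fE.
by apply: (mulIf (var_frac_neq0 0 N)); rewrite E fE tofracM mulrC.
Qed.

End Fractions.

(** The dual reading of independence: independent functionals take arbitrary prescribed values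
    simultaneously. *)
Lemma indep_solve (K : fieldType) (X Y : eqType) (e : X -> Y -> K) xs ys (b : Y -> K) :
    uniq xs -> uniq ys -> indep e xs ys ->
  exists c : X -> K, forall y, y \in ys -> \sum_(x <- xs) c x * e x y = b y.
Proof.
move=> uxs uys /(indep_minor uys)[f fxs dn0]; set B := \matrix_(i, j) _ in dn0.
have uB : B \in unitmx by rewrite unitmxE unitfE.
pose u := (\row_j b (tnth (in_tuple ys) j)) *m invmx B.
exists (fun x => \sum_(i | f i == x) u 0 i) => y ysy.
have ylt : (index y ys < size ys)%N by rewrite index_mem.
have := congr1 (fun w : 'rV_(size ys) => w 0 (Ordinal ylt)) (mulmxKV uB (\row_j b (tnth
  (in_tuple ys) j))).
rewrite -/u !mxE (tnth_nth y) /= nth_index // => <-.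
under eq_bigr => x _ do rewrite mulr_suml.
rewrite (exchange_big_dep xpredT) //=; apply: eq_bigr => i _.
rewrite big_mkcond (bigD1_seq (f i)) //= eqxx big1 ?addr0 => [|x xf].
  by rewrite ?mxE ?(tnth_nth y) /= ?nth_index.
by rewrite eq_sym (negbTE xf).
Qed.

Section CommonDenominators.

Variables (F : fieldType) (a b s x y : F).
Hypotheses (x0 : x != 0) (y0 : y != 0).

Lemma subf_common : (a / x - b / y) * (y * x) = y * a - x * b.
Proof. by field; rewrite x0 y0. Qed.

Lemma subf_clear : (a / x - s) * (x * y) = y * a - x * (s * y).
Proof. by field. Qed.

Lemma subf_defect : y * (a - x * (a / x - s)) = x * (s * y).
Proof. by field. Qed.

End CommonDenominators.

(** * Cech cochains and the conditions at the points *)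

Section Cohomology.

Variables (K : fieldType) (ms : seq nat) (P : 'M[K]_(size ms, 4)).
Hypothesis charK : [pchar K] =i pred0.
Hypothesis mP : multicoords P.
Local Notation R := {mpoly K[4]}.
Local Notation "f %:F" := (tofrac (f : R)).
Local Notation mult := (@mult_at ms).
Local Notation VI := (vanish_all mult P).
Local Notation I := (fat_ideal P).
Implicit Types (f g S : R).

Lemma H0_nonvanishing d f : f \is d.-homog -> f != 0 -> VI f -> ~ H0_vanishes I d.
Proof.
move=> hf f0 vf H0; case/eqP: f0; apply/eqP; rewrite -tofrac_eq0; apply/eqP/H0 => i.
apply: (twisted_var (N := 0) (f := f)); rewrite ?addn0 ?expr0 ?tofrac1 ?mulr1 //.
exact: (vanish_fat_ideal charK mP hf vf).
Qed.

Hypothesis P0 : forall a, P a 0 != 0.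

(** A global section is a form g; some X_0^N g lies in the ideal, and X_0 is nonzero at every point,
    so g itself satisfies the conditions. *)
Lemma H0_of_nonsingular d : (forall a, mult a <= d.+1)%N -> nonsingular mult P d ->
  H0_vanishes I d.
Proof.
move=> md ns s hs; have [N [f [hf If E]]] := twisted_varP (hs 0).
have [N' [f' [_ _ E']]] := twisted_varP (hs 1).
have [g hg sg] := global_form hf E E'; rewrite sg; apply/eqP; rewrite tofrac_eq0.
apply/eqP; apply: (nonsingular_eq0 charK md ns hg).
apply: (vanish_all_cancel (k := N) P0); have := fat_ideal_vanish If.
by congr (VI _); apply/eqP; rewrite -tofrac_eq -E sg tofracM mulrC.
Qed.

(** At points off the plane X_0 = 0 the products X_0^N g satisfy the conditions exactly when g does;
    equal kernels and equal numbers of conditions give equal ranks. *)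
Lemma independent_shift d N : (forall a, mult a <= d.+1)%N -> independent mult P d ->
  indep (fun s x => condition P x ('X_0 ^+ N * 'X_[mon s])) (simplex d) (conditions mult).
Proof.
move=> md; apply: indep_same_kernel; rewrite ?conditions_uniq ?simplex_uniq //.
move=> c c0 x xc; rewrite condition_form.
apply: ((conditions_vanish charK P md (form_homog d c)).2 _ x xc).
apply: (vanish_all_cancel (k := N) P0).
have md' a : (mult a <= (d + N).+1)%N by apply: leq_trans (md a) _; lia.
apply/(conditions_vanish charK P md' (varM_homog 0 N (form_homog d c))) => y yc.
rewrite -[RHS](c0 y yc) -condition_sum mulr_sumr.
by congr condition; apply: eq_bigr => s _; rewrite scalerAr.
Qed.

(** The multiples of X_0^N alone already attain every value on the fat points. *)
Lemma interpolate d N S : (forall a, mult a <= d.+1)%N -> independent mult P d ->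
  S \is (d + N).-homog -> exists2 g, g \is d.-homog & VI (S - 'X_0 ^+ N * g).
Proof.
move=> md /(independent_shift (N := N) md) ind hS.
have [||c cS] := indep_solve (fun x => condition P x S) _ _ ind.
- exact: simplex_uniq.
- exact: conditions_uniq.
have hg := form_homog d c; exists (form d c) => //.
have md' a : (mult a <= (d + N).+1)%N by apply: leq_trans (md a) _; lia.
have hSg : S - 'X_0 ^+ N * form d c \is (d + N).-homog.
  by apply: rpredB => //; apply: varM_homog.
apply/(conditions_vanish charK P md' hSg) => x xc.
have := cS x xc; rewrite -condition_sum => cx.
rewrite conditionB -cx -/(form d c); have -> : 'X_0 ^+ N * form d c =
    \sum_(s <- simplex d) c s *: ('X_0 ^+ N * 'X_[mon s]).
  by rewrite mulr_sumr; apply: eq_bigr => s _; rewrite scalerAr.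
by rewrite subrr.
Qed.

Lemma common_denominator d (t : 'I_4 -> 'I_4 -> {fraction R}) :
    (forall i j, twisted_section I d ('X_i * 'X_j) (t i j)) ->
  exists N F, forall i j, [/\ F i j \is (d + N + N).-homog, VI (F i j)
    & t i j * ('X_i ^+ N * 'X_j ^+ N)%:F = (F i j)%:F].
Proof.
move=> ht; have ex (ij : 'I_4 * 'I_4) : exists Nf : nat * R,
    [/\ Nf.2 \is (d + (Nf.1 + Nf.1)).-homog, I Nf.2
      & t ij.1 ij.2 * ('X_(ij.1) ^+ Nf.1 * 'X_(ij.2) ^+ Nf.1)%:F = Nf.2%:F].
  by have [N [f hf]] := twisted_var2P (ht ij.1 ij.2); exists (N, f).
have [F hF] := fin_all_exists ex; pose N := (\max_ij (F ij).1)%N.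
exists N, (fun i j => let k := (N - (F (i, j)).1)%N in
  'X_i ^+ k * 'X_j ^+ k * (F (i, j)).2) => i j.
have [hf If E] := hF (i, j); set n := (F (i, j)).1 in hf E *.
have nN : (n <= N)%N by apply: (leq_bigmax (i, j)).
split=> /=.
- have -> : (d + N + N = (N - n + (N - n)) + (d + (n + n)))%N by lia.
  by apply: dhomogM => //; apply: dhomogM; apply: varX_homog.
- exact/vanish_allMl/fat_ideal_vanish.
rewrite -{1 2}(subnK nN) !exprD [RHS]tofracM -E [RHS]mulrCA -tofracM.
by congr (_ * _%:F); ring.
Qed.

(** The cocycle is first written as a coboundary with values in O(d), which is the vanishing of
    H^1(O(d)) made explicit. Independence then provides a form of degree d whose subtraction carries
    the cochain into the ideal sheaf. *)
Lemma H1_of_independent d : (forall a, mult a <= d.+1)%N -> independent mult P d ->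
  H1_vanishes I d.
Proof.
move=> md ind t ht cyc; have [N [F hF]] := common_denominator ht.
have t00 : t 0 0 = 0 by apply: (addrI (t 0 0)); rewrite addr0 -cyc.
have cross j k : 'X_j ^+ N * F 0 k - 'X_k ^+ N * F 0 j = 'X_0 ^+ N * F j k.
  have [_ _ Ek] := hF 0 k; have [_ _ Ej] := hF 0 j; have [_ _ Ejk] := hF j k.
  apply/eqP; rewrite -tofrac_eq tofracB !tofracM -Ek -Ej -Ejk !tofracM (cyc 0 j k).
  by apply/eqP; ring.
have [B FB] := fin_all_exists (fun j => low_part_split 0 N (F 0 j)).
pose A j := low_part 0 N (F 0 j).
have crossA j k : j != 0 -> k != 0 -> 'X_j ^+ N * A k = 'X_k ^+ N * A j.
  by move=> j0 k0; apply: low_part_cross j0 k0 (cross j k).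
(* X_2^N A_1 = X_1^N A_2, and X_1, X_2 are coprime. *)
have [C AC] : exists C, A 1 = 'X_1 ^+ N * C.
  by apply: (var_divides (j := inord 2) (N := N) (g := A (inord 2))) (crossA _ _ _ _);
    rewrite // -val_eqE /= inordK.
have AjC j : j != 0 -> A j = 'X_j ^+ N * C.
  move=> j0; apply: (mulfI (varX_neq0 K (1 : 'I_4) N)).
  by rewrite (crossA 1 j) // AC mulrCA.
have hF0 j : F 0 j \is (d + N + N).-homog by case: (hF 0 j).
have hC : C \is (d + N).-homog.
  by apply: (@homog_varM _ _ 1 N); rewrite -AC; apply: (low_part_homog 0 N (hF0 1)).
have hB j : B j \is (d + N).-homog.
  apply: (@homog_varM _ _ 0 N).
  have -> : 'X_0 ^+ N * B j = F 0 j - A j by rewrite [in RHS]FB addrC addKr.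
  by apply: rpredB; [exact: hF0 | exact: (low_part_homog 0 N (hF0 j))].
(* As F_0j = X_0^N B_j + X_j^N C, the cocycle is the coboundary of the cochain S_j / X_j^N. *)
pose S j := if j == 0 then - C else B j.
have hS j : S j \is (d + N).-homog by rewrite /S; case: ifP => _ //; rewrite rpredN.
have FS j : j != 0 -> F 0 j = 'X_0 ^+ N * S j - 'X_j ^+ N * S 0.
  move=> j0; rewrite /S eqxx (negbTE j0) mulrN opprK addrC -AjC //; exact: FB.
have vS j : VI ('X_0 ^+ N * S j - 'X_j ^+ N * S 0).
  case: (eqVneq j 0) => [->|j0]; first by rewrite subrr => a; apply: vanish0.
  by rewrite -FS //; case: (hF 0 j).
(* Subtracting g moves the component of index 0 into the ideal; [vS] then does the same for the
   others. *)
have [g hg vg] := interpolate md ind (hS 0).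
pose s j := (S j)%:F / ('X_j ^+ N)%:F - g%:F.
have X0 j : ('X_j ^+ N : R)%:F != 0 by apply: var_frac_neq0.
have t0 j : t 0 j = s j - s 0.
  case: (eqVneq j 0) => [->|j0]; first by rewrite subrr.
  have [_ _ E] := hF 0 j; apply: (mulIf (X0 0)); apply: (mulIf (X0 j)).
  rewrite -mulrA -tofracM E (FS _ j0) tofracB !tofracM.
  have -> : s j - s 0 = (S j)%:F / ('X_j ^+ N)%:F - (S 0)%:F / ('X_0 ^+ N)%:F.
    by rewrite /s opprB addrA addrNK.
  by rewrite -[RHS]mulrA subf_common.
exists s; split=> [i|i j]; last first.
  rewrite -[t i j](addKr (t 0 i)) -cyc !t0; ring.
have hSg : S i - 'X_i ^+ N * g \is (d + N).-homog.
  by apply: rpredB; [exact: hS | exact: varM_homog].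
apply: (twisted_var hSg).
  apply: (vanish_fat_ideal charK mP hSg).
  apply: (vanish_all_cancel (k := N) P0).
  have -> : 'X_0 ^+ N * (S i - 'X_i ^+ N * g) =
      ('X_0 ^+ N * S i - 'X_i ^+ N * S 0) + 'X_i ^+ N * (S 0 - 'X_0 ^+ N * g) by ring.
  by apply: vanish_allD => //; apply: vanish_allMl.
by rewrite /s tofracB tofracM mulrBl divfK // [_ * g%:F]mulrC.
Qed.

(* Independence in a larger degree, which holds for general points, lets one *)
(* extend any form [S] to a Cech cochain whose coboundary lies in the ideal. *)
Lemma independent_of_H1 d M : (forall a, mult a <= d.+1)%N ->
  independent mult P (d + M) -> H1_vanishes I d -> independent mult P d.
Proof.
move=> md ind H1.
have mdM a : (mult a <= (d + M).+1)%N by apply: leq_trans (md a) _; lia.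
have lift_form S : S \is (d + M).-homog ->
    exists2 g, g \is d.-homog & VI (S - 'X_0 ^+ M * g).
  (* On the fat points T_j / X_j^M agrees with S / X_0^M, so the differences of these fractions form
     a cocycle with values in the ideal sheaf. *)
  move=> hS; have ex j : exists T, T \is (d + M).-homog /\
      VI ('X_j ^+ M * S - 'X_0 ^+ M * T).
    have [|T hT vT] := @interpolate (d + M) M ('X_j ^+ M * S) mdM ind.
      exact: varM_homog.
    by exists T.
  have [T hT] := fin_all_exists ex.
  pose t i j := (T j)%:F / ('X_j ^+ M)%:F - (T i)%:F / ('X_i ^+ M)%:F.
  have X0 j : ('X_j ^+ M : R)%:F != 0 by apply: var_frac_neq0.
  have ht i j : twisted_section I d ('X_i * 'X_j) (t i j).
    have hG : 'X_i ^+ M * T j - 'X_j ^+ M * T i \is (d + (M + M)).-homog.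
      by rewrite addnA; apply: rpredB; apply: varM_homog; apply: (hT _).1.
    apply: (twisted_var2 hG).
      apply: (vanish_fat_ideal charK mP hG); apply: (vanish_all_cancel (k := M) P0).
      have -> : 'X_0 ^+ M * ('X_i ^+ M * T j - 'X_j ^+ M * T i) =
          'X_j ^+ M * ('X_i ^+ M * S - 'X_0 ^+ M * T i) -
          'X_i ^+ M * ('X_j ^+ M * S - 'X_0 ^+ M * T j) by ring.
      by apply: vanish_allB; apply: vanish_allMl; apply: (hT _).2.
    by rewrite /t tofracB !tofracM subf_common.
  have [|s [hs ts]] := H1 t ht; first by move=> i j k; rewrite /t; ring.
  (* After correction by [s] the local sections coincide, so [u] is a global form of degree d. *)
  pose u := (T 0)%:F / ('X_0 ^+ M)%:F - s 0.
  have uE i : u = (T i)%:F / ('X_i ^+ M)%:F - s i.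
    have /eqP := ts 0 i; rewrite /t -subr_eq0 => /eqP E; apply/eqP.
    by rewrite -subr_eq0 /u -oppr_eq0 -E; apply/eqP; ring.
  have ui i : exists Nf : nat * R, [/\ Nf.2 \is (d + Nf.1).-homog
      & u * ('X_i ^+ Nf.1)%:F = Nf.2%:F].
    have [N [f [hf If E]]] := twisted_varP (hs i).
    exists ((M + N)%N, 'X_i ^+ N * T i - 'X_i ^+ M * f); split=> /=.
      apply: rpredB; last by rewrite (addnC M) addnA; apply: varM_homog.
      by rewrite addnA; apply: varM_homog; apply: (hT _).1.
    by rewrite (uE i) exprD tofracB !tofracM -E subf_clear.
  have [[N f] /= [hf Ef]] := ui 0; have [[N' f'] /= [_ Ef']] := ui 1.
  have [g hg ug] := global_form hf Ef Ef'; exists g => //.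
  have [n0 [f0 [hf0 If0 E0]]] := twisted_varP (hs 0).
  have v1 : VI (T 0 - 'X_0 ^+ M * g).
    apply: (vanish_all_cancel (k := n0) P0).
    have -> : 'X_0 ^+ n0 * (T 0 - 'X_0 ^+ M * g) = 'X_0 ^+ M * f0.
      apply/eqP; rewrite -tofrac_eq tofracM tofracB !tofracM -ug -E0 /u.
      by rewrite subf_defect.
    exact/vanish_allMl/fat_ideal_vanish.
  have v2 : VI (S - T 0).
    by apply: (vanish_all_cancel (k := M) P0); rewrite mulrBr; apply: (hT 0).2.
  have -> : S - 'X_0 ^+ M * g = (S - T 0) + (T 0 - 'X_0 ^+ M * g) by ring.
  exact: vanish_allD.
pose e s x := condition P x ('X_0 ^+ M * 'X_[mon s]).
have eE c x : \sum_(s <- simplex d) c s * e s x = condition P x ('X_0 ^+ M * form d c).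
  rewrite -condition_sum mulr_sumr; congr condition.
  by apply: eq_bigr => s _; rewrite scalerAr.
(* Each monomial of degree d + M has the same values under the conditions as some X_0^M g, so a
   linear relation holding on all these products holds in degree d + M. *)
have inde : indep e (simplex d) (conditions mult).
  move=> c c0; apply: ind => s sM.
  have hX : 'X_[mon s] \is [in K[4], (d + M).-homog].
    by rewrite dhomogX /=; have [->] := simplex_mon sM.
  have [g hg vg] := lift_form _ hX.
  have hSg : 'X_[mon s] - 'X_0 ^+ M * g \is (d + M).-homog.
    by apply: rpredB; [exact: hX | exact: varM_homog].
  have cond x : x \in conditions mult ->
      monomial_condition P x s = \sum_(r <- simplex d) g@_(mon r) * e r x.
    move=> xc; rewrite eE -formE //; apply/eqP; rewrite -subr_eq0 -conditionB.
    by apply/eqP; apply: ((conditions_vanish charK P mdM hSg).2 vg).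
  under eq_big_seq => x xc do rewrite cond // mulr_sumr.
  rewrite exchange_big big_seq big1 //= => r rd.
  transitivity (g@_(mon r) * (\sum_(x <- conditions mult) c x * e r x)).
    by rewrite mulr_sumr; apply: eq_bigr => x _; rewrite mulrCA.
  by rewrite c0 ?mulr0.
apply: indep_same_kernel inde; rewrite ?conditions_uniq ?simplex_uniq // => c c0 x xc.
rewrite eE; have hX := varM_homog 0 M (form_homog d c).
apply: ((conditions_vanish charK P mdM hX).2 _ x xc); apply: vanish_allMl.
apply/(conditions_vanish charK P md (form_homog d c)) => y yc.
by rewrite -condition_form c0.
Qed.

End Cohomology.

Lemma underdetermined (K : fieldType) (X Y : eqType) (e : X -> Y -> K) xs ys :
    uniq ys -> (size xs < size ys)%N ->
  exists c : Y -> K, (exists2 y, y \in ys & c y != 0) /\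
    forall x, x \in xs -> \sum_(y <- ys) c y * e x y = 0.
Proof.
move=> uys lt; pose A := \matrix_(j < size ys, i < size xs)
  e (tnth (in_tuple xs) i) (tnth (in_tuple ys) j).
have : kermx A != 0.
  rewrite -mxrank_eq0 mxrank_ker subn_eq0 -ltnNge.
  exact: leq_ltn_trans (rank_leq_col A) lt.
case/rowV0Pn => v /sub_kermxP vA v0.
pose c y := if insub (index y ys) is Some j then v 0 j else 0.
have cE (j : 'I_(size ys)) : c (tnth (in_tuple ys) j) = v 0 j.
  rewrite /c (tnth_nth (tnth (in_tuple ys) j)) /= index_uniq //.
  by rewrite valK.
exists c; split.
  have [j vj] : exists j, v 0 j != 0.
    apply/existsP; rewrite -negb_forall; apply: contra v0 => /forallP v0.
    by apply/eqP/rowP => j; rewrite mxE; apply/eqP.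
  by exists (tnth (in_tuple ys) j); rewrite ?mem_tnth ?cE.
move=> x xsx; have xlt : (index x xs < size xs)%N by rewrite index_mem.
have /rowP/(_ (Ordinal xlt)) := vA; rewrite !mxE => vx.
rewrite -[RHS]vx [LHS]big_tnth; apply: eq_bigr => j _; rewrite !mxE cE.
by rewrite (tnth_nth x) /= nth_index.
Qed.

Lemma size_simplex d : size (simplex d) = 'C(d + 3, 3).
Proof. by rewrite size_map size_low_exponents addSnnS. Qed.

(** * Superabundant systems *)

Section SpecialForms.

Variables (K : fieldType) (n : nat).
Hypothesis charK : [pchar K] =i pred0.
Implicit Types (mu : 'I_n -> nat) (P : 'M[K]_(n, 4)).

Lemma form_neq0 d (c : seq nat -> K) s : s \in simplex d -> c s != 0 -> form d c != 0.
Proof.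
by move=> sd; apply: contra => /eqP f0; rewrite -(mcoeff_form c sd) f0 mcoeff0.
Qed.

Lemma vanishing_form mu P d : (forall a, mu a <= d.+1)%N ->
    (\sum_a 'C(mu a + 2, 3) < 'C(d + 3, 3))%N ->
  exists f, [/\ f \is d.-homog, f != 0 & vanish_all mu P f].
Proof.
rewrite -size_conditions -size_simplex => mud lt.
have [c [[s sd cs] c0]] := underdetermined (monomial_condition P) (simplex_uniq d) lt.
exists (form d c); split; [exact: form_homog | exact: form_neq0 sd cs |].
apply/(conditions_vanish charK P mud (form_homog d c)) => x /c0.
by rewrite condition_form.
Qed.

(* A form in the ideal is determined by its coefficients outside the monomials *)
(* of a maximal minor, so one counts the multiples of [q] on which these vanish. *)
Lemma independent_multiples mu mu' P e k q :
    (forall a, mu a <= (e + k).+1)%N -> (forall a, mu' a <= e.+1)%N ->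
    q \is k.-homog -> q != 0 ->
    (forall h, vanish_all mu' P h -> vanish_all mu P (q * h)) ->
  independent mu P (e + k) ->
  ('C(e + 3, 3) + \sum_a 'C(mu a + 2, 3) <=
     'C(e + k + 3, 3) + \sum_a 'C(mu' a + 2, 3))%N.
Proof.
move=> mud mud' hq q0 qh; rewrite -!size_conditions -!size_simplex leqNgt.
set d := (e + k)%N in mud *.
move=> /indep_minor; rewrite conditions_uniq => /(_ isT)[f fd dn0].
have injf := @minor_inj _ _ _ (fun s x => monomial_condition P x s) _ _ _ dn0; set B :=
  \matrix_(i, j) _ in dn0.
have uB : B \in unitmx by rewrite unitmxE unitfE.
pose rest := [seq s <- simplex d | s \notin codom f].
have sz : (size rest + size (conditions mu) = size (simplex d))%N.
  rewrite -(count_predC (mem (codom f)) (simplex d)) addnC size_filter; congr addn.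
  rewrite -size_filter -[LHS](card_ord (size (conditions mu))) -(size_codom f).
  apply/perm_size/uniq_perm.
  - by rewrite (map_inj_uniq injf) enum_uniq.
  - by rewrite filter_uniq // simplex_uniq.
  by move=> s; rewrite mem_filter andb_idr // => /codomP[i ->].
apply/negP => lt.
pose cond (x : ('I_n * seq nat) + seq nat) (s : seq nat) : K :=
  match x with inl y => monomial_condition P y s | inr r => (q * 'X_[mon s])@_(mon r) end.
pose xs := [seq inl x | x <- conditions mu'] ++ [seq inr r | r <- rest].
have ltx : (size xs < size (simplex e))%N.
  by rewrite size_cat 2!size_map -(ltn_add2r (size (conditions mu))) -addnA sz addnC.
have [c [[s se cs] c0]] := underdetermined cond (simplex_uniq e) ltx.
have hf := form_homog e c.
have vf : vanish_all mu' P (form e c).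
  apply/(conditions_vanish charK P mud' hf) => x xc; rewrite -condition_form.
  by apply: (c0 (inl x)); rewrite mem_cat map_f.
have hqf : q * form e c \is d.-homog by rewrite /d addnC; apply: dhomogM.
pose b s := (q * form e c)@_(mon s).
have b_rest r : r \in rest -> b r = 0.
  move=> rr; have := c0 (inr r); rewrite mem_cat (map_f _ rr) orbT => /(_ isT) h.
  rewrite -[RHS]h /b /form mulr_sumr raddf_sum /=.
  by apply: eq_bigr => t _; rewrite -scalerAr mcoeffZ.
(* The product satisfies the conditions and is supported on the monomials of the invertible minor,
   so these coefficients vanish too. *)
have bf i : b (f i) = 0.
  pose u := \row_i b (f i).
  have uB0 : u *m B = 0.
    apply/rowP => j; rewrite !mxE.
    have := (conditions_vanish charK P mud hqf).2 (qh _ vf) (tnth (in_tuple (conditions mu)) j)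
      (mem_tnth _ _).
    rewrite {1}(formE hqf) -condition_form => h; rewrite -[RHS]h -/b.
    rewrite [RHS](bigID (mem (codom f))) /= [X in _ + X]big1_seq ?addr0; last first.
      by move=> t /andP[tf td]; rewrite -/(b t) b_rest ?mul0r // mem_filter tf.
    rewrite -[RHS]big_filter; transitivity (\sum_(t <- codom f)
        b t * monomial_condition P (tnth (in_tuple (conditions mu)) j) t).
      by rewrite big_map big_enum /=; apply: eq_bigr => l _; rewrite !mxE.
    apply/perm_big/uniq_perm.
    - by rewrite (map_inj_uniq injf) enum_uniq.
    - by rewrite filter_uniq // simplex_uniq.
    by move=> t; rewrite mem_filter andb_idr // => /codomP[l ->].
  have /rowP/(_ i) : u = 0 by rewrite -(mulmxK uB u) uB0 mul0mx.
  by rewrite !mxE.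
have : q * form e c = 0.
  rewrite (formE hqf) (@eq_form _ d _ (fun=> 0)) => [|t td].
    by rewrite /form big1 // => t _; rewrite scale0r.
  case: (boolP (t \in codom f)) => [/codomP[i ->]|tf]; first exact: bf.
  by apply: b_rest; rewrite mem_filter tf.
by move/eqP; rewrite mulf_eq0 (negbTE q0) (negbTE (form_neq0 se cs)).
Qed.

Definition list_degree (l : seq nat) : nat := sumn [seq 'C(m + 2, 3) | m <- l].

Lemma sum_list_degree l : size l = n -> (\sum_(a < n) 'C(nth 0 l a + 2, 3) = list_degree l)%N.
Proof.
move=> sl; rewrite /list_degree sumnE big_map (big_nth 0%N) sl.
by rewrite big_mkord.
Qed.

Lemma list_form P l d : size l = n -> all (fun m => m <= d.+1)%N l ->
    (list_degree l < 'C(d + 3, 3))%N ->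
  exists f, [/\ f \is d.-homog, f != 0 & vanish_all (fun a => nth 0%N l a) P f].
Proof.
move=> sl /allP ld lt; apply: vanishing_form; last by rewrite sum_list_degree.
by move=> a; apply: ld; rewrite mem_nth // sl.
Qed.

Lemma product_form P l1 d1 k1 l2 d2 k2 :
    [&& size l1 == n, all (fun m => m <= d1.+1)%N l1 & list_degree l1 < 'C(d1 + 3, 3)]%N ->
    [&& size l2 == n, all (fun m => m <= d2.+1)%N l2 & list_degree l2 < 'C(d2 + 3, 3)]%N ->
  exists f, [/\ f \is (d1 * k1 + d2 * k2).-homog, f != 0 &
    vanish_all (fun a => nth 0 l1 a * k1 + nth 0 l2 a * k2)%N P f].
Proof.
case/and3P=> /eqP s1 ld1 lt1 /and3P[/eqP s2 ld2 lt2].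
have [f1 [h1 n1 v1]] := list_form P s1 ld1 lt1.
have [f2 [h2 n2 v2]] := list_form P s2 ld2 lt2.
exists (f1 ^+ k1 * f2 ^+ k2); split.
- by apply: dhomogM; apply: dhomogMn.
- by rewrite mulf_neq0 ?expf_neq0.
by apply: (vanish_allM _ (vanish_allX k1 v1) (vanish_allX k2 v2)).
Qed.

End SpecialForms.

Lemma fat_degree_list ms : fat_degree ms = list_degree ms.
Proof. by rewrite /fat_degree /list_degree sumnE big_map. Qed.

Lemma fat_degree_multiplicities w x y z :
  fat_degree (multiplicities w x y z) = (35 * w + 20 * x + 10 * y + 4 * z)%N.
Proof.
rewrite fat_degree_list /list_degree /multiplicities !map_cat !sumn_cat !map_nseq !sumn_nseq.
by rewrite !addnA.
Qed.

Lemma multiplicities_le w x y z d : (5 <= d)%N -> all (fun m => m <= d)%N (multiplicities w x y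
    z).
Proof. by move=> d5; rewrite /multiplicities !all_cat !all_nseq; lia. Qed.

(** * Good and bad postulation *)

Section Postulation.

Variables (K : fieldType) (ms : seq nat).
Hypothesis charK : [pchar K] =i pred0.
Local Notation mult := (@mult_at ms).

(** Each of the two auxiliary forms has more coefficients than conditions, hence exists for every
    choice of points; the product of their powers is a nonzero section. *)
Lemma not_good_H0 d l1 d1 k1 l2 d2 k2 : ('C(d + 3, 3) <= fat_degree ms)%N ->
    [&& size l1 == size ms, all (fun m => m <= d1.+1)%N l1 & list_degree l1 < 'C(d1 + 3, 3)]%N ->
    [&& size l2 == size ms, all (fun m => m <= d2.+1)%N l2 & list_degree l2 < 'C(d2 + 3, 3)]%N ->
    all (fun a => nth 0 ms a <= nth 0 l1 a * k1 + nth 0 l2 a * k2)%N (iota 0 (size ms)) ->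
    d = (d1 * k1 + d2 * k2)%N ->
  for_general (fun P : 'M[K]_(size ms, 4) => ~ good_postulation d P).
Proof.
move=> deg h1 h2 /allP le dE; apply: for_general_always => P mP [_ /(_ deg)].
have [f [hf f0 vf]] := product_form charK P k1 k2 h1 h2; rewrite -dE in hf.
apply: (H0_nonvanishing charK mP hf f0) => a.
by apply: vanish_le (vf a); apply: le; rewrite mem_iota /=.
Qed.

(** If h^1 vanished, independence would descend from degree [d + M] to degree [d] and fix the
    dimension of the space of forms; the last numerical hypothesis says that the multiples of one
    product already exceed it. *)
Lemma not_good_H1 d e l1 d1 k1 l2 d2 k2 l M : (fat_degree ms <= 'C(d + 3, 3))%N ->
    all (fun m => m <= d.+1)%N ms -> realizable K false (simplex (d + M)) ms ->
    [&& size l1 == size ms, all (fun m => m <= d1.+1)%N l1 & list_degree l1 < 'C(d1 + 3, 3)]%N ->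
    [&& size l2 == size ms, all (fun m => m <= d2.+1)%N l2 & list_degree l2 < 'C(d2 + 3, 3)]%N ->
    (size l == size ms) && all (fun m => m <= e.+1)%N l ->
    all (fun a => nth 0 ms a <= nth 0 l1 a * k1 + nth 0 l2 a * k2 + nth 0 l a)%N (iota 0 (size
      ms)) ->
    d = (e + (d1 * k1 + d2 * k2))%N ->
    ('C(d + 3, 3) + list_degree l < 'C(e + 3, 3) + fat_degree ms)%N ->
  for_general (fun P : 'M[K]_(size ms, 4) => ~ good_postulation d P).
Proof.
move=> deg msd rz h1 h2 /andP[/eqP sl /allP le] /allP lem dE lt.
have msdM : all (fun m => m <= (d + M).+1)%N ms.
  by apply: sub_all msd => m md; apply: leq_trans md _; lia.
apply: (for_general_realizable charK msdM rz) => P mP P0 ind [/(_ deg) H1 _].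
have indd := independent_of_H1 charK mP P0 (mult_at_le msd) ind H1.
have [q [hq q0 vq]] := product_form charK P k1 k2 h1 h2.
move: (lt); rewrite ltnNge => /negP; apply; subst d.
have le_l (a : 'I_(size ms)) : (nth 0%N l a <= e.+1)%N.
  by apply: le; rewrite mem_nth // sl.
have := independent_multiples charK (mult_at_le msd) le_l hq q0 _ indd.
rewrite -fat_degree_size size_conditions (sum_list_degree sl); apply.
move=> h vh; apply: vanish_allM vq vh => a.
by apply: lem; rewrite mem_iota /=.
Qed.

Lemma good_of_realizable d : all (fun m => m <= d.+1)%N ms ->
    (forall b : bool, (if b then 'C(d + 3, 3) <= fat_degree ms
                       else fat_degree ms <= 'C(d + 3, 3))%N ->
       realizable K b (simplex d) ms) ->
  for_general (fun P : 'M[K]_(size ms, 4) => good_postulation d P).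
Proof.
move=> msd rz; have md := mult_at_le msd.
case: (leqP (fat_degree ms) 'C(d + 3, 3)) => deg; last first.
  have := rz true (ltnW deg); move/(for_general_realizable charK msd); apply.
  move=> P mP P0 ns; split; first by rewrite leqNgt deg.
  by move=> _; apply: (H0_of_nonsingular charK P0 md ns).
have := rz false deg; move/(for_general_realizable charK msd); apply.
move=> P mP P0 ind; split=> [_|deg']; first exact: (H1_of_independent charK mP P0 md ind).
apply: (H0_of_nonsingular charK P0 md).
(* When the length equals the number of monomials both vanishings are required; the matrix is
   square, so independence gives injectivity. *)
apply: (indep_square _ _ _ ind); rewrite ?conditions_uniq ?simplex_uniq //.
by rewrite size_simplex fat_degree_size; apply/eqP; rewrite eqn_leq deg deg'.
Qed.

End Postulation.

Lemma for_general_iff (K : fieldType) k (Q : 'M[K]_(k, 4) -> Prop) (b : bool) :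
  for_general (fun P => if b then Q P else ~ Q P) -> for_general (fun P => Q P <-> b).
Proof.
move=> [U [oU neU UQ]]; exists U; split=> // P mP UP; have := UQ P mP UP.
by case: b {UQ} => // nQ; split.
Qed.

Local Close Scope ring_scope.

Theorem theorem31 (K : fieldType) (charK : [pchar K]%R =i pred0)
    (w x y z : nat) :
  for_general
    (fun P : 'M[K]_(size (multiplicities w x y z), 4) =>
       good_postulation 10 P <->
       (w, x, y, z) \notin
         [:: (9, 0, 0, 0); (8, 1, 0, 0); (8, 0, 1, 1); (8, 0, 1, 0);
             (8, 0, 0, 2); (8, 0, 0, 1); (7, 2, 0, 1); (7, 1, 2, 0);
             (7, 2, 0, 0)]).
Proof.
apply: for_general_iff; case: (boolP (_ \notin _)) => [nex|].
  apply: (good_of_realizable charK) => [|b]; first exact: multiplicities_le.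
  rewrite fat_degree_multiplicities => deg.
  exact: (realizable10_nonexceptional charK nex deg).
rewrite negbK; set q9 := nseq 9 1%N.
have H0 a b c e := @not_good_H0 K (multiplicities a b c e) charK 10.
have H1 a b c e := @not_good_H1 K (multiplicities a b c e) charK 10.
have interp a b c e : dominates a b c e 8 1 1 0 ->
    realizable K false (simplex (10 + 3)) (multiplicities a b c e).
  exact: (interpolation charK).
rewrite !inE; repeat case/orP; move/eqP=> E; case: E => *; subst.
(* The fifth power of the quadric through the nine points; the second factor has exponent 0. *)
- by apply: (H0 9 0 0 0 q9 2 5 q9 2 0); rewrite ?fat_degree_multiplicities.
- by apply: (H0 8 1 0 0 q9 2 5 q9 2 0); rewrite ?fat_degree_multiplicities.
(* The cube of the quadric through the first nine points times the square of the quadric through the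
   first eight and the tenth: multiplicities 5 at the first eight, then 3 and 2. *)
- by apply: (H0 8 0 1 1 (rcons q9 0) 2 3 (nseq 8 1 ++ [:: 0; 1]) 2 2)%N;
    rewrite ?fat_degree_multiplicities.
- by apply: (H0 8 0 1 0 q9 2 5 q9 2 0); rewrite ?fat_degree_multiplicities.
- by apply: (H0 8 0 0 2 (rcons q9 0) 2 3 (nseq 8 1 ++ [:: 0; 1]) 2 2)%N;
    rewrite ?fat_degree_multiplicities.
(* Multiples of the quadric by octics with eight 4-points and a simple point: at least 165 - 161 = 4
   dimensions, against 286 - 284 = 2. *)
- apply: (H1 8 0 0 1 8 q9 2 1 q9 2 0 (nseq 8 4 ++ [:: 1]) 3)%N; rewrite ?fat_degree_multiplicities //.
  exact: interp.
(* The square of the quadric through the first nine points times a sextic with seven 3-points and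
   three 2-points, which exists since 82 < 84. *)
- by apply: (H0 7 2 0 1 (rcons q9 0) 2 2 (nseq 7 3 ++ [:: 2; 2; 2]) 6 1)%N;
    rewrite ?fat_degree_multiplicities.
(* Two quadrics share the first eight points and pass through the ninth and the tenth respectively.
   Multiplying by sextics as above gives at least 84 - 82 = 2 dimensions, against 286 - 285 = 1. *)
- apply: (H1 7 1 2 0 6 (rcons q9 0) 2 1 (nseq 8 1 ++ [:: 0; 1]) 2 1 (nseq 7 3 ++ [:: 2; 2; 2]) 3)%N;
    rewrite ?fat_degree_multiplicities //.
  exact: interp.
(* Multiples of the quadric by octics with seven 4-points and two 3-points: at least 165 - 160 = 5
   dimensions, against 286 - 285 = 1. *)
apply: (H1 7 2 0 0 8 q9 2 1 q9 2 0 (nseq 7 4 ++ [:: 3; 3]) 3)%N; rewrite ?fat_degree_multiplicities //.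
exact: interp.
Qed.
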